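(* Let $T=[T_1,\ldots,T_n]$ be a completely non-coisometric row contraction on a Hilbert space $\mathcal H$, and let $\Theta_T=\Theta_i\Theta_o$ be the inner-outer factorization of its characteristic function. This factorization induces the triangulation of type $$\begin{pmatrix}C_{\cdot0}&0\\ *&C_{\cdot1}\end{pmatrix}$$ for $T$; that is, if $\mathbf T=[\mathbf T_1,\ldots,\mathbf T_n]$ on $\mathbf H$ is the functional model of $T$ and $\mathbf H=\mathbf H_2\oplus\mathbf H_1$ is the decomposition corresponding to the regular factorization $\Theta_T=\Theta_2\Theta_1$ with $\Theta_2=\Theta_i$, $\Theta_1=\Theta_o$, then with respect to $\mathbf H=\mathbf H_2\oplus\mathbf H_1$ $$\mathbf T_j=\begin{pmatrix}\mathbf B_j&0\\ *&\mathbf A_j\end{pmatrix},\qquad j=1,\ldots,n,$$ with $[\mathbf B_1,\ldots,\mathbf B_n]$ of class $C_{\cdot0}$ and $[\mathbf A_1,\ldots,\mathbf A_n]$ of class $C_{\cdot1}$. In particular, if the inner-outer factorization of the characteristic function is non-trivial (neither $\Theta_i$ nor $\Theta_o$ is a unitary constant), then there is a non-trivial joint invariant subspace (different from $\{0\}$ and $\mathcal H$) under the operators $T_1,\ldots,T_n$.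
   Context: Conventions: $n\in\{1,2,\ldots\}$ or $n=\infty$; Hilbert spaces are complex, operators are bounded, subspaces are closed, infinite operator sums converge strongly. $H_n$ is an $n$-dimensional Hilbert space with orthonormal basis $e_1,e_2,\ldots$; $F^2(H_n)=\bigoplus_{k\ge0}H_n^{\otimes k}$ is the full Fock space ($H_n^{\otimes0}=\mathbb C1$), and $S_j\varphi=e_j\otimes\varphi$ are the left creation operators. $\mathbb F_n^+$ is the free semigroup with generators $g_1,\ldots,g_n$ and identity $g_0$; for $\alpha=g_{i_1}\cdots g_{i_k}$, $|\alpha|=k$, $e_\alpha=e_{i_1}\otimes\cdots\otimes e_{i_k}$, $T_\alpha=T_{i_1}\cdots T_{i_k}$; $|g_0|=0$, $e_{g_0}=1$, $T_{g_0}=I$. A bounded operator $A:F^2(H_n)\otimes\mathcal K\to F^2(H_n)\otimes\mathcal K'$ is multi-analytic if $A(S_j\otimes I_{\mathcal K})=(S_j\otimes I_{\mathcal K'})A$ for all $j$; its symbol is $k\mapsto A(1\otimes k)$. It is inner if it is an isometry, outer if it has dense range, and a unitary constant if $A=I\otimes W$ with $W$ unitary. Every multi-analytic operator has an essentially unique inner-outer factorization $A=A_iA_o$ with $A_o:F^2(H_n)\otimes\mathcal K\to F^2(H_n)\otimes\mathcal F$ outer and $A_i:F^2(H_n)\otimes\mathcal F\to F^2(H_n)\otimes\mathcal K'$ inner multi-analytic. $T=[T_1,\ldots,T_n]$, $T_j\in B(\mathcal H)$, is a row contraction if $\sum_jT_jT_j^*\le I$; it is also regarded as an operator $\mathcal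 H^{(n)}\to\mathcal H$. It is completely non-coisometric if the only $h\in\mathcal H$ with $\sum_{|\alpha|=k}\|T_\alpha^*h\|^2=\|h\|^2$ for all $k\ge1$ is $h=0$. It is of class $C_{\cdot0}$ if $\lim_{k\to\infty}\sum_{|\alpha|=k}\|T_\alpha^*h\|^2=0$ for every $h$, and of class $C_{\cdot1}$ if this limit is nonzero for every $h\ne0$. Put $\Delta_{T^*}=(I-\sum_jT_jT_j^* )^{1/2}$, $\Delta_T=(I-T^*T)^{1/2}$, $\mathcal D_*=\overline{\Delta_{T^*}\mathcal H}$, $\mathcal D=\overline{\Delta_T\mathcal H^{(n)}}$. The characteristic function $\Theta_T:F^2(H_n)\otimes\mathcal D\to F^2(H_n)\otimes\mathcal D_*$ is the contractive multi-analytic operator with symbol $\theta_T(h)=-1\otimes\sum_jT_jP_jh+\sum_j(S_j\otimes I_{\mathcal D_*})\big(\sum_{\alpha\in\mathbb F_n^+}e_\alpha\otimes\Delta_{T^*}T_\alpha^*P_j\Delta_Th\big)$, $h\in\mathcal D$, where $P_j$ is the projection of $\mathcal H^{(n)}$ onto its $j$-th component. Functional model (known): write $\Theta=\Theta_T$, $\mathcal E=\mathcal D$, $\mathcal E_*=\mathcal D_*$, $\Delta_\Theta=(I-\Theta^*\Theta)^{1/2}$, and let $C_j\Delta_\Theta g=\Delta_\Theta(S_j\otimes I_{\mathcal E})g$ on $\overline{\Delta_\Theta(F^2(H_n)\otimes\mathcal E)}$. A c.n.c. row contraction $T$ is unitarily equivalent to $\mathbf T=[\mathbf T_1,\ldots,\mathbf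 T_n]$ on $$\mathbf H=[(F^2(H_n)\otimes\mathcal E_* )\oplus\overline{\Delta_\Theta(F^2(H_n)\otimes\mathcal E)}]\ominus\{\Theta g\oplus\Delta_\Theta g:\ g\in F^2(H_n)\otimes\mathcal E\},$$ $\mathbf T_j^*(f\oplus u)=(S_j^*\otimes I_{\mathcal E_*})f\oplus C_j^*u$. Regular factorization: if $\Theta=\Theta_2\Theta_1$ with $\Theta_1:F^2(H_n)\otimes\mathcal E\to F^2(H_n)\otimes\mathcal F$, $\Theta_2:F^2(H_n)\otimes\mathcal F\to F^2(H_n)\otimes\mathcal E_*$ contractive multi-analytic, $\Delta_k=(I-\Theta_k^*\Theta_k)^{1/2}$ ($k=1,2$), then $X_\Theta(\Delta_\Theta f)=\Delta_2\Theta_1f\oplus\Delta_1f$ defines an isometry from $\overline{\Delta_\Theta(F^2(H_n)\otimes\mathcal E)}$ into $\overline{\Delta_2(F^2(H_n)\otimes\mathcal F)}\oplus\overline{\Delta_1(F^2(H_n)\otimes\mathcal E)}$; the factorization is regular if $X_\Theta$ is unitary (this is automatic when $\Theta_2$ is inner, since then $\Delta_2=0$). The corresponding decomposition of $\mathbf H$ is $$\mathbf H_1=\{\Theta_2f\oplus X_\Theta^*(\Delta_2f\oplus g):\ f\in F^2(H_n)\otimes\mathcal F,\ g\in\overline{\Delta_1(F^2(H_n)\otimes\mathcal E)}\}\ominus\{\Theta\varphi\oplus\Delta_\Theta\varphi:\ \varphi\in F^2(H_n)\otimes\mathcal E\}$$ (invariant under every $\mathbf T_j$) and $\mathbf H_2=\mathbf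 H\ominus\mathbf H_1$. *)

(* Defs.v *)
From HB Require Import structures.
From mathcomp Require Import all_boot all_order all_algebra.
From mathcomp Require Import finmap complex ring lra.
From mathcomp Require Import all_classical all_reals.
From mathcomp Require Import ereal topology normedtype sequences esum.
From mathcomp.analysis.showcase Require summability.
Import Order.TTheory GRing.Theory Num.Theory numFieldNormedType.Exports.
Set Implicit Arguments.
Unset Strict Implicit.
Unset Printing Implicit Defensive.
Local Open Scope classical_set_scope.
Local Open Scope ring_scope.

HB.mixin Record NormedModule_hasDot (R : realType) V & NormedModule R[i] V := {
  dot : V -> V -> R[i];
  dotDl : forall x y z, dot (x + y) z = dot x z + dot y z;
  dotZl : forall (a : R[i]) x y, dot (a *: x) y = a * dot x y;
  dotC : forall x y, dot y x = (dot x y)^*;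
  dot_norm : forall x, dot x x = `|x| ^+ 2
}.
#[short(type="preHilbertType")]
HB.structure Definition PreHilbert (R : realType) :=
  {V of NormedModule R[i] V & NormedModule_hasDot R V}.
#[short(type="hilbertType")]
HB.structure Definition Hilbert (R : realType) :=
  {V of PreHilbert R V & Complete V}.

Section ip_theory.
Variables (R : realType) (V : lmodType R[i]) (ip : V -> V -> R[i]).
Hypothesis ipDl : forall x y z, ip (x + y) z = ip x z + ip y z.
Hypothesis ipZl : forall (a : R[i]) x y, ip (a *: x) y = a * ip x y.
Hypothesis ipC : forall x y, ip y x = (ip x y)^*.
Hypothesis ip_ge0 : forall x, 0 <= ip x x.
Hypothesis ip_eq0 : forall x, ip x x = 0 -> x = 0.

Lemma ipDr x y z : ip x (y + z) = ip x y + ip x z.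
Proof. by rewrite ipC ipDl rmorphD /= -(ipC y) -(ipC z). Qed.

Lemma ipZr a x y : ip x (a *: y) = a^* * ip x y.
Proof. by rewrite ipC ipZl rmorphM /= -(ipC y). Qed.

Lemma cauchy_schwarz x y : `|ip x y| ^+ 2 <= ip x x * ip y y.
Proof.
have [y0|y0] := eqVneq (ip y y) 0.
  have -> : ip x y = 0.
    by rewrite (ip_eq0 y0) -(scale0r 0) ipZr conjC0 mul0r.
  by rewrite normr0 expr0n mulr_ge0 ?ip_ge0.
pose t := ip x y / ip y y.
have := ip_ge0 (x + (- t) *: y).
have yr : (ip y y)^* = ip y y by rewrite -ipC.
rewrite ipDl !ipDr !ipZl !ipZr (ipC x y) rmorphN rmorphM /= fmorphV /= yr.
rewrite normCK => h.
have yp : 0 < ip y y by rewrite lt_neqAle eq_sym y0 ip_ge0.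
rewrite -ler_pdivrMr // -subr_ge0.
apply: le_trans h _; rewrite le_eqVlt; apply/orP; left; apply/eqP.
by rewrite /t; field.
Qed.

End ip_theory.

HB.factory Record Lmodule_isPreHilbert (R : realType) V
    & GRing.Lmodule R[i] V := {
  ip : V -> V -> R[i];
  ipDl : forall x y z, ip (x + y) z = ip x z + ip y z;
  ipZl : forall (a : R[i]) x y, ip (a *: x) y = a * ip x y;
  ipC : forall x y, ip y x = (ip x y)^*;
  ip_ge0 : forall x, 0 <= ip x x;
  ip_eq0 : forall x, ip x x = 0 -> x = 0
}.

HB.builders Context R V & Lmodule_isPreHilbert R V.

Let nrm (x : V) : R[i] := sqrtC (ip x x).

Let nrm_ge0 x : 0 <= nrm x.
Proof. by rewrite sqrtC_ge0 ip_ge0. Qed.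

Let ler_nrmD x y : nrm (x + y) <= nrm x + nrm y.
Proof.
rewrite -(ler_pXn2r (n := 2)) ?nnegrE ?addr_ge0 ?nrm_ge0 //.
have cs : `|ip x y| <= nrm x * nrm y.
  rewrite -(ler_pXn2r (n := 2)) ?nnegrE ?mulr_ge0 ?nrm_ge0 //.
  rewrite exprMn !sqrtCK.
  exact: (cauchy_schwarz ipDl ipZl ipC ip_ge0 ip_eq0).
have re2 : ip x y + ip y x = 'Re (ip x y) *+ 2.
  by rewrite ReE -mulr_natr divfK ?pnatr_eq0 // -ipC.
have -> : nrm (x + y) ^+ 2 = nrm x ^+ 2 + 'Re (ip x y) *+ 2 + nrm y ^+ 2.
  by rewrite !sqrtCK ipDl !(ipDr ipDl ipC) -re2; ring.
rewrite sqrrD lerD2r lerD2l lerMn2r /=.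
by apply: le_trans cs; case: (leif_Re_Creal (ip x y)).
Qed.

Let nrmZ (a : R[i]) x : nrm (a *: x) = `|a| * nrm x.
Proof.
rewrite /nrm ipZl (ipZr ipZl ipC) mulrA -normCK.
by rewrite sqrtCM ?nnegrE ?exprn_ge0 ?ip_ge0 // exprCK.
Qed.

Let nrm_eq0 x : nrm x = 0 -> x = 0.
Proof. by move/eqP; rewrite sqrtC_eq0 => /eqP /ip_eq0. Qed.

HB.instance Definition _ :=
  @Lmodule_isNormed.Build R[i] V nrm ler_nrmD nrmZ nrm_eq0.

Let ip_norm x : ip x x = `|x| ^+ 2.
Proof. by rewrite -(sqrtCK (ip x x)). Qed.

HB.instance Definition _ :=
  @NormedModule_hasDot.Build R V ip ipDl ipZl ipC ip_norm.

HB.end.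

Section dot_theory.
Variables (R : realType) (V : preHilbertType R).
Implicit Types x y z : V.

Lemma dotDr x y z : dot x (y + z) = dot x y + dot x z.
Proof. exact: ipDr (@dotDl R V) (@dotC R V) x y z. Qed.

Lemma dotZr (a : R[i]) x y : dot x (a *: y) = a^* * dot x y.
Proof. exact: ipZr (@dotZl R V) (@dotC R V) a x y. Qed.

Lemma dot0l y : dot 0 y = 0.
Proof. by rewrite -(scale0r (0 : V)) dotZl mul0r. Qed.

Lemma dotNl x y : dot (- x) y = - dot x y.
Proof. by rewrite -scaleN1r dotZl mulN1r. Qed.

Lemma dotNr x y : dot x (- y) = - dot x y.
Proof. by rewrite dotC dotNl rmorphN /= -dotC. Qed.

Lemma dotBl x y z : dot (x - y) z = dot x z - dot y z.
Proof. by rewrite dotDl dotNl. Qed.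

Lemma normC_dot x y : `|dot x y| <= `|x| * `|y|.
Proof.
rewrite -(ler_pXn2r (n := 2)) ?nnegrE ?mulr_ge0 ?normr_ge0 //.
rewrite exprMn -!dot_norm; apply: cauchy_schwarz.
- exact: dotDl.
- exact: dotZl.
- exact: dotC.
- by move=> z; rewrite dot_norm exprn_ge0.
- by move=> z; rewrite dot_norm => /eqP; rewrite expf_eq0 normr_eq0 => /andP[_ /eqP].
Qed.

(** The norm takes its values in [R[i]]; [nrm2 x] is its square, in [R]. *)
Definition nrm2 x : R := complex.Re (dot x x).

Lemma nrm2E x : (nrm2 x)%:C%C = `|x| ^+ 2.
Proof.
rewrite -dot_norm /nrm2; have : 0 <= dot x x by rewrite dot_norm exprn_ge0.
by case: (dot x x) => a b; rewrite lecE /= => /andP[/eqP -> _].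
Qed.

Lemma nrm2_ge0 x : 0 <= nrm2 x.
Proof. by rewrite -(@ler0c R) nrm2E exprn_ge0. Qed.

Lemma nrm20 : nrm2 0 = 0.
Proof. by rewrite /nrm2 dot0l. Qed.

Lemma nrm2_eq0 x : nrm2 x = 0 -> x = 0.
Proof.
move=> h; have := nrm2E x; rewrite h => /esym/eqP.
by rewrite expf_eq0 /= normr_eq0 => /eqP.
Qed.

Lemma nrm2Z (a : R[i]) x :
  nrm2 (a *: x) = (complex.Re a ^+ 2 + complex.Im a ^+ 2) * nrm2 x.
Proof.
rewrite {1}/nrm2 dotZl dotZr dot_norm -nrm2E.
by case: a => u v /=; ring.
Qed.

Lemma nrm2N x : nrm2 (- x) = nrm2 x.
Proof. by rewrite -scaleN1r nrm2Z /= oppr0 expr0n sqrrN expr1n addr0 mul1r. Qed.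

Lemma nrm2D x y :
  nrm2 (x + y) = nrm2 x + nrm2 y + complex.Re (dot x y) *+ 2.
Proof.
rewrite /nrm2 dotDl !dotDr (dotC x y) !raddfD /=.
have -> : complex.Re (dot x y)^* = complex.Re (dot x y) by case: (dot x y).
by ring.
Qed.

Lemma nrm2D_le x y : nrm2 (x + y) <= nrm2 x *+ 2 + nrm2 y *+ 2.
Proof.
have := nrm2_ge0 (x - y); rewrite !nrm2D nrm2N dotNr raddfN /=.
by lra.
Qed.

Lemma Re_dot_le x y : `|complex.Re (dot x y)| <= nrm2 x + nrm2 y.
Proof.
have h (z : V) : - complex.Re (dot x z) <= nrm2 x + nrm2 z.
  have := nrm2_ge0 (x + z); rewrite nrm2D.
  by have := nrm2_ge0 x; have := nrm2_ge0 z; lra.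
rewrite ler_norml lerNl h /=; have := h (- y); rewrite nrm2N.
by rewrite dotNr raddfN opprK.
Qed.

Lemma Im_dot_le x y : `|complex.Im (dot x y)| <= nrm2 x + nrm2 y.
Proof.
have := Re_dot_le ('i%C *: x) y; rewrite nrm2Z dotZl /= expr0n expr1n add0r.
rewrite mul1r; case: (dot x y) => a b /=.
by rewrite mul0r mul1r sub0r normrN.
Qed.

Lemma norm_lt_nrm2 x (e : R) : 0 < e -> (`|x| < e%:C%C) = (nrm2 x < e ^+ 2).
Proof.
move=> e0; rewrite -(@ltcR R) nrm2E rmorphXn /=.
by rewrite ltr_pXn2r // nnegrE ?normr_ge0 // ler0c ltW.
Qed.

Lemma gt0_realC (e : R[i]) : 0 < e -> exists2 r : R, 0 < r & e = r%:C%C.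
Proof. by case: e => a b; rewrite ltcE /= => /andP[/eqP -> a0]; exists a. Qed.

Lemma nbhs_nrm2P x (A : set V) :
  nbhs x A <-> exists2 e : R, 0 < e & forall y, nrm2 (x - y) < e -> A y.
Proof.
split=> [/nbhs_normP[e /= /gt0_realC[r r0 ->] h]|[e e0 h]].
  by exists (r ^+ 2) => [|y yr]; [exact: exprn_gt0 | apply: h; rewrite /= norm_lt_nrm2].
apply/nbhs_normP; exists (Num.sqrt e)%:C%C => /=; first by rewrite ltcR sqrtr_gt0.
by move=> y /=; rewrite norm_lt_nrm2 ?sqrtr_gt0 // sqr_sqrtr ?ltW //; exact: h.
Qed.

Lemma cauchy_nrm2P (F : set_system V) : ProperFilter F ->
  cauchy F <-> forall e : R, 0 < e ->
    exists2 A, F A & forall x y, A x -> A y -> nrm2 (x - y) < e.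
Proof.
move=> FF; split=> [/cauchy_ballP cF e e0|h].
  have /cF : 0 < (Num.sqrt e)%:C%C by rewrite ltcR sqrtr_gt0.
  move=> [[A B] /= [FA FB] AB]; exists (A `&` B); first exact: filterI.
  move=> x y [Ax _] [_ By]; have /= := AB (x, y) (conj Ax By).
  by rewrite -ball_normE /= norm_lt_nrm2 ?sqrtr_gt0 // sqr_sqrtr // ltW.
apply/cauchy_ballP => _ /gt0_realC[e e0 ->].
have [A FA hA] := h _ (exprn_gt0 2 e0).
exists (A, A) => //= -[x y] /= [Ax Ay]; rewrite -ball_normE /= norm_lt_nrm2 //.
exact: hA.
Qed.

Lemma cvg_nrm2P (F : set_system V) (x : V) : Filter F ->
  (F --> x) <-> forall e : R, 0 < e -> F [set y | nrm2 (x - y) < e].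
Proof.
move=> FF; split=> [Fx e e0|h A /nbhs_nrm2P[e e0 eA]].
  by apply: Fx; apply/nbhs_nrm2P; exists e.
by apply: filterS (h e e0) => y; exact: eA.
Qed.

Lemma cvg_cauchy_nrm2 (F : set_system V) : ProperFilter F ->
  (forall G : set_system V, ProperFilter G ->
    (forall e : R, 0 < e ->
      exists2 A, G A & forall x y, A x -> A y -> nrm2 (x - y) < e) ->
    exists x, forall e : R, 0 < e -> G [set y | nrm2 (x - y) < e]) ->
  cauchy F -> cvg F.
Proof.
move=> FF h /cauchy_nrm2P cF; have [x Fx] := h F FF cF.
by apply/cvg_ex; exists x; apply/cvg_nrm2P.
Qed.

Lemma closed_dot y : closed [set x | dot x y = 0].
Proof.
move=> x clx; apply/eqP; apply: contraT => xy0.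
have y0 : 0 < `|y|.
  rewrite normr_gt0; apply: contra xy0 => /eqP ->.
  by rewrite dotC dot0l conjC0.
have d0 : 0 < `|dot x y| / `|y| by rewrite divr_gt0 // normr_gt0.
have [|z [/= z0]] := clx [set z | `|x - z| < `|dot x y| / `|y|].
  by apply/nbhs_normP; exists (`|dot x y| / `|y|).
rewrite ltr_pdivlMr // => /(le_lt_trans (normC_dot _ _)).
by rewrite dotBl z0 subr0 ltxx.
Qed.

End dot_theory.

Record csubspace (R : realType) (V : hilbertType R) := CSubspace {
  carrier :> set V;
  carrier0 : carrier 0;
  carrierP : forall (a : R[i]) x y, carrier x -> carrier y -> carrier (a *: x + y);
  carrier_closed : closed carrier
}.

Section sub_hilbert.
Variables (R : realType) (V : hilbertType R) (M : csubspace V).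

Definition in_sub : pred V := [pred x | x \in (M : set V)].

Record sub := Sub_ { sub_val : V; _ : in_sub sub_val }.

HB.instance Definition _ := [isSub for sub_val].
HB.instance Definition _ := [Choice of sub by <:].

Fact in_sub_submod : GRing.submod_closed in_sub.
Proof.
split; first exact/mem_set/carrier0.
by move=> a x y /set_mem Mx /set_mem My; apply/mem_set/carrierP.
Qed.

HB.instance Definition _ := GRing.isSubmodClosed.Build R[i] V in_sub
  in_sub_submod.
HB.instance Definition _ := [SubChoice_isSubLmodule of sub by <:].

Let ip (x y : sub) := dot (val x) (val y).

Fact sub_ipDl (x y z : sub) : ip (x + y) z = ip x z + ip y z.
Proof. exact: dotDl. Qed.
Fact sub_ipZl (a : R[i]) (x y : sub) : ip (a *: x) y = a * ip x y.
Proof. exact: dotZl. Qed.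
Fact sub_ipC (x y : sub) : ip y x = (ip x y)^*.
Proof. exact: dotC. Qed.
Fact sub_ip_ge0 (x : sub) : 0 <= ip x x.
Proof. by rewrite /ip dot_norm exprn_ge0. Qed.
Fact sub_ip_eq0 (x : sub) : ip x x = 0 -> x = 0.
Proof.
rewrite /ip dot_norm => /eqP; rewrite expf_eq0 /= normr_eq0 => /eqP x0.
exact: val_inj.
Qed.

HB.instance Definition _ := @Lmodule_isPreHilbert.Build R sub ip
  sub_ipDl sub_ipZl sub_ipC sub_ip_ge0 sub_ip_eq0.

Fact sub_complete (F : set_system sub) : ProperFilter F -> cauchy F -> cvg F.
Proof.
move=> FF; apply: cvg_cauchy_nrm2 => G GG cG.
have : cvg (val @ G).
  apply: cauchy_cvg; apply/cauchy_nrm2P => e /cG[A GA hA].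
  exists (val @` A); first by apply: (@filterS _ G _ A) => // x Ax; exists x.
  by move=> _ _ [x Ax <-] [y Ay <-]; have := hA _ _ Ax Ay.
move=> /cvg_ex[l /cvg_nrm2P hl].
have Ml : in_sub l.
  apply/mem_set/carrier_closed => B /nbhs_nrm2P[e e0 eB].
  have [x xe] := @filter_ex _ G _ _ (hl e e0).
  by exists (val x); split; [exact/set_mem/valP | exact: eB].
by exists (Sub l Ml : sub) => e e0; have := hl e e0.
Qed.

HB.instance Definition _ := Uniform_isComplete.Build sub sub_complete.

End sub_hilbert.

(** An alias of the product type: the norm of [U * V] is the sup norm. *)
Definition hprod (R : realType) (U V : hilbertType R) : Type := (U * V)%type.

Section hprod_hilbert.
Variables (R : realType) (U V : hilbertType R).

HB.instance Definition _ := GRing.Lmodule.copy (hprod U V) (U * V)%type.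

Let ip (x y : hprod U V) := dot x.1 y.1 + dot x.2 y.2.

Fact hprod_ipDl (x y z : hprod U V) : ip (x + y) z = ip x z + ip y z.
Proof. by rewrite /ip !dotDl addrACA. Qed.
Fact hprod_ipZl (a : R[i]) (x y : hprod U V) : ip (a *: x) y = a * ip x y.
Proof. by rewrite /ip !dotZl mulrDr. Qed.
Fact hprod_ipC (x y : hprod U V) : ip y x = (ip x y)^*.
Proof. by rewrite /ip rmorphD /= -!dotC. Qed.
Fact hprod_ip_ge0 (x : hprod U V) : 0 <= ip x x.
Proof. by rewrite /ip !dot_norm addr_ge0 // exprn_ge0. Qed.
Fact hprod_ip_eq0 (x : hprod U V) : ip x x = 0 -> x = 0.
Proof.
rewrite /ip !dot_norm => /eqP; rewrite paddr_eq0 ?exprn_ge0 //.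
rewrite !expf_eq0 /= !normr_eq0; case: x => x1 x2 /=.
by move=> /andP[/eqP -> /eqP ->].
Qed.

HB.instance Definition _ := @Lmodule_isPreHilbert.Build R (hprod U V) ip
  hprod_ipDl hprod_ipZl hprod_ipC hprod_ip_ge0 hprod_ip_eq0.

Lemma nrm2_hprod (x : hprod U V) : nrm2 x = nrm2 x.1 + nrm2 x.2.
Proof. by rewrite /nrm2 -raddfD. Qed.

Fact hprod_complete (F : set_system (hprod U V)) :
  ProperFilter F -> cauchy F -> cvg F.
Proof.
move=> FF; apply: cvg_cauchy_nrm2 => G GG cG.
have : cvg (fst @ G).
  apply: cauchy_cvg; apply/cauchy_nrm2P => e /cG[A GA hA].
  exists (fst @` A); first by apply: (@filterS _ G _ A) => // x Ax; exists x.
  move=> _ _ [x Ax <-] [y Ay <-]; apply: le_lt_trans (hA _ _ Ax Ay).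
  by rewrite nrm2_hprod lerDl nrm2_ge0.
have : cvg (snd @ G).
  apply: cauchy_cvg; apply/cauchy_nrm2P => e /cG[A GA hA].
  exists (snd @` A); first by apply: (@filterS _ G _ A) => // x Ax; exists x.
  move=> _ _ [x Ax <-] [y Ay <-]; apply: le_lt_trans (hA _ _ Ax Ay).
  by rewrite nrm2_hprod lerDr nrm2_ge0.
move=> /cvg_ex[l2 /cvg_nrm2P h2] /cvg_ex[l1 /cvg_nrm2P h1].
exists (l1, l2) => e e0; have e20 : 0 < e / 2 by rewrite divr_gt0.
apply: (@filterS _ G _ (fst @^-1` [set y | nrm2 (l1 - y) < e / 2] `&`
                        snd @^-1` [set y | nrm2 (l2 - y) < e / 2])).
  by move=> x [/= x1 x2]; rewrite nrm2_hprod (splitr e) ltrD.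
by apply: filterI; [exact: h1 | exact: h2].
Qed.

HB.instance Definition _ := Uniform_isComplete.Build (hprod U V) hprod_complete.

End hprod_hilbert.

(** Unordered sums [\sum_(i : I) x i]: limits of the finite partial sums along
    the directed set of finite subsets of [I]. *)
Notation psum x := (summability.partial_sum x).
Notation finsets := summability.totally.
Notation usum := summability.sum.

#[global] Existing Instance summability.totally_filter.

Lemma psumE (I : choiceType) (V : zmodType) (x : I -> V) (A : {fset I}) :
  psum x A = \sum_(i <- A) x i.
Proof. by rewrite /summability.partial_sum [RHS]big_seq_fsetE. Qed.

Section usum_real.
Variables (R : realType) (I : choiceType).
Implicit Types (x y : I -> R).

Lemma sub_fset_sum_le x (A B : {fset I}) : (A `<=` B)%fset ->
  (forall i, 0 <= x i) -> \sum_(i <- A) x i <= \sum_(i <- B) x i.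
Proof.
move=> AB x0.
rewrite [leRHS](big_fsetID _ (mem A)) /=.
have -> : [fset i in B | i \in A]%fset = A.
  by apply/fsetP => i; rewrite !inE andbC; case: (boolP (i \in A)) => //= /(fsubsetP AB).
by rewrite lerDl sumr_ge0.
Qed.

Lemma is_cvg_psum_ge0 x (M : R) : (forall i, 0 <= x i) ->
  (forall A : {fset I}, \sum_(i <- A) x i <= M) -> cvg (psum x @ finsets).
Proof.
move=> x0 xM.
pose S := [set \sum_(i <- A) x i | A in @setT {fset I}].
have hS : has_sup S.
  split; first by exists (\sum_(i <- fset0) x i); exists fset0.
  by exists M => _ [A _ <-].
apply/cvg_ex; exists (sup S); apply/cvgrPdist_lt => e e0.
have [_ [A _ <-] hA] := sup_adherent e0 hS.
exists A => // B /= AB; rewrite psumE.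
have SB : \sum_(i <- B) x i <= sup S by apply: ub_le_sup; [case: hS | exists B].
rewrite ger0_norm ?subr_ge0 //.
by have := sub_fset_sum_le AB x0; move: hA SB; lra.
Qed.

Lemma is_cvg_psum x (M : R) :
  (forall A : {fset I}, \sum_(i <- A) `|x i| <= M) -> cvg (psum x @ finsets).
Proof.
move=> xM.
have -> : psum x = psum (fun i => `|x i| + x i) \- psum (fun i => `|x i|).
  apply/funext => A; rewrite /= !psumE -sumrB.
  by apply: eq_bigr => i _; rewrite addrAC subrr add0r.
apply: is_cvgB; last exact: is_cvg_psum_ge0 xM.
apply: (@is_cvg_psum_ge0 _ (M + M)) => [i|A].
  by have := ler_norm (- x i); rewrite normrN; lra.
by rewrite big_split lerD //; apply: le_trans (xM A); exact: ler_sum (fun i _ => ler_norm _).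
Qed.

Lemma usumD x y : cvg (psum x @ finsets) -> cvg (psum y @ finsets) ->
  usum (fun i => x i + y i) = usum x + usum y.
Proof.
move=> cx cy; apply/cvg_lim => //.
have -> : psum (fun i => x i + y i) = psum x \+ psum y.
  by apply/funext => A; rewrite /= !psumE big_split.
exact: cvgD.
Qed.

Lemma is_cvg_psumZ (a : R) x : cvg (psum x @ finsets) ->
  cvg (psum (fun i => a * x i) @ finsets).
Proof.
move=> cx.
have -> : psum (fun i => a * x i) = (fun A => a * psum x A).
  by apply/funext => A; rewrite /= !psumE mulr_sumr.
exact: is_cvgMl_tmp.
Qed.

Lemma usumZ (a : R) x : cvg (psum x @ finsets) ->
  usum (fun i => a * x i) = a * usum x.
Proof.
move=> cx; apply/cvg_lim => //.
have -> : psum (fun i => a * x i) = (fun A => a * psum x A).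
  by apply/funext => A; rewrite /= !psumE mulr_sumr.
exact: cvgMl_tmp.
Qed.

Lemma psum_le_usum x (M : R) (A : {fset I}) : (forall i, 0 <= x i) ->
  (forall A : {fset I}, \sum_(i <- A) x i <= M) ->
  \sum_(i <- A) x i <= usum x.
Proof.
move=> x0 xM; apply: limr_ge; first exact: is_cvg_psum_ge0 xM.
by exists A => // B /= AB; rewrite psumE; exact: sub_fset_sum_le.
Qed.

Lemma usum_le x (M : R) : (forall i, 0 <= x i) ->
  (forall A : {fset I}, \sum_(i <- A) x i <= M) -> usum x <= M.
Proof.
move=> x0 xM; apply: limr_le; first exact: is_cvg_psum_ge0 xM.
by exists fset0 => // B _ /=; rewrite psumE.
Qed.

End usum_real.

Section l2_hilbert.
Variables (R : realType) (I : choiceType) (K : hilbertType R).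

Definition square_summable (f : I -> K) : Prop :=
  exists M : R, forall A : {fset I}, \sum_(i <- A) nrm2 (f i) <= M.

Definition in_l2 : pred (I -> K) := [pred f | `[< square_summable f >]].

Record l2 := L2 { l2_val :> I -> K; _ : in_l2 l2_val }.

HB.instance Definition _ := [isSub for l2_val].
HB.instance Definition _ := [Choice of l2 by <:].

Lemma l2P (f : l2) : square_summable f.
Proof. exact/asboolP/(valP f). Qed.

Fact in_l2_submod : GRing.submod_closed in_l2.
Proof.
split=> [|a f g /asboolP[M fM] /asboolP[N gN]]; apply/asboolP.
  by exists 0 => A; rewrite big1 // => i _; exact: nrm20.
pose c := complex.Re a ^+ 2 + complex.Im a ^+ 2.
exists (c * M *+ 2 + N *+ 2) => A.
apply: (@le_trans _ _ (\sum_(i <- A) (c * nrm2 (f i) *+ 2 + nrm2 (g i) *+ 2))).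
  by apply: ler_sum => i _; apply: le_trans (nrm2D_le _ _) _; rewrite nrm2Z.
rewrite big_split /= !sumrMnl -mulr_sumr lerD // lerMn2r //=.
by rewrite ler_wpM2l // addr_ge0 ?sqr_ge0.
Qed.

HB.instance Definition _ := GRing.isSubmodClosed.Build R[i] (I -> K) in_l2
  in_l2_submod.
HB.instance Definition _ := [SubChoice_isSubLmodule of l2 by <:].

Let re (f g : l2) i := complex.Re (dot (f i) (g i)).
Let im (f g : l2) i := complex.Im (dot (f i) (g i)).

(** [\sum_i dot (f i) (g i)], summed componentwise. *)
Definition l2_dot (f g : l2) : R[i] := (usum (re f g) +i* usum (im f g))%C.

Let cvg_re f g : cvg (psum (re f g) @ finsets).
Proof.
have [M fM] := l2P f; have [N gN] := l2P g.
apply: (@is_cvg_psum _ _ _ (M + N)) => A; apply: le_trans (lerD (fM A) (gN A)).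
by rewrite -big_split; apply: ler_sum => i _; exact: Re_dot_le.
Qed.

Let cvg_im f g : cvg (psum (im f g) @ finsets).
Proof.
have [M fM] := l2P f; have [N gN] := l2P g.
apply: (@is_cvg_psum _ _ _ (M + N)) => A; apply: le_trans (lerD (fM A) (gN A)).
by rewrite -big_split; apply: ler_sum => i _; exact: Im_dot_le.
Qed.

Fact l2_dotDl (x y z : l2) : l2_dot (x + y) z = l2_dot x z + l2_dot y z.
Proof.
have hre : re (x + y) z = fun i => re x z i + re y z i.
  by apply/funext => i; rewrite /re dotDl raddfD.
have him : im (x + y) z = fun i => im x z i + im y z i.
  by apply/funext => i; rewrite /im dotDl raddfD.
by rewrite /l2_dot hre him !usumD.
Qed.

Fact l2_dotZl (a : R[i]) (x y : l2) : l2_dot (a *: x) y = a * l2_dot x y.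
Proof.
case: a => u v.
have hre : re ((u +i* v)%C *: x) y = fun i => u * re x y i + (- v) * im x y i.
  apply/funext => i; rewrite /re /im dotZl.
  by case: (dot (x i) (y i)) => b c /=; rewrite mulNr.
have him : im ((u +i* v)%C *: x) y = fun i => u * im x y i + v * re x y i.
  apply/funext => i; rewrite /re /im dotZl.
  by case: (dot (x i) (y i)).
rewrite /l2_dot hre him !usumD ?usumZ //; try exact: is_cvg_psumZ.
by rewrite mulNr (addrC (u * usum (im x y))); congr (_ +i* _)%C; rewrite addrC.
Qed.

Fact l2_dotC (x y : l2) : l2_dot y x = (l2_dot x y)^*.
Proof.
have hre : re y x = re x y.
  by apply/funext => i; rewrite /re dotC; case: (dot _ _).
have him : im y x = fun i => (- 1) * im x y i.
  by apply/funext => i; rewrite /im dotC mulN1r; case: (dot _ _).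
by rewrite /l2_dot hre him usumZ // mulN1r.
Qed.

Let Re_l2_dot (f : l2) : complex.Re (l2_dot f f) = usum (fun i => nrm2 (f i)).
Proof. by []. Qed.

Let Im_l2_dot (f : l2) : complex.Im (l2_dot f f) = 0.
Proof.
rewrite /= (_ : im f f = fun i => 0 * im f f i) ?usumZ ?mul0r //.
apply/funext => i; rewrite mul0r /im dot_norm -nrm2E.
by [].
Qed.

Lemma nrm2_le_l2 (f : l2) (A : {fset I}) :
  \sum_(i <- A) nrm2 (f i) <= complex.Re (l2_dot f f).
Proof.
have [M fM] := l2P f; rewrite Re_l2_dot.
exact: (@psum_le_usum _ _ (fun i => nrm2 (f i)) M) (fun i => nrm2_ge0 _) fM.
Qed.

Lemma l2_nrm2_le (f : l2) (M : R) :
  (forall A : {fset I}, \sum_(i <- A) nrm2 (f i) <= M) ->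
  complex.Re (l2_dot f f) <= M.
Proof. by move=> fM; rewrite Re_l2_dot; apply: usum_le => // i; exact: nrm2_ge0. Qed.

Fact l2_dot_ge0 (x : l2) : 0 <= l2_dot x x.
Proof.
rewrite lecE Im_l2_dot eqxx /=.
by have := nrm2_le_l2 x fset0; rewrite big_seq_fset0.
Qed.

Fact l2_dot_eq0 (x : l2) : l2_dot x x = 0 -> x = 0.
Proof.
move=> x0; apply/val_inj/funext => i; apply/nrm2_eq0/le_anti.
rewrite nrm2_ge0 andbT.
by have := nrm2_le_l2 x [fset i]%fset; rewrite big_seq_fset1 x0.
Qed.

HB.instance Definition _ := @Lmodule_isPreHilbert.Build R l2 l2_dot
  l2_dotDl l2_dotZl l2_dotC l2_dot_ge0 l2_dot_eq0.

Lemma nrm2_coord_le (f : l2) i : nrm2 (f i) <= nrm2 f.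
Proof. by have := nrm2_le_l2 f [fset i]%fset; rewrite big_seq_fset1. Qed.

Fact l2_complete (F : set_system l2) : ProperFilter F -> cauchy F -> cvg F.
Proof.
move=> FF; apply: cvg_cauchy_nrm2 => G GG cG.
have cv : forall i : I, exists x : K, (fun f : l2 => f i) @ G --> x.
  move=> i.
  suff /cvg_ex : cvg ((fun f : l2 => f i) @ G) by [].
  apply: cauchy_cvg; apply/cauchy_nrm2P => e /cG[A GA hA].
  exists ((fun f : l2 => f i) @` A).
    by apply: (@filterS _ G _ A) => // x Ax; exists x.
  move=> _ _ [x Ax <-] [y Ay <-]; apply: le_lt_trans (hA _ _ Ax Ay).
  exact: (nrm2_coord_le (x - y)).
have [l hl] := choice cv.
have key (e : R) B f : 0 < e -> (forall x y, B x -> B y -> nrm2 (x - y) < e) ->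
    G B -> B f -> forall A : {fset I}, \sum_(i <- A) nrm2 (l i - f i) <= e *+ 4.
  move=> e0 hB GB Bf A.
  pose d := e / (#|` A|%:R + 1).
  have d0 : 0 < d by rewrite divr_gt0 // ltr_wpDl.
  have : G (B `&` [set g | forall i, i \in A -> nrm2 (l i - g i) < d]).
    apply: filterI => //.
    apply: (@filter_bigI _ _ A (fun i => [set g : l2 | nrm2 (l i - g i) < d])).
    by move=> i _; move/cvg_nrm2P : (hl i); apply.
  move=> /(@filter_ex _ G)[g [Bg gd]].
  apply: (@le_trans _ _
    (\sum_(i <- A) (nrm2 (l i - g i) *+ 2 + nrm2 (g i - f i) *+ 2))).
    by apply: ler_sum => i _; apply: le_trans (nrm2D_le _ _); rewrite addrA subrK.
  rewrite big_split /= !sumrMnl (mulrnDr e 2 2) lerD // lerMn2r /=.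
    apply: (@le_trans _ _ (\sum_(i <- A) d)).
      by rewrite big_seq [leRHS]big_seq; apply: ler_sum => i /gd /ltW.
    rewrite big_const_seq count_predT iter_addr_0.
    rewrite -mulr_natr /d mulrAC ler_pdivrMr ?ltr_wpDl //.
    by rewrite ler_wpM2l ?lerDl // ltW.
  by apply: le_trans (ltW (hB _ _ Bg Bf)); exact: (nrm2_le_l2 (g - f)).
have [B0 GB0 hB0] := cG 1 ltr01; have [f0 Bf0] := @filter_ex _ G _ _ GB0.
have l_l2 : in_l2 l.
  apply/asboolP; have [M fM] := l2P f0.
  exists ((1 *+ 4) *+ 2 + M *+ 2) => A.
  apply: (@le_trans _ _ (\sum_(i <- A) (nrm2 (l i - f0 i) *+ 2 + nrm2 (f0 i) *+ 2))).
    by apply: ler_sum => i _; apply: le_trans (nrm2D_le _ _); rewrite subrK.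
  rewrite big_split /= !sumrMnl lerD // lerMn2r //=.
  exact: key hB0 GB0 Bf0 A.
exists (Sub l l_l2 : l2) => e e0.
have e80 : 0 < e / 8 by rewrite divr_gt0.
have [B GB hB] := cG _ e80.
apply: (@filterS _ G _ B) => // f Bf.
apply: (@le_lt_trans _ _ (e / 8 *+ 4)); last by rewrite -mulr_natr; lra.
by apply: (@l2_nrm2_le (Sub l l_l2 - f)) => A; exact: key hB GB Bf A.
Qed.

HB.instance Definition _ := Uniform_isComplete.Build l2 l2_complete.

End l2_hilbert.

Record bop (R : realType) (U V : hilbertType R) := Bop {
  bop_lin :> {linear U -> V};
  bop_continuous : continuous bop_lin
}.

Section bop_instances.
Variables (R : realType) (U V : hilbertType R).

HB.instance Definition _ := gen_eqMixin (bop U V).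
HB.instance Definition _ := gen_choiceMixin (bop U V).

Definition bop0 : bop U V := @Bop R U V \0 (fun x => @cst_continuous U V 0 x).

HB.instance Definition _ := isPointed.Build (bop U V) bop0.

End bop_instances.

Section bop_comp.
Variables (R : realType) (U V W : hilbertType R).

Definition bop_comp (B : bop V W) (A : bop U V) : bop U W :=
  @Bop R U W (B \o A)
    (fun x => continuous_comp (@bop_continuous _ _ _ A x)
                              (@bop_continuous _ _ _ B (A x))).

End bop_comp.

(** Below, an operator that the mathematics characterizes uniquely is the
    operator [get P] picked from the set [P] of operators with that
    characterization. *)

Section operators.
Variables (R : realType) (U V : hilbertType R).

Definition adj (A : U -> V) : bop V U :=
  get [set B : bop V U | forall x y, dot (A x) y = dot x (B y)].

Definition positive (A : U -> U) : Prop := forall x, 0 <= dot (A x) x.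

Definition sqrt_op (A : U -> U) : bop U U :=
  get [set B : bop U U | positive B /\ forall x, B (B x) = A x].

Definition contraction (A : U -> V) : Prop := forall x, `|A x| <= `|x|.

Definition isometric (A : U -> V) : Prop := forall x, `|A x| = `|x|.

Definition unitary (A : U -> V) : Prop :=
  isometric A /\ forall y, exists x, A x = y.

(** [defect A] is [(I - A^* A)^(1/2)]. *)
Definition defect (A : U -> V) : bop U U := sqrt_op (fun x => x - adj A (A x)).

End operators.

Section csubspaces.
Variables (R : realType) (V : hilbertType R).
Implicit Types (M : csubspace V) (A N : set V).

Definition fullsp : csubspace V :=
  @CSubspace R V setT I (fun _ _ _ _ _ => I) closedT.

Definition clspan_set A : set V :=
  [set x | forall M, A `<=` M -> carrier M x].

Fact clspan0 A : clspan_set A 0.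
Proof. by move=> M _; exact: carrier0. Qed.

Fact clspanP A (a : R[i]) x y :
  clspan_set A x -> clspan_set A y -> clspan_set A (a *: x + y).
Proof. by move=> hx hy M AM; apply: carrierP; [exact: hx | exact: hy]. Qed.

Fact clspan_closed A : closed (clspan_set A).
Proof.
move=> x clx M AM; apply: carrier_closed => B /clx[y [yA By]].
by exists y; split=> //; exact: yA.
Qed.

Definition clspan A : csubspace V :=
  @CSubspace R V (clspan_set A) (@clspan0 A) (@clspanP A) (@clspan_closed A).

Lemma clspan_closure A : A 0 ->
  (forall (a : R[i]) x y, A x -> A y -> A (a *: x + y)) ->
  clspan A = closure A :> set V.
Proof.
move=> A0 AP; apply/seteqP; split=> x.
  have c0 : closure A 0 by exact: subset_closure.
  have cP (a : R[i]) y z :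
      closure A y -> closure A z -> closure A (a *: y + z).
    move=> cy cz B.
    have : (fun p : V * V => a *: p.1 + p.2) @ (y, z) --> a *: y + z.
      apply: cvgD; last exact: cvg_snd.
      by apply: cvgZl_tmp; exact: cvg_fst.
    move=> /[apply] -[[B1 B2] /= [/cy[y' [Ay' By']] /cz[z' [Az' Bz']]] sB].
    by exists (a *: y' + z'); split; [exact: AP | exact: (sB (y', z'))].
  pose M := @CSubspace R V (closure A) c0 cP (@closed_closure _ A).
  by move=> /(_ M (@subset_closure _ A)).
by move=> clx M AM; apply: carrier_closed => B /clx[y [Ay By]]; exists y; split=> //; exact: AM.
Qed.

(** [ominus M N] is [M] minus [N]: the vectors of [M] orthogonal to [N]. *)
Definition ominus_set M N : set V :=
  [set x | carrier M x /\ forall y, N y -> dot x y = 0].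

Fact ominus0 M N : ominus_set M N 0.
Proof. by split=> [|y _]; [exact: carrier0 | exact: dot0l]. Qed.

Fact ominusP M N (a : R[i]) x y :
  ominus_set M N x -> ominus_set M N y -> ominus_set M N (a *: x + y).
Proof.
move=> [Mx Nx] [My Ny]; split=> [|z Nz]; first exact: carrierP.
by rewrite dotDl dotZl Nx // Ny // mulr0 addr0.
Qed.

Fact ominus_closed M N : closed (ominus_set M N).
Proof.
move=> x clx; split=> [|y Ny].
  by apply: carrier_closed => B /clx[z [[Mz _] Bz]]; exists z.
by apply: closed_dot => B /clx[z [[_ Nz] Bz]]; exists z; split=> //; exact: Nz.
Qed.

Definition ominus M N : csubspace V := @CSubspace R V (ominus_set M N)
  (@ominus0 M N) (@ominusP M N) (@ominus_closed M N).

Variable M : csubspace V.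

Fact incl_linear : linear (val : sub M -> V).
Proof. by []. Qed.

HB.instance Definition _ :=
  GRing.isLinear.Build R[i] (sub M) V *:%R (@sub_val R V M) incl_linear.

Fact incl_continuous : continuous (@sub_val R V M).
Proof.
move=> x A /nbhs_nrm2P[e e0 eA]; apply/nbhs_nrm2P.
by exists e => // y ye; exact: eA.
Qed.

Definition incl : bop (sub M) V := @Bop R (sub M) V (@sub_val R V M)
  incl_continuous.

(** The orthogonal projection onto [M], as an operator with values in [M]. *)
Definition proj : bop V (sub M) :=
  get [set P : bop V (sub M) |
        forall x (z : sub M), dot (x - val (P x)) (val z) = 0].

(** A closed subspace [L], intersected with [M] and seen inside the space
    [sub M]. *)
Definition within_set (L : csubspace V) : set (sub M) := [set x | carrier L (val x)].

Fact within0 L : within_set L 0.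
Proof. exact: carrier0. Qed.

Fact withinP L (a : R[i]) x y :
  within_set L x -> within_set L y -> within_set L (a *: x + y).
Proof. exact: carrierP. Qed.

Fact within_closed L : closed (within_set L).
Proof.
move=> x clx; apply: carrier_closed => B /incl_continuous /clx[y [Ly By]].
by exists (val y).
Qed.

Definition within L : csubspace (sub M) := @CSubspace R (sub M) (within_set L)
  (@within0 L) (@withinP L) (@within_closed L).

End csubspaces.

Section clrange.
Variables (R : realType) (U V : hilbertType R) (A : bop U V).

(** The closure of the range of [A] (see [clspan_closure]). *)
Definition clrange : csubspace V := clspan (range A).

Fact in_clrange x : in_sub clrange (A x).
Proof. by apply/mem_set => M; apply; exists x. Qed.

Definition to_clrange (x : U) : sub clrange := Sub_ (in_clrange x).

End clrange.

(** The entry [P_N A |_ M] of the matrix of [A]. *)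
Definition block (R : realType) (V : hilbertType R) (N M : csubspace V)
    (A : bop V V) : bop (sub M) (sub N) :=
  bop_comp (proj N) (bop_comp A (incl M)).

(** [fock J K] is the Hilbert tensor product of the full Fock space over
    a Hilbert space with orthonormal basis [e_j], [j : J], with [K].  The free
    semigroup on [J] is [seq J]; as the [e_alpha], [alpha : seq J], form an
    orthonormal basis of the full Fock space, a vector of the tensor product is
    given by its square summable family of coefficients: [f] stands for
    [\sum_alpha e_alpha (x) f alpha]. *)
Notation fock J K := (l2 (seq J) K).

Section fock.
Variables (R : realType) (J : choiceType) (K : hilbertType R).

Definition tens_fun (a : seq J) (k : K) : seq J -> K :=
  fun b => if b == a then k else 0.

Fact tens_in_l2 a k : in_l2 (tens_fun a k).
Proof.
apply/asboolP; exists (nrm2 k) => A.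
have [aA|aA] := boolP (a \in A).
  rewrite (big_fsetD1 a) //= big_seq big1 => [|b].
    by rewrite addr0 /tens_fun eqxx.
  by rewrite !inE /tens_fun => /andP[/negPf -> _]; rewrite nrm20.
rewrite big_seq big1 ?nrm2_ge0 // => b bA; rewrite /tens_fun.
by case: eqP => [ba|]; [rewrite -ba bA in aA | rewrite nrm20].
Qed.

Definition tens (a : seq J) (k : K) : fock J K := L2 (tens_in_l2 a k).

Definition shift_fun (j : J) (f : seq J -> K) : seq J -> K :=
  fun a => if a is i :: b then (if i == j then f b else 0) else 0.

Fact shift_in_l2 j (f : fock J K) : in_l2 (shift_fun j f).
Proof.
apply/asboolP; have [M fM] := l2P f; exists M => A.
pose B := [fset a in A | ohead a == Some j]%fset.
apply: le_trans (fM [fset behead a | a in B]%fset).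
rewrite big_imfset /=; last first.
  move=> [|i a] [|i' b]; rewrite !inE /= ?andbF //.
  move=> /andP[_ /eqP ij] /andP[_ /eqP i'j] ->.
  by case: ij => ->; case: i'j => ->.
rewrite [leLHS](big_fsetID _ (fun a => ohead a == Some j)) /=.
rewrite [X in _ + X]big_seq [X in _ + X]big1 ?addr0.
  rewrite big_seq [leRHS]big_seq; apply: ler_sum => -[|i a].
    by rewrite !inE /= andbF.
  by rewrite !inE /= => /andP[_ /eqP ij]; case: ij => ->; rewrite eqxx.
move=> [|i a]; rewrite !inE /= ?nrm20 // => /andP[_].
by have [->|ij] := eqVneq i j; rewrite ?eqxx ?nrm20.
Qed.

(** [S_j] tensored with the identity of [K]: as [S_j e_b = e_(j :: b)], the
    coefficient of [e_b] is moved to [e_(j :: b)]. *)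
Definition shift (j : J) (f : fock J K) : fock J K := L2 (shift_in_l2 j f).

End fock.

Section multi_analytic.
Variables (R : realType) (J : choiceType) (K K' : hilbertType R).
Variable A : bop (fock J K) (fock J K').

Definition multi_analytic : Prop := forall j f, A (shift j f) = shift j (A f).

Definition inner : Prop := isometric A.

Definition outer : Prop := dense (range A).

Definition unitary_constant : Prop :=
  exists W : bop K K', unitary W /\ forall f a, A f a = W (f a).

End multi_analytic.

(** [idx n] is the set of indices of [T_1, ..., T_n], with [n = oo] encoded as
    [None]. *)
Definition idx (n : option nat) : choiceType :=
  if n is Some m return choiceType then 'I_m else nat.

Section row_contractions.
Variables (R : realType) (J : choiceType) (H : hilbertType R).
Variable T : J -> bop H H.

Definition rowTT (h : H) : H := usum (fun j => T j (adj (T j) h)).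

Definition row_contraction : Prop :=
  (forall h, cvg (psum (fun j => T j (adj (T j) h)) @ finsets)) /\
  positive (fun h => h - rowTT h).

Definition word_op (a : seq J) : H -> H := foldr (fun j A => T j \o A) id a.

Definition word_sum (k : nat) (h : H) : \bar R :=
  \esum_(a in [set a : seq J | size a = k]) (nrm2 (adj (word_op a) h))%:E.

Definition cnc : Prop :=
  forall h, (forall k, (1 <= k)%N -> word_sum k h = (nrm2 h)%:E) -> h = 0.

Definition class_C0 : Prop :=
  row_contraction /\ forall h, word_sum ^~ h @ \oo --> 0%E.

Definition class_C1 : Prop :=
  row_contraction /\ forall h, h != 0 ->
    exists2 l : \bar R, l != 0%E & word_sum ^~ h @ \oo --> l.

Definition row_op (h : l2 J H) : H := usum (fun j => T j (h j)).

Definition DeltaTs : bop H H := sqrt_op (fun h => h - rowTT h).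
Definition DeltaT : bop (l2 J H) (l2 J H) := defect row_op.

Definition Dstar : csubspace H := clrange DeltaTs.
Definition Dspace : csubspace (l2 J H) := clrange DeltaT.

(** The symbol of the characteristic function, with values in [fock J H]
    rather than [fock J (sub Dstar)]: that the coefficients lie in [Dstar] when
    [h] is in [Dspace] is clear for all but the first, and follows from
    [T DeltaT = DeltaTs T] for that one. *)
Definition symbol (h : l2 J H) : fock J H :=
  - tens [::] (row_op h) +
  usum (fun j => shift j
    (usum (fun a => tens a (DeltaTs (adj (word_op a) (DeltaT h j)))))).

Definition charfun : bop (fock J (sub Dspace)) (fock J (sub Dstar)) :=
  get [set Theta : bop (fock J (sub Dspace)) (fock J (sub Dstar)) |
    [/\ multi_analytic Theta, contraction Theta &
        forall (h : sub Dspace) a,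
          val (Theta (tens [::] h) a) = symbol (val h) a]].

End row_contractions.

Section model.
Variables (R : realType) (J : choiceType) (E Es : hilbertType R).
Variable Theta : bop (fock J E) (fock J Es).

Notation Delta := (defect Theta).

Definition dilation_space : hilbertType R := hprod (fock J Es) (sub (clrange Delta)).

Definition graph : set dilation_space :=
  [set x | exists g, x = (Theta g, to_clrange Delta g)].

Definition model_space : csubspace dilation_space :=
  ominus (fullsp _) graph.

Definition residual_shift (j : J) :
    bop (sub (clrange Delta)) (sub (clrange Delta)) :=
  get [set C : bop (sub (clrange Delta)) (sub (clrange Delta)) |
    forall g, C (to_clrange Delta g) = to_clrange Delta (shift j g)].

Definition model_op (j : J) : bop (sub model_space) (sub model_space) :=
  get [set A : bop (sub model_space) (sub model_space) |
    forall x : sub model_space, val (adj A x) =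
      (adj (@shift R J Es j) (val x).1, adj (residual_shift j) (val x).2)].

Variables (F : hilbertType R).
Variables (Theta2 : bop (fock J F) (fock J Es))
          (Theta1 : bop (fock J E) (fock J F)).

Notation Delta2 := (defect Theta2).
Notation Delta1 := (defect Theta1).

Definition fact_iso : bop (sub (clrange Delta))
    (hprod (sub (clrange Delta2)) (sub (clrange Delta1))) :=
  get [set X : bop (sub (clrange Delta))
                   (hprod (sub (clrange Delta2)) (sub (clrange Delta1))) |
    forall f, X (to_clrange Delta f) =
      (to_clrange Delta2 (Theta1 f), to_clrange Delta1 f)].

Definition fact_set : set dilation_space :=
  [set x | exists (f : fock J F) (g : sub (clrange Delta1)),
    x = (Theta2 f, adj fact_iso (to_clrange Delta2 f, g))].

(** [clspan] only bundles [fact_set] as a closed subspace.  When [fact_iso] is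
    unitary, i.e. for a regular factorization, [fact_set] is already closed, as
    the range of an isometry:
    [||Theta2 f||^2 + ||Delta2 f||^2 + ||g||^2 = ||f||^2 + ||g||^2]. *)
Definition model_H1 : csubspace (sub model_space) :=
  within model_space (ominus (clspan fact_set) graph).

Definition model_H2 : csubspace (sub model_space) :=
  ominus (fullsp _) model_H1.

End model.

(* Main.v *)
From HB Require Import structures.
Require Import Defs.
From mathcomp Require Import all_boot all_order all_algebra.
From mathcomp Require Import finmap complex ring lra.
From mathcomp Require Import all_classical all_reals.
From mathcomp Require Import ereal topology normedtype sequences esum.
Import Order.TTheory GRing.Theory Num.Theory numFieldNormedType.Exports.
Set Implicit Arguments.
Unset Strict Implicit.
Unset Printing Implicit Defensive.
Local Open Scope classical_set_scope.
Local Open Scope ring_scope.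

(** Write [Theta] for the characteristic function of [T], [S_j] for the left creation
    operators and [T_a], [S_a], [C_a] for products along a word [a], with [C_j]
    the residual shifts.

    Everything rests on the Schaeffer form of the minimal isometric dilation [V =
    [V_1, ..., V_n]] of [T], on [H (+) F^2 (x) D]. Its defect operator [p : (h,
    xi) |-> Delta_T* h - T xi_[]] satisfies [||x||^2 = ||p x||^2 + \sum_j ||V_j^*
    x||^2], because [p] and the [V_j^*] together form the Halmos unitary of [T]
    (halmos_energy, dil_energy). Iterating this identity gives the Wold
    decomposition: [W x = (p V_a^* x)_a] is a coisometry onto [F^2 (x) D_*] that
    intertwines [V_j] and [S_j], and on its kernel the [V_j^*] lose no energy
    (wold_coisometry, G_adj_wold, wold_kernel). The characteristic function is [W]
    restricted to [F^2 (x) D] (charfunE).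

    Triangulation. Since [Theta_i] is isometric, [Delta_2 = 0] and the isometry
    [X_Theta] identifies the residual space of [Theta] with that of [Theta_o].
    Hence [H_1] consists of the vectors [(Theta_i f, u)] orthogonal to the graph,
    and [H_2] of the [(v, 0)] with [v] orthogonal to the range of [Theta_i]
    (model_H1P, model_H2P). As [Theta_i] commutes with the shifts, [H_2] is
    invariant under the [TT_j^*], which act on it as [S_j^*]: this is the zero
    block and the class [C_{.0}]. On [H_1], [A_j^* (Theta_i f, u) = (Theta_i S_j^*
    f, C_j^* u)] (c1_adj_A, c2_adj_A), so that [\sum_(|a| = k) ||A_a^* y||^2]
    tends to [lim \sum_(|a| = k) ||C_a^* u||^2]. The polar identity [||Delta_Theta
    g|| = ||P g||], with [P] the projection onto [ker W], carries the [C_j^*] to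
    the restrictions of the [V_j^*] to [ker W], provided that [P (F^2 (x) D)] is
    dense in [ker W]; complete non-coisometry says exactly this
    (residual_in_space_eq0). So the sum over [|a| = k] is [||u||^2] for every [k]
    (residual_wsum). If it vanishes, then [u = 0], and orthogonality to the graph
    makes [f] orthogonal to the range of [Theta_o], which is dense; so [f = 0] as
    well, and the class is [C_{.1}].

    Invariant subspace. The vectors [h] of [H] in the range of [W^*] form a closed
    subspace [S] invariant under the [T_j^*] (stable_part); its orthogonal
    complement is invariant under the [T_j], and is the required subspace unless
    [S] is trivial. If [S = H], then [W] is isometric on the smallest
    [V]-invariant subspace containing [H], which is the whole dilation space; so
    [Theta] and [Theta_o] are isometric (charfun_isometric). If [S = 0], then
    [Theta] has dense range, and so has [Theta_i] (charfun_dense). In either case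
    one of the two factors is a multi-analytic isometry with dense range, and such
    an operator is a unitary constant (unitary_multi_analytic_constant). *)

(** * Inner products and bounded operators *)
Section inner_product.
Variables (R : realType) (V : preHilbertType R).
Implicit Types x y z : V.

Lemma dot_nrm2 x : dot x x = (nrm2 x)%:C%C.
Proof. by rewrite dot_norm nrm2E. Qed.

Lemma dot0r x : dot x 0 = 0.
Proof. by rewrite dotC dot0l conjC0. Qed.

Lemma dotBr x y z : dot x (y - z) = dot x y - dot x z.
Proof. by rewrite dotDr dotNr. Qed.

Lemma dot_inj x y : (forall z, dot x z = dot y z) -> x = y.
Proof.
move=> h; apply/eqP; rewrite -subr_eq0; apply/eqP/nrm2_eq0.
by rewrite /nrm2 dotBl h subrr.
Qed.

Lemma dot_injr x y : (forall z, dot z x = dot z y) -> x = y.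
Proof. by move=> h; apply: dot_inj => z; rewrite dotC h -dotC. Qed.

Lemma nrm2Zr (s : R) x : nrm2 (s%:C%C *: x) = s ^+ 2 * nrm2 x.
Proof. by rewrite nrm2Z /= expr0n addr0. Qed.

Lemma nrm2B x y : nrm2 (x - y) = nrm2 x + nrm2 y - complex.Re (dot x y) *+ 2.
Proof. by rewrite nrm2D nrm2N dotNr raddfN /= mulNrn. Qed.

Lemma nrm2_sym x y : nrm2 (x - y) = nrm2 (y - x).
Proof. by rewrite -nrm2N opprB. Qed.

(** The weights absorb the cross term; a small [s] makes [nrm2 (x + y)] close to
    [nrm2 x] when [y] is small. *)
Lemma nrm2D_eps (s : R) x y : 0 < s ->
  nrm2 (x + y) <= (1 + s) * nrm2 x + (1 + s^-1) * nrm2 y.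
Proof.
move=> s0; have := nrm2_ge0 (s%:C%C *: x - y).
rewrite nrm2B nrm2Zr dotZl nrm2D.
have -> : complex.Re (s%:C%C * dot x y) = s * complex.Re (dot x y).
  by case: (dot x y) => a b /=; rewrite mul0r subr0.
move=> h; rewrite -subr_ge0.
have -> : (1 + s) * nrm2 x + (1 + s^-1) * nrm2 y
    - (nrm2 x + nrm2 y + complex.Re (dot x y) *+ 2) =
  s^-1 * (s ^+ 2 * nrm2 x + nrm2 y - s * complex.Re (dot x y) *+ 2).
  by field; exact: lt0r_neq0.
by rewrite mulr_ge0 // invr_ge0 ltW.
Qed.

Lemma dot_cs x y :
  complex.Re (dot x y) ^+ 2 + complex.Im (dot x y) ^+ 2 <= nrm2 x * nrm2 y.
Proof.
have := normC_dot x y.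
rewrite -(@ler_pXn2r _ 2) ?nnegrE ?mulr_ge0 ?normr_ge0 //.
by rewrite exprMn -!nrm2E -add_Re2_Im2 -rmorphM /= lecR.
Qed.

Lemma eps_le (a c : R) : 0 <= c -> (forall e, 0 < e -> a <= c * e) -> a <= 0.
Proof.
move=> c0 h; have [//|a0] := leP a 0.
have := h (a / (c + 1) / 2) _; set d := a / (c + 1) / 2.
have d0 : 0 < d by rewrite !divr_gt0 // ltr_wpDl.
have ad : a = (c + 1) * d * 2 by rewrite /d; field; rewrite gt_eqF// ltr_wpDl.
move/(_ d0); rewrite {1}ad; have : 0 <= c * d by rewrite mulr_ge0 // ltW.
by nra.
Qed.

Lemma nrm2_small0 (c : R) x : 0 <= c -> (forall e, 0 < e -> nrm2 x <= c * e) -> x = 0.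
Proof.
by move=> c0 h; apply/nrm2_eq0/le_anti; rewrite nrm2_ge0 andbT; exact: eps_le h.
Qed.

End inner_product.

Lemma norm_nrm2 (R : realType) (V W : preHilbertType R) (x : V) (w : W) :
  (`|x| <= `|w|) = (nrm2 x <= nrm2 w).
Proof.
rewrite -(@ler_pXn2r _ 2) ?nnegrE ?normr_ge0 //.
by rewrite -!nrm2E lecR.
Qed.

Lemma norm_nrm2_eq (R : realType) (V W : preHilbertType R) (x : V) (w : W) :
  `|x| = `|w| <-> nrm2 x = nrm2 w.
Proof.
split=> h; apply/eqP; last by rewrite eq_le !norm_nrm2 h !lexx.
by rewrite eq_le -!norm_nrm2 h !lexx.
Qed.

Section bounded.
Variables (R : realType) (U V : hilbertType R).

(** Continuity at [0] gives a ball on which the image is bounded; rescaling any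
    vector into it gives the constant. *)
Lemma bop_bounded (A : bop U V) :
  exists2 C : R, 0 < C & forall x, nrm2 (A x) <= C * nrm2 x.
Proof.
have cA : A @ (0 : U) --> A 0 by exact: bop_continuous.
have : nbhs (A 0) [set y | nrm2 (A 0 - y) < 1].
  by apply/nbhs_nrm2P; exists 1.
move=> /cA /nbhs_nrm2P[e e0 /= he].
exists (2 / e); first by rewrite divr_gt0.
(* A nonzero [x] is rescaled to have squared norm [e / 2]. *)
move=> x; have [x0|x0] := eqVneq (nrm2 x) 0.
  by rewrite (nrm2_eq0 x0) linear0 !nrm20 mulr0.
have xp : 0 < nrm2 x by rewrite lt_neqAle eq_sym x0 nrm2_ge0.
have := he ((Num.sqrt (e / 2 / nrm2 x))%:C%C *: x).
rewrite linear0 !sub0r !nrm2N (linearZZ A) !nrm2Zr sqr_sqrtr; last by rewrite !divr_ge0 // ltW.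
have -> : e / 2 / nrm2 x * nrm2 x = e / 2 by field.
have e2 : e / 2 < e by lra.
move/(_ e2)/ltW.
have -> : e / 2 / nrm2 x * nrm2 (A x) = nrm2 (A x) / (2 / e * nrm2 x).
  by field; rewrite x0 /= gt_eqF.
by rewrite ler_pdivrMr ?mul1r // mulr_gt0 // divr_gt0.
Qed.

Section bop_of.
Variables (f : U -> V) (C : R).
Hypothesis f_lin : linear f.
Hypothesis f_bnd : forall x, nrm2 (f x) <= C * nrm2 x.

Let flin : {linear U -> V} :=
  HB.pack f (GRing.isLinear.Build R[i] U V *:%R f f_lin).

Fact bop_of_continuous : continuous flin.
Proof.
move=> x A /nbhs_nrm2P[e e0 eA]; apply/nbhs_nrm2P.
exists (e / (`|C| + 1)); first by rewrite divr_gt0 // ltr_wpDl.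
move=> y; rewrite ltr_pdivlMr ?ltr_wpDl // => h; apply: eA.
rewrite -linearB; apply: le_lt_trans (f_bnd _) _; apply: le_lt_trans h.
rewrite mulrC ler_wpM2l ?nrm2_ge0 //.
by have := ler_norm C; lra.
Qed.

Definition bop_of : bop U V := Bop bop_of_continuous.

Lemma bop_ofE x : bop_of x = f x.
Proof. by []. Qed.

End bop_of.

Lemma csub_lim (M : csubspace U) x :
  (forall e : R, 0 < e -> exists2 m, carrier M m & nrm2 (x - m) < e) ->
  carrier M x.
Proof.
move=> h; apply: carrier_closed => B /nbhs_nrm2P[e /h[m Mm xm] eB].
by exists m; split => //; exact: eB.
Qed.

End bounded.

(** * Closed subspaces *)
Section csubspace_constructions.
Variables (R : realType) (U V : hilbertType R).

Lemma csubD (M : csubspace U) x y : carrier M x -> carrier M y -> carrier M (x + y).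
Proof. by move=> Mx My; rewrite -[x]scale1r; exact: carrierP. Qed.

Lemma csubZ (M : csubspace U) a x : carrier M x -> carrier M (a *: x).
Proof. by move=> Mx; rewrite -[_ *: _]addr0; apply: carrierP => //; exact: carrier0. Qed.

Lemma csubB (M : csubspace U) x y : carrier M x -> carrier M y -> carrier M (x - y).
Proof. by move=> Mx My; apply: csubD => //; rewrite -scaleN1r; exact: csubZ. Qed.

Lemma clspan_sub (A : set U) (M : csubspace U) :
  A `<=` M -> carrier (clspan A) `<=` M.
Proof. by move=> AM x; exact. Qed.

Lemma sub_clspan (A : set U) : A `<=` clspan A.
Proof. by move=> x Ax M; exact. Qed.

Section preimage.
Variables (A : bop U V) (M : csubspace V).
Fact preim_sp0 : carrier M (A 0). Proof. by rewrite linear0; exact: carrier0. Qed.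
Fact preim_spP (a : R[i]) x y :
  carrier M (A x) -> carrier M (A y) -> carrier M (A (a *: x + y)).
Proof. by rewrite linearP; exact: carrierP. Qed.
Fact preim_sp_closed : closed [set x | carrier M (A x)].
Proof. by apply: closed_comp; [move=> x _; exact: bop_continuous | exact: carrier_closed]. Qed.
Definition preim_sp : csubspace U :=
  @CSubspace R U [set x | carrier M (A x)] preim_sp0 preim_spP preim_sp_closed.
End preimage.

Section equalizer.
Variables (A B : bop U V).
Fact eq_sp0 : A 0 = B 0. Proof. by rewrite !linear0. Qed.
Fact eq_spP (a : R[i]) x y : A x = B x -> A y = B y -> A (a *: x + y) = B (a *: x + y).
Proof. by rewrite !linearP => -> ->. Qed.
Fact eq_sp_closed : closed [set x | A x = B x].
Proof.
move=> x clx; apply/eqP; rewrite -subr_eq0; apply/eqP.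
have [C C0 hC] := bop_bounded A; have [D D0 hD] := bop_bounded B.
apply: (@nrm2_small0 _ _ ((C + D) *+ 2)) => [|e e0].
  by rewrite mulrn_wge0 // addr_ge0 // ltW.
have [|y [/= ABy xy]] := clx [set y | nrm2 (x - y) < e].
  by apply/nbhs_nrm2P; exists e.
have -> : A x - B x = A (x - y) + - B (x - y).
  by rewrite (linearB A) (linearB B) ABy opprB addrA subrK.
apply: le_trans (nrm2D_le _ _) _; rewrite nrm2N.
have h1 := hC (x - y); have h2 := hD (x - y).
have h3 : C * nrm2 (x - y) <= C * e by rewrite ler_pM2l // ltW.
have h4 : D * nrm2 (x - y) <= D * e by rewrite ler_pM2l // ltW.
by move: h1 h2 h3 h4; lra.
Qed.
Definition eq_sp : csubspace U :=
  @CSubspace R U [set x | A x = B x] eq_sp0 eq_spP eq_sp_closed.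
End equalizer.

End csubspace_constructions.

Section bop_id.
Variables (R : realType) (U : hilbertType R).
Definition bop_id : bop U U := @bop_of R U U id 1 (fun _ _ _ => erefl)
  (fun x => eq_ind_r (fun z => nrm2 x <= z) (lexx _) (mul1r _)).
End bop_id.
Arguments bop_id {R} U.

Section projection.
Variables (R : realType) (V : hilbertType R) (M : csubspace V).

(** Vectors of [M] that nearly minimize the distance to [x] form a Cauchy filter,
    by the parallelogram identity; its limit is the foot of the perpendicular. *)
Lemma projection_exists x :
  exists2 m, carrier M m & forall z, carrier M z -> dot (x - m) z = 0.
Proof.
pose S := [set nrm2 (x - m) | m in carrier M].
have S0 : S !=set0 by exists (nrm2 (x - 0)), 0 => //; exact: carrier0.
have Sl : lbound S 0 by move=> _ [m _ <-]; exact: nrm2_ge0.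
have hS : has_inf S by split => //; exists 0.
pose d := inf S.
have dle m : carrier M m -> d <= nrm2 (x - m).
  by move=> Mm; apply: ge_inf; [exists 0 | exists m].
pose F : set_system V := filter_from [set e : R | 0 < e]
  (fun e => [set m | carrier M m /\ nrm2 (x - m) < d + e]).
have FF : ProperFilter F.
  apply: filter_from_proper; last first.
    by move=> e e0; have [_ [m Mm <-] hm] := inf_adherent e0 hS; exists m.
  apply: filter_from_filter; first by exists 1; exact: ltr01.
  move=> e1 e2 /= e10 e20; exists (Num.min e1 e2); first by rewrite /= lt_min e10.
  move=> m [Mm]; rewrite -ltrBlDl lt_min => /andP[h1 h2].
  by split; split => //; rewrite -ltrBlDl.
have mid m m' : carrier M m -> carrier M m' ->
    nrm2 (m - m') <= nrm2 (x - m) *+ 2 + nrm2 (x - m') *+ 2 - d *+ 4.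
  move=> Mm Mm'.
  have Mh : carrier M ((2^-1)%:C%C *: (m + m')).
    by apply: csubZ; exact: csubD.
  have := dle _ Mh.
  have -> : x - (2^-1)%:C%C *: (m + m') = (2^-1)%:C%C *: ((x - m) + (x - m')).
    rewrite addrACA -opprD -mulr2n scalerBr -[x *+ 2]scaler_nat scalerA.
    have -> : (2^-1)%:C%C * 2%:R = 1 :> R[i].
      by rewrite -(rmorph_nat (@real_complex R)) -rmorphM /= mulVf ?pnatr_eq0.
    by rewrite scale1r.
  rewrite nrm2Zr nrm2D.
  have -> : m - m' = (x - m') - (x - m) by rewrite opprB [RHS]addrC addrA subrK.
  rewrite (nrm2B (x - m')) (dotC (x - m)).
  have -> : complex.Re (dot (x - m) (x - m'))^* = complex.Re (dot (x - m) (x - m')).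
    by case: (dot (x - m) (x - m')).
  by lra.
have : cvg F.
  apply: cauchy_cvg; apply/cauchy_nrm2P => e e0.
  exists [set m | carrier M m /\ nrm2 (x - m) < d + e / 4].
    by exists (e / 4) => //; rewrite /= divr_gt0.
  move=> m m' [Mm hm] [Mm' hm']; apply: le_lt_trans (mid _ _ Mm Mm') _.
  by move: hm hm'; lra.
move=> /cvg_ex[m0 /cvg_nrm2P hm0].
have near0 e : 0 < e -> exists m, [/\ carrier M m, nrm2 (x - m) < d + e & nrm2 (m0 - m) < e].
  move=> e0; have Fe : F [set m | carrier M m /\ nrm2 (x - m) < d + e] by exists e.
  have [m [[Mm xm] m0m]] := filter_ex (filterI Fe (hm0 e e0)).
  by exists m.
exists m0.
  by apply: csub_lim => e /near0[m [Mm _ h]]; exists m.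
have dm0 : nrm2 (x - m0) <= d.
  rewrite -subr_le0; apply: (@eps_le _ _ (d + 4)) => [|e e0].
    by rewrite addr_ge0 //; apply: lb_le_inf.
  (* An approximation within [e1 ^+ 2] compensates the weight [1 + e1^-1] of
     [nrm2D_eps]. *)
  pose e1 := Num.min e 1.
  have e10 : 0 < e1 by rewrite lt_min e0 ltr01.
  have e1e : e1 <= e by rewrite ge_min lexx.
  have e11 : e1 <= 1 by rewrite ge_min lexx orbT.
  have e120 : 0 < e1 ^+ 2 by rewrite exprn_gt0.
  have [m [Mm xm m0m]] := near0 _ e120.
  have := @nrm2D_eps _ _ e1 (x - m) (m - m0) e10.
  rewrite addrA subrK (nrm2_sym m) => h.
  have h1 : (1 + e1) * nrm2 (x - m) <= (1 + e1) * (d + e1 ^+ 2).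
    by rewrite ler_wpM2l ?ltW // addr_gt0.
  have h2 : (1 + e1^-1) * nrm2 (m0 - m) <= (1 + e1^-1) * e1 ^+ 2.
    by rewrite ler_wpM2l ?ltW // addr_gt0 // invr_gt0.
  have h3 : (1 + e1^-1) * e1 ^+ 2 = e1 ^+ 2 + e1 by field; exact: lt0r_neq0.
  have h4 : e1 ^+ 2 <= e1 by rewrite expr2 ler_piMl // ltW.
  have h5 : e1 ^+ 2 * e1 <= e1 by apply: ler_piMl; [exact: ltW | exact: le_trans h4 e11].
  have d0 : 0 <= d by exact: lb_le_inf.
  have h6 : d * e1 <= d * e by rewrite ler_wpM2l.
  by move: h h1 h2; rewrite h3; lra.
have key z : carrier M z -> complex.Re (dot (x - m0) z) = 0.
  move=> Mz; have Mm0 : carrier M m0 by apply: csub_lim => e /near0[m [Mm _ h]]; exists m.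
  have h (s : R) : 0 <= s ^+ 2 * nrm2 z - s * complex.Re (dot (x - m0) z) *+ 2.
    have := dle _ (csubD Mm0 (csubZ s%:C%C Mz)).
    rewrite opprD addrA nrm2B nrm2Zr dotZr => /(le_trans dm0).
    have -> : complex.Re ((s%:C%C)^* * dot (x - m0) z) = s * complex.Re (dot (x - m0) z).
      by case: (dot (x - m0) z) => a b /=; rewrite oppr0 mul0r subr0.
    by lra.
  set r := complex.Re _ in h *.
  apply/eqP; rewrite -sqrf_eq0; apply/eqP/le_anti; rewrite sqr_ge0 andbT.
  have z1 : 0 < nrm2 z + 1 by rewrite ltr_wpDl // nrm2_ge0.
  have := h (r / (nrm2 z + 1)).
  have -> : (r / (nrm2 z + 1)) ^+ 2 * nrm2 z - r / (nrm2 z + 1) * r *+ 2 =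
            - r ^+ 2 * (nrm2 z + 2) / (nrm2 z + 1) ^+ 2.
    by field; exact: lt0r_neq0.
  rewrite -mulrA mulNr oppr_ge0 pmulr_lle0 // divr_gt0 ?exprn_gt0 //.
  by rewrite ltr_wpDl // nrm2_ge0.
move=> z Mz; have h1 := key _ Mz; have h2 := key _ (csubZ 'i%C Mz).
move: h1 h2; rewrite dotZr; case: (dot (x - m0) z) => a b /= ->.
by rewrite mul0r sub0r mulN1r opprK => ->.
Qed.

End projection.


(** * Adjoints *)
Section adjoint.
Variables (R : realType) (U V : hilbertType R).

(** The kernel of [x |-> dot (A x) y] is closed.  A vector [w] orthogonal to it
    represents the functional up to a scalar, fixed by its value at [w]. *)
Lemma riesz (A : bop U V) y : exists z, forall x, dot (A x) y = dot x z.
Proof.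
pose M := preim_sp A (ominus (fullsp V) [set y]).
have MP x : carrier M x <-> dot (A x) y = 0.
  by split=> [[_ /(_ y)]|h]; [exact | split=> // _ ->].
have [[x0 x0n]|h] := pselect (exists x, dot (A x) y != 0); last first.
  exists 0 => x; rewrite dot0r; apply/eqP; apply: contrapT => /negP hx.
  by apply: h; exists x.
have [m Mm hm] := projection_exists M x0.
pose w := x0 - m; pose f x := dot (A x) y.
have fw : f w != 0 by rewrite /f linearB dotBl (MP m).1 // subr0.
have w0 : (nrm2 w)%:C%C != 0.
  rewrite -dot_nrm2 dot_norm expf_eq0 /= normr_eq0.
  by apply: contra fw => /eqP ->; rewrite /f linear0 dot0l.
exists ((f w / (nrm2 w)%:C%C)^* *: w) => x.
have : dot (x - (f x / f w) *: w) w = 0.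
  rewrite dotC hm ?conjC0 //; apply/MP.
  by rewrite linearB linearZZ dotBl dotZl -/(f w) divfK // subrr.
rewrite dotBl dotZl dot_nrm2 dotZr conjCK => /eqP; rewrite subr_eq0 => /eqP ->.
by rewrite /f; field; rewrite fw w0.
Qed.

Lemma adjoint_exists (A : bop U V) :
  exists B : bop V U, forall x y, dot (A x) y = dot x (B y).
Proof.
have [g hg] := choice (riesz A).
have glin : linear g.
  move=> a x y; apply: dot_injr => z.
  by rewrite -hg !dotDr !dotZr -!hg.
have [C C0 hC] := bop_bounded A.
have gb y : nrm2 (g y) <= C * nrm2 y.
  have := dot_cs (A (g y)) y; rewrite hg dot_nrm2 /= expr0n addr0 => h.
  have h2 : nrm2 (A (g y)) * nrm2 y <= C * nrm2 (g y) * nrm2 y.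
    by rewrite ler_wpM2r // nrm2_ge0.
  have [->|g0] := eqVneq (nrm2 (g y)) 0; first by rewrite mulr_ge0 ?nrm2_ge0 // ltW.
  have gp : 0 < nrm2 (g y) by rewrite lt_neqAle eq_sym g0 nrm2_ge0.
  by rewrite -(ler_pM2l gp) -expr2 (le_trans h) // (le_trans h2) // mulrCA mulrA.
by exists (bop_of glin gb).
Qed.

(** [adj] is also applied to maps that are not bundled operators, such as
    [shift j] and [row_op T]; exhibiting one adjoint is then enough. *)
Lemma get_adj (f : U -> V) (B : bop V U) :
  (forall x y, dot (f x) y = dot x (B y)) ->
  forall x y, dot (f x) y = dot x (adj f y).
Proof.
move=> hB; have := @getPex _ [set B : bop V U | forall x y, dot (f x) y = dot x (B y)].
by apply; exists B.
Qed.

Lemma adjE (f : U -> V) (B : bop V U) :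
  (forall x y, dot (f x) y = dot x (B y)) -> forall y, adj f y = B y.
Proof.
by move=> hB y; apply: dot_injr => x; rewrite -(get_adj hB) hB.
Qed.

Lemma adjP (A : bop U V) x y : dot (A x) y = dot x (adj A y).
Proof. by have [B hB] := adjoint_exists A; exact: get_adj hB x y. Qed.

Lemma adjPl (A : bop U V) x y : dot (adj A y) x = dot y (A x).
Proof. by rewrite dotC -adjP -dotC. Qed.

Lemma adj_uniq (A : bop U V) y z : (forall x, dot (A x) y = dot x z) -> adj A y = z.
Proof. by move=> h; apply: dot_injr => x; rewrite -adjP. Qed.

End adjoint.

Section adjoint_theory.
Variables (R : realType).
Implicit Types (U V W : hilbertType R).

Lemma adjK U V (A : bop U V) x : adj (adj A) x = A x.
Proof. by apply: adj_uniq => y; rewrite adjPl. Qed.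

Lemma isometric_nrm2 U V (A : U -> V) :
  isometric A <-> forall x, nrm2 (A x) = nrm2 x.
Proof. by split=> h x; apply/norm_nrm2_eq. Qed.

Lemma contraction_nrm2 U V (A : U -> V) :
  Defs.contraction A <-> forall x, nrm2 (A x) <= nrm2 x.
Proof. by split=> h x; have := h x; rewrite norm_nrm2. Qed.

Lemma isometric_dot U V (A : bop U V) :
  isometric A -> forall x y, dot (A x) (A y) = dot x y.
Proof.
move=> /isometric_nrm2 h.
have hre x y : complex.Re (dot (A x) (A y)) = complex.Re (dot x y).
  have := h (x + y); rewrite linearD !nrm2D !h => /addrI.
  by lra.
move=> x y; apply/eqP; rewrite eq_complex hre eqxx /=; apply/eqP.
have := hre ('i%C *: x) y; rewrite linearZZ !dotZl.
case: (dot (A x) (A y)) => a b; case: (dot x y) => c d /=.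
by rewrite !mul0r !mul1r !sub0r => /oppr_inj.
Qed.

Lemma isometric_adjK U V (A : bop U V) : isometric A -> forall x, adj A (A x) = x.
Proof. by move=> h x; apply: adj_uniq => y; exact: isometric_dot. Qed.

Lemma nrm2_adj_le U V (A : bop U V) :
  Defs.contraction A -> forall y, nrm2 (adj A y) <= nrm2 y.
Proof.
move=> /contraction_nrm2 hA y.
have := dot_cs (A (adj A y)) y; rewrite adjP dot_nrm2 /= expr0n addr0 => h.
have h2 : nrm2 (A (adj A y)) * nrm2 y <= nrm2 (adj A y) * nrm2 y.
  by rewrite ler_wpM2r // nrm2_ge0.
have [->|g0] := eqVneq (nrm2 (adj A y)) 0; first exact: nrm2_ge0.
have gp : 0 < nrm2 (adj A y) by rewrite lt_neqAle eq_sym g0 nrm2_ge0.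
by rewrite -(ler_pM2l gp) -expr2 (le_trans h).
Qed.

(** Expanding [||A^* A x - x||^2] leaves [||A^* A x||^2 - ||x||^2 <= 0]. *)
Lemma contraction_adjK U V (A : bop U V) : Defs.contraction A ->
  forall x, nrm2 (A x) = nrm2 x -> adj A (A x) = x.
Proof.
move=> hA x hx; apply/eqP; rewrite -subr_eq0; apply/eqP/nrm2_eq0/le_anti.
rewrite nrm2_ge0 andbT nrm2B adjPl dot_nrm2 /= hx.
by have := nrm2_adj_le hA (A x); rewrite hx; lra.
Qed.

(** Polarization: [dot (B z) z] is real for [z = x + y] and for [z = x + i y]. *)
Lemma positive_sa U (B : bop U U) : positive B -> forall x y, dot (B x) y = dot x (B y).
Proof.
move=> hB.
have im0 x : complex.Im (dot (B x) x) = 0.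
  by have := hB x; case: (dot (B x) x) => a b; rewrite lecE /= => /andP[/eqP].
have key x y : complex.Im (dot (B x) y) + complex.Im (dot (B y) x) = 0.
  have := im0 (x + y); rewrite linearD dotDl !dotDr !raddfD /= !im0; lra.
move=> x y; rewrite (dotC (B y)).
have h1 := key x y; have := key x ('i%C *: y).
rewrite linearZZ dotZl dotZr.
move: h1; case: (dot (B x) y) => a b; case: (dot (B y) x) => c d /= h1 h2.
by apply/eqP; rewrite eq_complex /=; apply/andP; split; apply/eqP; lra.
Qed.

(** Positivity at [x - t B x] for small [t] would fail if [B x] were nonzero. *)
Lemma positive_eq0 U (B : bop U U) : positive B ->
  forall x, dot (B x) x = 0 -> B x = 0.
Proof.
move=> hB x hx; have sa := positive_sa hB.
apply: nrm2_eq0; set r := nrm2 (B x).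
pose q := complex.Re (dot (B (B x)) (B x)).
have q0 : 0 <= q by have := hB (B x); rewrite lecE => /andP[].
have key (t : R) : 0 <= t ^+ 2 * q - t * r *+ 2.
  have := hB (x + (- t)%:C%C *: B x).
  rewrite linearD linearZZ dotDl !dotDr hx !dotZl !dotZr (sa (B x) x) dot_nrm2 -/r.
  rewrite lecE => /andP[_]; rewrite /q; case: (dot (B (B x)) (B x)) => a b /=.
  by lra.
(* [q + 1] rather than [q], which may vanish *)
have q1 : 0 < q + 1 by rewrite ltr_wpDl.
have r0 : 0 <= r by exact: nrm2_ge0.
have := key (r / (q + 1)).
have -> : (r / (q + 1)) ^+ 2 * q - r / (q + 1) * r *+ 2 =
          - (r ^+ 2 * ((q + 2) / (q + 1) ^+ 2)) by field; exact: lt0r_neq0.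
have q2 : 0 < (q + 2) / (q + 1) ^+ 2.
  by rewrite divr_gt0 ?exprn_gt0 // ltr_wpDl.
rewrite oppr_ge0 pmulr_lle0 // => h.
by apply/eqP; rewrite -sqrf_eq0; apply/eqP/le_anti; rewrite h sqr_ge0.
Qed.

End adjoint_theory.

Section real_norm.
Variables (R : realType) (V : preHilbertType R).
Implicit Types x y : V.

(** The triangle inequality and the convergence estimates below are between real
    numbers, whereas the norm of [V] takes its values in [R[i]]. *)
Definition rnorm x : R := Num.sqrt (nrm2 x).

Lemma rnormE x : (rnorm x)%:C%C = `|x|.
Proof.
apply/eqP; rewrite -(@eqrXn2 _ 2) ?normr_ge0 //; last by rewrite ler0c sqrtr_ge0.
by rewrite -rmorphXn /= sqr_sqrtr ?nrm2_ge0 // nrm2E.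
Qed.

Lemma rnorm_ge0 x : 0 <= rnorm x. Proof. exact: sqrtr_ge0. Qed.

Lemma rnormD x y : rnorm (x + y) <= rnorm x + rnorm y.
Proof. by rewrite -lecR rmorphD /= !rnormE ler_normD. Qed.

Lemma rnormN x : rnorm (- x) = rnorm x.
Proof. by rewrite /rnorm nrm2N. Qed.

Lemma rnormZ (s : R) x : 0 <= s -> rnorm (s%:C%C *: x) = s * rnorm x.
Proof. by move=> s0; rewrite /rnorm nrm2Zr sqrtrM ?sqr_ge0 // sqrtr_sqr ger0_norm. Qed.

Lemma rnormZC (a : R[i]) x :
  rnorm (a *: x) = Num.sqrt (complex.Re a ^+ 2 + complex.Im a ^+ 2) * rnorm x.
Proof. by rewrite /rnorm nrm2Z sqrtrM // addr_ge0 ?sqr_ge0. Qed.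

Lemma rnorm_sqr x : rnorm x ^+ 2 = nrm2 x.
Proof. by rewrite sqr_sqrtr ?nrm2_ge0. Qed.

Lemma rnorm_eq0 x : rnorm x = 0 -> x = 0.
Proof. by move=> h; apply: nrm2_eq0; rewrite -rnorm_sqr h expr0n. Qed.

Lemma rnorm_dot x y : `|complex.Re (dot x y)| <= rnorm x * rnorm y.
Proof.
rewrite -(@ler_pXn2r _ 2) ?nnegrE ?mulr_ge0 ?rnorm_ge0 //.
rewrite exprMn !rnorm_sqr real_normK ?num_real //.
by have := dot_cs x y; have := sqr_ge0 (complex.Im (dot x y)); lra.
Qed.

Lemma rnorm_small0 (c : R) x : 0 <= c -> (forall e, 0 < e -> rnorm x <= c * e) -> x = 0.
Proof. by move=> c0 h; apply/rnorm_eq0/le_anti; rewrite rnorm_ge0 andbT; exact: eps_le h. Qed.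

End real_norm.

Lemma rnorm_le_nrm2 (R : realType) (V W : preHilbertType R) (x : V) (w : W) :
  (rnorm x <= rnorm w) = (nrm2 x <= nrm2 w).
Proof. by rewrite ler_sqrt ?nrm2_ge0. Qed.

(** * Square roots of positive operators *)

(** The root of [I - X] is [I - Y], with [Y] the limit of the iteration
    [Y' = (X + Y^2) / 2] from [0].  The same iteration for the scalar [X = 1] is
    increasing and bounded by [1], and its increments dominate those of the
    operators, so that these converge in norm. *)
Section scalar_iteration.
Variable R : realType.

Fixpoint half_iter (n : nat) : R :=
  if n is n'.+1 then 2^-1 * (1 + half_iter n' ^+ 2) else 0.

Lemma half_iter_bounds n : 0 <= half_iter n <= 1.
Proof. by elim: n => [|n /andP[h0 h1]] /=; [rewrite lexx ler01 | nra]. Qed.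

Lemma half_iter_ge0 n : 0 <= half_iter n.
Proof. by have /andP[] := half_iter_bounds n. Qed.

Lemma half_iter_le1 n : half_iter n <= 1.
Proof. by have /andP[] := half_iter_bounds n. Qed.

Definition half_lim : R := sup (range half_iter).

Lemma half_iter_has_sup : has_sup (range half_iter).
Proof.
split; first by exists (half_iter 0), 0%N.
by exists 1 => _ [n _ <-]; exact: half_iter_le1.
Qed.

Lemma half_iter_le_lim n : half_iter n <= half_lim.
Proof. by apply: ub_le_sup; [case: half_iter_has_sup | exists n]. Qed.

Lemma half_lim_le1 : half_lim <= 1.
Proof.
apply: sup_le_ub; first by case: half_iter_has_sup.
by move=> _ [n _ <-]; exact: half_iter_le1.
Qed.

Definition half_gap n : R := half_lim - half_iter n.

Lemma half_gap_ge0 n : 0 <= half_gap n.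
Proof. by rewrite subr_ge0 half_iter_le_lim. Qed.

Lemma half_iter_step n : half_iter n <= half_iter n.+1.
Proof. by have /andP[] := half_iter_bounds n; rewrite /=; nra. Qed.

Lemma half_gap_anti m n : (m <= n)%N -> half_gap n <= half_gap m.
Proof.
move=> mn; rewrite lerD2l lerN2.
by apply: (@homo_leq _ half_iter <=%R) mn => //; [exact: le_trans | exact: half_iter_step].
Qed.

Lemma half_gap_small e : 0 < e -> exists N, forall n, (N <= n)%N -> half_gap n < e.
Proof.
move=> e0; have [_ [N _ <-] hN] := sup_adherent e0 half_iter_has_sup.
exists N => // n /half_gap_anti h; apply: le_lt_trans h _.
by rewrite ltrBlDl -ltrBlDr.
Qed.

End scalar_iteration.

Section square_root.
Variables (R : realType) (V : hilbertType R) (X : bop V V).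
Hypothesis X_sa : forall x y, dot (X x) y = dot x (X y).
Hypothesis X_contr : Defs.contraction X.

Fixpoint op_iter (n : nat) (x : V) : V :=
  if n is n'.+1 then (2^-1)%:C%C *: (X x + op_iter n' (op_iter n' x)) else 0.

Lemma op_iter_linear n : linear (op_iter n).
Proof.
elim: n => [|n IH] a x y; first by rewrite /= scaler0 addr0.
rewrite [LHS]/= !IH linearP scalerDr.
rewrite [op_iter n.+1 x]/= [op_iter n.+1 y]/= !scalerDr !scalerA.
by rewrite (mulrC a) addrACA.
Qed.

Lemma op_iterB n x y : op_iter n (x - y) = op_iter n x - op_iter n y.
Proof. by rewrite addrC -scaleN1r op_iter_linear scaleN1r addrC. Qed.

Lemma op_iter_sa n x y : dot (op_iter n x) y = dot x (op_iter n y).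
Proof.
elim: n x y => [|n IH] x y; first by rewrite /= dot0l dot0r.
rewrite /= dotZl dotZr dotDl dotDr X_sa !IH; congr (_ * _).
by apply/eqP; rewrite eq_complex /= oppr0 !eqxx.
Qed.

Lemma rnormX x : rnorm (X x) <= rnorm x.
Proof. by rewrite rnorm_le_nrm2; exact: (contraction_nrm2 X).1. Qed.

Let h2 : 0 <= 2^-1 :> R. Proof. by rewrite invr_ge0. Qed.

Lemma op_iter_le n x : rnorm (op_iter n x) <= half_iter R n * rnorm x.
Proof.
elim: n x => [|n IH] x; first by rewrite /= /rnorm nrm20 sqrtr0 mul0r.
rewrite /= rnormZ // -mulrA ler_wpM2l // mulrDl mul1r.
apply: le_trans (rnormD _ _) _; apply: lerD; first exact: rnormX.
apply: le_trans (IH _) _; rewrite expr2 -mulrA ler_wpM2l //.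
exact: half_iter_ge0.
Qed.

(** [Y'' - Y' = (Y' (Y' - Y) + (Y' - Y) Y) / 2], and the same identity for the
    scalars. *)
Lemma op_iter_step n x :
  rnorm (op_iter n.+1 x - op_iter n x) <=
  (half_iter R n.+1 - half_iter R n) * rnorm x.
Proof.
elim: n x => [|n IH] x; first by rewrite subr0 subr0; exact: op_iter_le.
have -> : op_iter n.+2 x - op_iter n.+1 x = (2^-1)%:C%C *:
    (op_iter n.+1 (op_iter n.+1 x - op_iter n x) +
      (op_iter n.+1 (op_iter n x) - op_iter n (op_iter n x))).
  rewrite op_iterB addrA subrK [op_iter n.+2 x]/= [X in _ - X = _]/= -scalerBr.
  by congr (_ *: _); rewrite opprD addrACA subrr add0r.
rewrite rnormZ //.
have -> : half_iter R n.+2 - half_iter R n.+1 =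
  2^-1 * (half_iter R n.+1 * (half_iter R n.+1 - half_iter R n) +
   (half_iter R n.+1 - half_iter R n) * half_iter R n).
  have E k : half_iter R k.+1 = 2^-1 * (1 + half_iter R k ^+ 2) by [].
  by rewrite (E n.+1) [X in _ - X = _](E n); set u := half_iter R n.+1; ring.
rewrite -mulrA ler_wpM2l //; apply: le_trans (rnormD _ _) _; rewrite mulrDl.
apply: lerD.
  by apply: le_trans (op_iter_le _ _) _; rewrite -mulrA ler_wpM2l ?half_iter_ge0.
apply: le_trans (IH _) _; rewrite -mulrA ler_wpM2l ?op_iter_le //.
by rewrite subr_ge0 half_iter_step.
Qed.

Lemma op_iter_dist m n x : (m <= n)%N ->
  rnorm (op_iter n x - op_iter m x) <= half_gap R m * rnorm x.
Proof.
move=> mn; apply: (@le_trans _ _ ((half_iter R n - half_iter R m) * rnorm x)).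
  rewrite -(subnK mn); elim: (n - m)%N => [|k IH].
    by rewrite add0n !subrr /rnorm nrm20 sqrtr0 mul0r.
  rewrite addSn -(subrK (op_iter (k + m) x) (op_iter (k + m).+1 x)) -addrA.
  apply: le_trans (rnormD _ _) _; apply: le_trans (lerD (op_iter_step _ _) IH) _.
  by rewrite -mulrDl addrA subrK.
by rewrite ler_wpM2r ?rnorm_ge0 // lerD2r half_iter_le_lim.
Qed.

Lemma op_lim_pointwise x :
  exists y, forall n, rnorm (y - op_iter n x) <= half_gap R n * rnorm x.
Proof.
have : cvg (op_iter n x @[n --> \oo]).
  apply: cauchy_cvg; apply/cauchy_nrm2P => e e0.
  have x1 : 0 < rnorm x + 1 by rewrite ltr_wpDl ?rnorm_ge0.
  have d0 : 0 < Num.sqrt e / (rnorm x + 1) by rewrite divr_gt0 ?sqrtr_gt0.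
  have [N hN] := half_gap_small d0.
  exists (op_iter ^~ x @` [set n | (N <= n)%N]).
    by exists N => // n Nn; exists n.
  have key m n : (N <= m)%N -> (m <= n)%N -> nrm2 (op_iter n x - op_iter m x) < e.
    move=> Nm mn; rewrite -rnorm_sqr -[e]sqr_sqrtr ?ltW //.
    rewrite ltr_pXn2r ?nnegrE ?rnorm_ge0 ?sqrtr_ge0 //.
    apply: le_lt_trans (op_iter_dist _ mn) _.
    have := hN m Nm; rewrite ltr_pdivlMr //; apply: le_lt_trans.
    by rewrite ler_wpM2l ?half_gap_ge0 // lerDl.
  move=> _ _ [n Nn <-] [m Nm <-]; have [mn|/ltnW nm] := leqP m n; first exact: key.
  by rewrite nrm2_sym; exact: key.
move=> /cvg_ex[y /cvg_nrm2P hy]; exists y => n.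
apply/ler_addgt0Pl => e e0.
have e20 : 0 < e ^+ 2 by rewrite exprn_gt0.
have [N _ hN] := hy _ e20.
have := hN (maxn N n) (leq_maxl _ _) => /= h.
rewrite -(subrK (op_iter (maxn N n) x) y) -addrA.
apply: le_trans (rnormD _ _) _; apply: lerD; last exact: op_iter_dist (leq_maxr _ _).
rewrite -(@ler_pXn2r _ 2) ?nnegrE ?rnorm_ge0 ?(ltW e0) //.
by rewrite rnorm_sqr ltW.
Qed.

Definition op_lim (x : V) : V := projT1 (cid (op_lim_pointwise x)).

Lemma op_limP n x : rnorm (op_lim x - op_iter n x) <= half_gap R n * rnorm x.
Proof. exact: (projT2 (cid (op_lim_pointwise x))). Qed.

(** [half_gap] tends to [0]: this is how every identity passes to the limit. *)
Lemma gap_eq (c : R) (u v : V) : 0 <= c ->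
  (forall n, rnorm (u - v) <= half_gap R n * c) -> u = v.
Proof.
move=> c0 h; apply/eqP; rewrite -subr_eq0; apply/eqP.
apply: (@rnorm_small0 _ _ c) => // e e0.
have [N /(_ N (leqnn _)) hN] := half_gap_small e0.
by apply: le_trans (h N) _; rewrite mulrC ler_wpM2l // ltW.
Qed.

Lemma op_lim_linear : linear op_lim.
Proof.
move=> a x y.
apply: (@gap_eq (rnorm (a *: x + y) + rnorm (a *: x) + rnorm y)).
  by rewrite !addr_ge0 ?rnorm_ge0.
move=> n.
have -> : op_lim (a *: x + y) - (a *: op_lim x + op_lim y) =
   (op_lim (a *: x + y) - op_iter n (a *: x + y)) -
   (a *: (op_lim x - op_iter n x) + (op_lim y - op_iter n y)).
  rewrite op_iter_linear scalerBr [X in _ = _ - X]addrACA -opprD opprB.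
  by rewrite addrA subrK.
apply: le_trans (rnormD _ _) _; rewrite rnormN -addrA mulrDr.
apply: lerD; first exact: op_limP.
apply: le_trans (rnormD _ _) _; rewrite mulrDr.
apply: lerD; last exact: op_limP.
by rewrite !rnormZC mulrCA ler_wpM2l ?op_limP ?sqrtr_ge0.
Qed.

Lemma op_lim_le x : rnorm (op_lim x) <= rnorm x.
Proof.
have := op_limP 0 x; rewrite /half_gap !subr0 => /le_trans; apply.
by rewrite ler_piMl ?rnorm_ge0 ?half_lim_le1.
Qed.

Lemma op_lim_sa x y : dot (op_lim x) y = dot x (op_lim y).
Proof.
have hre u v : complex.Re (dot (op_lim u) v) = complex.Re (dot u (op_lim v)).
  apply/eqP; rewrite -subr_eq0 -normr_eq0; apply/eqP/le_anti.
  rewrite normr_ge0 andbT.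
  apply: (@eps_le _ _ (rnorm u * rnorm v *+ 2)) => [|e e0].
    by rewrite mulrn_wge0 // mulr_ge0 ?rnorm_ge0.
  have [N /(_ N (leqnn _)) hN] := half_gap_small e0.
  have -> : complex.Re (dot (op_lim u) v) - complex.Re (dot u (op_lim v)) =
    complex.Re (dot (op_lim u - op_iter N u) v) - complex.Re (dot u (op_lim v - op_iter N v)).
    have ReB (p q : R[i]) : complex.Re (p - q) = complex.Re p - complex.Re q.
      by case: p; case: q.
    by rewrite dotBl dotBr op_iter_sa !ReB opprB addrA subrK.
  apply: le_trans (ler_normB _ _) _.
  apply: le_trans (lerD (rnorm_dot _ _) (rnorm_dot _ _)) _.
  have h1 : rnorm (op_lim u - op_iter N u) * rnorm v <= e * rnorm u * rnorm v.
    rewrite ler_wpM2r ?rnorm_ge0 //; apply: le_trans (op_limP _ _) _.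
    by rewrite ler_wpM2r ?rnorm_ge0 // ltW.
  have h3 : rnorm u * rnorm (op_lim v - op_iter N v) <= rnorm u * (e * rnorm v).
    rewrite ler_wpM2l ?rnorm_ge0 //; apply: le_trans (op_limP _ _) _.
    by rewrite ler_wpM2r ?rnorm_ge0 // ltW.
  by move: h1 h3; lra.
apply/eqP; rewrite eq_complex hre eqxx /=; apply/eqP.
have := hre ('i%C *: x) y.
have -> : op_lim ('i%C *: x) = 'i%C *: op_lim x.
  have := op_lim_linear 'i%C x 0; rewrite !addr0 => ->.
  suff -> : op_lim 0 = 0 by rewrite addr0.
  by apply: rnorm_eq0; apply/le_anti; rewrite rnorm_ge0 (le_trans (op_lim_le _)) // /rnorm nrm20 sqrtr0.
rewrite !dotZl.
case: (dot (op_lim x) y) => a b; case: (dot x (op_lim y)) => c d /=.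
by rewrite !mul0r !mul1r !sub0r => /oppr_inj.
Qed.

Lemma op_lim_fix x : op_lim x = (2^-1)%:C%C *: (X x + op_lim (op_lim x)).
Proof.
apply: (@gap_eq (rnorm x *+ 2)) => [|n]; first by rewrite mulrn_wge0 ?rnorm_ge0.
have opB u v : op_lim (u - v) = op_lim u - op_lim v.
  by rewrite addrC -scaleN1r op_lim_linear scaleN1r addrC.
have -> : op_lim x - (2^-1)%:C%C *: (X x + op_lim (op_lim x)) =
  (op_lim x - op_iter n.+1 x) - (2^-1)%:C%C *: (op_lim (op_lim x - op_iter n x) +
     (op_lim (op_iter n x) - op_iter n (op_iter n x))).
  rewrite opB addrA subrK /= !scalerBr !scalerDr opprD opprB.
  by rewrite [in RHS]opprD -!addrA addKr.
apply: le_trans (rnormD _ _) _; rewrite rnormN rnormZ // [rnorm x *+ 2]mulr2n mulrDr.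
apply: lerD.
  apply: le_trans (op_limP _ _) _; rewrite ler_wpM2r ?rnorm_ge0 //.
  by apply: half_gap_anti.
apply: (@le_trans _ _ (2^-1 * (half_gap R n * rnorm x + half_gap R n * rnorm x))); last first.
  by lra.
rewrite ler_wpM2l //; apply: le_trans (rnormD _ _) _; apply: lerD.
  by apply: le_trans (op_lim_le _) _; exact: op_limP.
apply: le_trans (op_limP _ _) _; rewrite ler_wpM2l ?half_gap_ge0 //.
apply: le_trans (op_iter_le _ _) _; rewrite ler_piMl ?rnorm_ge0 //.
exact: half_iter_le1.
Qed.

End square_root.

Section square_root_operator.
Variable R : realType.

(** Polynomials in [X] are intertwined with the same polynomials in [X']. *)
Lemma op_lim_intertwine (V V' : hilbertType R) (X : bop V V) (X' : bop V' V')
    (ct : Defs.contraction X) (ct' : Defs.contraction X') (T : bop V V') :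
  (forall x, T (X x) = X' (T x)) -> forall x, T (op_lim ct x) = op_lim ct' (T x).
Proof.
move=> TX.
have Ti n x : T (op_iter X n x) = op_iter X' n (T x).
  elim: n x => [|n IH] x; first by rewrite linear0.
  by rewrite /= linearZZ linearD TX !IH.
have [C C0 hC] := bop_bounded T.
have hT x : rnorm (T x) <= Num.sqrt C * rnorm x.
  by rewrite /rnorm -sqrtrM ?(ltW C0) // ler_sqrt ?mulr_ge0 ?nrm2_ge0 // ltW.
move=> x; apply: (@gap_eq _ _ (Num.sqrt C * rnorm x + rnorm (T x))).
  by rewrite addr_ge0 ?mulr_ge0 ?rnorm_ge0 ?sqrtr_ge0.
move=> n; rewrite -(subrK (T (op_iter X n x)) (T (op_lim ct x))) -addrA -linearB Ti.
apply: le_trans (rnormD _ _) _; rewrite mulrDr; apply: lerD.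
  apply: le_trans (hT _) _; rewrite mulrCA ler_wpM2l ?sqrtr_ge0 //.
  exact: op_limP.
by rewrite -rnormN opprB; exact: op_limP.
Qed.

Section one_operator.
Variables (V : hilbertType R) (X : bop V V) (f : V -> V).
Hypothesis X_sa : forall x y, dot (X x) y = dot x (X y).
Hypothesis X_contr : Defs.contraction X.
Hypothesis fE : forall x, f x = x - X x.

Definition root_op (x : V) : V := x - op_lim X_contr x.

Fact root_op_linear : linear root_op.
Proof.
by move=> a x y; rewrite /root_op op_lim_linear scalerBr opprD addrACA.
Qed.

Fact root_op_bnd x : nrm2 (root_op x) <= 4 * nrm2 x.
Proof.
apply: le_trans (nrm2D_le _ _) _; rewrite nrm2N.
have := op_lim_le X_contr x; rewrite rnorm_le_nrm2; lra.
Qed.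

Definition root_bop : bop V V := bop_of root_op_linear root_op_bnd.

Lemma root_bop_sa x y : dot (root_bop x) y = dot x (root_bop y).
Proof. by rewrite !bop_ofE /root_op dotBl dotBr op_lim_sa. Qed.

Lemma root_bop_pos : positive root_bop.
Proof.
move=> x; rewrite bop_ofE lecE; apply/andP; split.
  have := root_bop_sa x x; rewrite (dotC (root_op x)) bop_ofE.
  by case: (dot (root_op x) x) => a b /= [] h; apply/eqP; lra.
rewrite /root_op dotBl dot_nrm2.
have := rnorm_dot (op_lim X_contr x) x; have := op_lim_le X_contr x.
rewrite -(rnorm_sqr x); case: (dot (op_lim X_contr x) x) => a b /=.
have := rnorm_ge0 x; have := ler_norm a; nra.
Qed.

Lemma root_bopK x : root_bop (root_bop x) = f x.
Proof.
rewrite fE !bop_ofE /root_op.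
have opB u v : op_lim X_contr (u - v) = op_lim X_contr u - op_lim X_contr v.
  by rewrite addrC -scaleN1r op_lim_linear scaleN1r addrC.
have := op_lim_fix X_contr x.
set y := op_lim X_contr x => hy; rewrite opB -/y.
have {}hy : y + y = X x + op_lim X_contr y.
  rewrite {1 2}hy -scalerDl -rmorphD /=.
  have -> : 2^-1 + 2^-1 = 1 :> R by field.
  by rewrite scale1r.
have -> : X x = y + y - op_lim X_contr y by rewrite hy addrK.
by rewrite !opprD !opprK !addrA.
Qed.

(** [B] commutes with [X], hence with the root [Q] constructed above; so for
    [y = (Q - B) x] the numbers [dot (Q y) y] and [dot (B y) y] add up to
    [dot ((Q^2 - B^2) x) y = 0], and being nonnegative both vanish. *)
Lemma positive_root_unique (B : bop V V) :
  positive B -> (forall x, B (B x) = f x) -> forall x, B x = root_bop x.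
Proof.
move=> Bp BB.
have XB x : B (X x) = X (B x).
  have XE z : X z = z - B (B z) by rewrite BB fE opprB addrC subrK.
  by rewrite !XE linearB.
have SB x : B (root_bop x) = root_bop (B x).
  by rewrite !bop_ofE /root_op linearB (op_lim_intertwine X_contr X_contr XB).
have Ssa := root_bop_sa; have Bsa := positive_sa Bp.
move=> x; apply/eqP; rewrite eq_sym -subr_eq0; apply/eqP.
pose D z := root_bop z - B z.
have Dsa u v : dot (D u) v = dot u (D v) by rewrite /D dotBl dotBr Ssa Bsa.
have key : dot (root_bop (D x)) (D x) + dot (B (D x)) (D x) = 0.
  rewrite -dotDl /D (linearB root_bop) (linearB B) root_bopK BB SB.
  by rewrite addrA subrK subrr dot0l.
have p1 := root_bop_pos (D x); have p2 := Bp (D x).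
move/eqP: key; rewrite paddr_eq0 // => /andP[/eqP z1 /eqP z2].
have DD : D (D x) = 0.
  by rewrite {1}/D (positive_eq0 root_bop_pos z1) (positive_eq0 Bp z2) subrr.
by apply: nrm2_eq0; rewrite /nrm2 -/(D x) Dsa DD dot0r.
Qed.

Lemma sqrt_opP : positive (sqrt_op f) /\ forall x, sqrt_op f (sqrt_op f x) = f x.
Proof.
have := @getPex _ [set B : bop V V | positive B /\ forall x, B (B x) = f x].
by apply; exists root_bop; split; [exact: root_bop_pos | exact: root_bopK].
Qed.

Lemma sqrt_opE x : sqrt_op f x = root_bop x.
Proof. by have [h1 h2] := sqrt_opP; exact: positive_root_unique. Qed.

End one_operator.

Lemma sqrt_op_intertwine (V V' : hilbertType R) (X : bop V V) (X' : bop V' V')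
    (f : V -> V) (f' : V' -> V') (T : bop V V') :
  (forall x y, dot (X x) y = dot x (X y)) -> Defs.contraction X ->
  (forall x, f x = x - X x) ->
  (forall x y, dot (X' x) y = dot x (X' y)) -> Defs.contraction X' ->
  (forall x, f' x = x - X' x) ->
  (forall x, T (X x) = X' (T x)) ->
  forall x, T (sqrt_op f x) = sqrt_op f' (T x).
Proof.
move=> sa ct fE sa' ct' fE' TX x.
rewrite (sqrt_opE sa ct fE) (sqrt_opE sa' ct' fE') !bop_ofE /root_op linearB.
by rewrite (op_lim_intertwine ct ct' TX).
Qed.

Section defect.
Variables (U V : hilbertType R) (A : bop U V).
Hypothesis A_contr : Defs.contraction A.

Let X := bop_comp (adj A) A.

Lemma defect_X_sa x y : dot (X x) y = dot x (X y).
Proof. by rewrite /= adjPl adjP. Qed.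

Lemma defect_X_contr : Defs.contraction X.
Proof.
apply/contraction_nrm2 => x /=; apply: le_trans (nrm2_adj_le A_contr _) _.
exact: (contraction_nrm2 A).1.
Qed.

Lemma defectP : positive (defect A) /\ forall x, defect A (defect A x) = x - adj A (A x).
Proof. exact: (sqrt_opP defect_X_sa defect_X_contr (fun=> erefl)). Qed.

Lemma defect_sa x y : dot (defect A x) y = dot x (defect A y).
Proof. by apply: positive_sa; case: defectP. Qed.

Lemma defectK x : defect A (defect A x) = x - adj A (A x).
Proof. by case: defectP. Qed.

Lemma nrm2_defect x : nrm2 (defect A x) = nrm2 x - nrm2 (A x).
Proof.
rewrite /nrm2 defect_sa defectK dotBr.
have -> : dot x (adj A (A x)) = dot (A x) (A x) by rewrite adjP.
by case: (dot x x) => a b; case: (dot (A x) (A x)).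
Qed.

End defect.
End square_root_operator.


(** * Projections, dense ranges and extension by continuity *)
Section proj_theory.
Variables (R : realType) (V : hilbertType R) (M : csubspace V).

Lemma subP (z : sub M) : carrier M (val z).
Proof. exact/set_mem/(valP z). Qed.

Definition in_subspace x (Mx : carrier M x) : sub M := Sub_ (mem_set Mx : in_sub M x).

Lemma dot_sub (x y : sub M) : dot x y = dot (val x) (val y).
Proof. by []. Qed.

Lemma nrm2_sub (x : sub M) : nrm2 x = nrm2 (val x).
Proof. by []. Qed.

Lemma proj_exists : exists P : bop V (sub M),
  forall x (z : sub M), dot (x - val (P x)) (val z) = 0.
Proof.
have h x : exists m : sub M, forall z : sub M, dot (x - val m) (val z) = 0.
  have [m Mm hm] := projection_exists M x.
  by exists (in_subspace Mm) => z; apply: hm; exact: subP.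
have [g hg] := choice h.
have gE x z : dot (g x) z = dot x (val z).
  by have /eqP := hg x z; rewrite dotBl subr_eq0 => /eqP ->.
have glin : linear g.
  by move=> a x y; apply: dot_inj => z; rewrite dotDl dotZl !gE dotDl dotZl.
have gb x : nrm2 (g x) <= 1 * nrm2 x.
  rewrite mul1r; have := nrm2_ge0 (x - val (g x)).
  rewrite nrm2B -gE dot_nrm2 -nrm2_sub /=; lra.
by exists (bop_of glin gb).
Qed.

Lemma projP (x : V) (z : sub M) : dot (x - val (Defs.proj M x)) (val z) = 0.
Proof. exact: (getPex proj_exists). Qed.

Lemma dot_proj (x : V) (z : sub M) : dot (Defs.proj M x) z = dot x (val z).
Proof. by have /eqP := projP x z; rewrite dotBl subr_eq0 => /eqP ->. Qed.

Lemma proj_val (z : sub M) : Defs.proj M (val z) = z.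
Proof. by apply: dot_inj => w; rewrite dot_proj. Qed.

Lemma proj_eq0 (x : V) : (forall z, carrier M z -> dot x z = 0) -> Defs.proj M x = 0.
Proof. by move=> h; apply: dot_inj => z; rewrite dot_proj dot0l h //; exact: subP. Qed.

Lemma csubspace_full : (forall x, (forall z, carrier M z -> dot x z = 0) -> x = 0) ->
  forall x, carrier M x.
Proof.
move=> h x; have [m Mm hm] := projection_exists M x.
by have /eqP := h _ hm; rewrite subr_eq0 => /eqP ->.
Qed.

End proj_theory.

Lemma adj_block (R : realType) (V : hilbertType R) (N M : csubspace V)
    (A : bop V V) (y : sub N) : adj (block N M A) y = Defs.proj M (adj A (val y)).
Proof.
by apply: adj_uniq => x /=; rewrite dot_proj (adjP A) [RHS]dotC dot_proj -dotC.
Qed.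

Section dense_range.
Variables (R : realType) (U V : hilbertType R) (A : bop U V).

Lemma clrange_approx y : carrier (clrange A) y ->
  forall e : R, 0 < e -> exists x, nrm2 (y - A x) < e.
Proof.
have A0 : range A 0 by exists 0 => //; rewrite linear0.
have AP (a : R[i]) x z : range A x -> range A z -> range A (a *: x + z).
  by move=> [u _ <-] [v _ <-]; exists (a *: u + v) => //; rewrite linearP.
have E : carrier (clrange A) = closure (range A) by exact: clspan_closure.
move=> hy e e0; move: hy; rewrite [X in X -> _](_ : _ = closure (range A) y).
  move=> /(_ [set z | nrm2 (y - z) < e])[|_ [[x _ <-] h]]; last by exists x.
  by apply/nbhs_nrm2P; exists e.
by rewrite E.
Qed.

Lemma clrange_dense (M : csubspace (sub (clrange A))) :
  (forall x, carrier M (to_clrange A x)) -> forall y, carrier M y.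
Proof.
move=> h y; apply: csub_lim => e e0.
by have [x hx] := clrange_approx (subP y) e0; exists (to_clrange A x).
Qed.

Lemma eq_bop_clrange (W : hilbertType R) (B C : bop (sub (clrange A)) W) :
  (forall x, B (to_clrange A x) = C (to_clrange A x)) -> forall y, B y = C y.
Proof. exact: (@clrange_dense (eq_sp B C)). Qed.

(** The range has the same orthogonal complement as its closure, which is
    everything exactly when that complement is trivial. *)
Lemma dense_rangeP :
  dense (range A) <-> (forall y, (forall x, dot (A x) y = 0) -> y = 0).
Proof.
split=> [dA y hy|h O [y Oy] oO].
  apply: (@nrm2_small0 _ _ 1) => // e e0; rewrite mul1r.
  have [|w [/interior_subset /= hx [x _ xE]]] :=
      dA (interior [set z | nrm2 (y - z) < e]) _ (@open_interior _ _).
    by exists y; apply/nbhs_nrm2P; exists e.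
  move: hx; rewrite -xE nrm2B (dotC (A x)) hy conjC0 /= mul0rn subr0.
  by have := nrm2_ge0 (A x); lra.
have full : carrier (clrange A) y.
  apply: csubspace_full => x hx; apply: h => u; rewrite dotC hx ?conjC0 //.
  by apply: sub_clspan; exists u.
have /nbhs_nrm2P[e e0 eO] : nbhs y O by exact: open_nbhs_nbhs.
have [x hx] := clrange_approx full e0.
by exists (A x); split; [exact: eO | exists x].
Qed.

End dense_range.

Section extension.
Variables (R : realType) (U V W : hilbertType R) (A : bop U V) (B : bop U W).
Hypothesis BA : forall x, nrm2 (B x) <= nrm2 (A x).

Let BAr x : rnorm (B x) <= rnorm (A x).
Proof. by rewrite rnorm_le_nrm2. Qed.

Let approx (y : sub (clrange A)) (e : R) : 0 < e ->
  exists x, rnorm (val y - A x) < e.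
Proof.
move=> e0; have e20 : 0 < e ^+ 2 by rewrite exprn_gt0.
have [x hx] := clrange_approx (subP y) e20; exists x.
by rewrite -(@ltr_pXn2r _ 2) ?nnegrE ?rnorm_ge0 ?(ltW e0) // rnorm_sqr.
Qed.

Let ext_pointwise (y : sub (clrange A)) :
  exists z, forall x, rnorm (z - B x) <= rnorm (val y - A x).
Proof.
pose F : set_system U := filter_from [set e : R | 0 < e]
  (fun e => [set x | rnorm (val y - A x) < e]).
have FF : ProperFilter F.
  apply: filter_from_proper; last first.
    by move=> e /= e0; have [x hx] := approx y e0; exists x.
  apply: filter_from_filter; first by exists 1; exact: ltr01.
  move=> e1 e2 /= e10 e20; exists (Num.min e1 e2); first by rewrite /= lt_min e10.
  by move=> x /=; rewrite lt_min => /andP[].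
have key x x' : rnorm (B x - B x') <= rnorm (val y - A x) + rnorm (val y - A x').
  rewrite -(linearB B); apply: le_trans (BAr _) _; rewrite (linearB A).
  rewrite -[rnorm (val y - A x)]rnormN; apply: le_trans (rnormD _ _).
  by rewrite opprB addrA subrK.
have : cvg (B @ F).
  apply: cauchy_cvg; apply/cauchy_nrm2P => e e0.
  have d0 : 0 < Num.sqrt e / 2 by rewrite divr_gt0 ?sqrtr_gt0.
  exists (B @` [set x | rnorm (val y - A x) < Num.sqrt e / 2]).
    by exists (Num.sqrt e / 2) => // x hx; exists x.
  move=> _ _ [x hx <-] [x' hx' <-].
  rewrite -rnorm_sqr -[e]sqr_sqrtr ?ltW //.
  rewrite ltr_pXn2r ?nnegrE ?rnorm_ge0 ?sqrtr_ge0 //.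
  by apply: le_lt_trans (key _ _) _; move: hx hx' => /=; lra.
move=> /cvg_ex[z /cvg_nrm2P hz]; exists z => x.
apply/ler_addgt0Pl => e e0.
have e2 : 0 < e / 2 by rewrite divr_gt0.
have e20 : 0 < (e / 2) ^+ 2 by rewrite exprn_gt0.
have F1 : F [set x | rnorm (val y - A x) < e / 2] by exists (e / 2).
have F2 : F [set x' | nrm2 (z - B x') < (e / 2) ^+ 2] by exact: (hz _ e20).
have [x' [/= h1 h2]] := filter_ex (filterI F2 F1).
have h3 : rnorm (z - B x') < e / 2.
  by rewrite -(@ltr_pXn2r _ 2) ?nnegrE ?rnorm_ge0 ?(ltW e2) // rnorm_sqr.
rewrite -(subrK (B x') z) -addrA; apply: le_trans (rnormD _ _) _.
by have := key x' x; move: h2 h3; lra.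
Qed.

Let ext (y : sub (clrange A)) : W := projT1 (cid (ext_pointwise y)).

Let extP y x : rnorm (ext y - B x) <= rnorm (val y - A x).
Proof. exact: (projT2 (cid (ext_pointwise y))). Qed.

Let ext_linear : linear ext.
Proof.
move=> a y y'; apply/eqP; rewrite -subr_eq0; apply/eqP.
pose c := Num.sqrt (complex.Re a ^+ 2 + complex.Im a ^+ 2).
have c0 : 0 <= c by exact: sqrtr_ge0.
apply: (@rnorm_small0 _ _ ((c + 1) *+ 2)) => [|e e0].
  by rewrite mulrn_wge0 // addr_ge0.
have [x hx] := approx y e0; have [x' hx'] := approx y' e0.
have hc : c * rnorm (val y - A x) <= c * e by rewrite ler_wpM2l // ltW.
have h1 := extP (a *: y + y') (a *: x + x').
have h2 : rnorm (val (a *: y + y') - A (a *: x + x')) <= c * e + e.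
  have -> : val (a *: y + y') - A (a *: x + x') =
      a *: (val y - A x) + (val y' - A x').
    by rewrite linearP /= scalerBr opprD addrACA.
  apply: le_trans (rnormD _ _) _; rewrite rnormZC -/c; move: hc hx'; lra.
have h3 : rnorm (a *: ext y + ext y' - B (a *: x + x')) <= c * e + e.
  have -> : a *: ext y + ext y' - B (a *: x + x') =
      a *: (ext y - B x) + (ext y' - B x').
    by rewrite linearP /= scalerBr opprD addrACA.
  apply: le_trans (rnormD _ _) _; rewrite rnormZC -/c.
  have : c * rnorm (ext y - B x) <= c * rnorm (val y - A x) by rewrite ler_wpM2l.
  have := extP y' x'; move: hc hx'; lra.
rewrite -(subrK (B (a *: x + x')) (ext _)) -addrA.
apply: le_trans (rnormD _ _) _; rewrite -[rnorm (B _ - _)]rnormN opprB.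
by move: h1 h2 h3; lra.
Qed.

Let ext_le y : nrm2 (ext y) <= 1 * nrm2 y.
Proof.
rewrite mul1r -rnorm_le_nrm2; have := extP y 0.
by rewrite (linear0 A) (linear0 B) !subr0.
Qed.

Lemma extension : exists Z : bop (sub (clrange A)) W,
  forall x, Z (to_clrange A x) = B x.
Proof.
exists (bop_of ext_linear ext_le) => x; rewrite bop_ofE.
apply/eqP; rewrite -subr_eq0; apply/eqP/rnorm_eq0/le_anti.
rewrite rnorm_ge0 andbT; have := extP (to_clrange A x) x.
by rewrite /= subrr [X in _ <= X]/rnorm nrm20 sqrtr0.
Qed.

End extension.

(** The operators of the model are known only on [to_clrange A x]; continuity
    carries the norm identity to the closure of the range. *)
Lemma isometric_clrange (R : realType) (U V W : hilbertType R) (A : bop U V)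
    (Z : bop (sub (clrange A)) W) :
  (forall x, nrm2 (Z (to_clrange A x)) = nrm2 (A x)) -> isometric Z.
Proof.
move=> h; apply/isometric_nrm2 => y.
have [C C0 hC] := bop_bounded Z.
have hZ u : rnorm (Z u) <= Num.sqrt C * rnorm u.
  by rewrite /rnorm -sqrtrM ?(ltW C0) // ler_sqrt ?mulr_ge0 ?nrm2_ge0 // ltW.
have key (e : R) : 0 < e -> exists y', [/\ rnorm (Z y') = rnorm y',
    rnorm (y - y') <= e & rnorm (Z (y - y')) <= Num.sqrt C * e].
  move=> e0; have e20 : 0 < e ^+ 2 by rewrite exprn_gt0.
  have [x hx] := clrange_approx (subP y) e20; exists (to_clrange A x).
  have yx : rnorm (y - to_clrange A x) <= e.
    rewrite -(@ler_pXn2r _ 2) ?nnegrE ?rnorm_ge0 ?(ltW e0) // rnorm_sqr.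
    exact: ltW.
  split=> //; first by rewrite /rnorm h.
  by apply: le_trans (hZ _) _; rewrite ler_wpM2l ?sqrtr_ge0.
rewrite -!rnorm_sqr; congr (_ ^+ 2); apply/eqP; rewrite eq_le.
have c0 : 0 <= Num.sqrt C + 1 by rewrite addr_ge0 ?sqrtr_ge0.
apply/andP; split; rewrite -subr_le0; apply: (eps_le c0) => e /key[y' [h1 h2 h3]].
  have := rnormD (Z (y - y')) (Z y'); rewrite -linearD subrK.
  have := rnormD (y' - y) y; rewrite subrK -[rnorm (y' - y)]rnormN opprB; lra.
have := rnormD (Z (y' - y)) (Z y); rewrite -linearD subrK.
have -> : Z (y' - y) = - Z (y - y') by rewrite -linearN opprB.
have := rnormD (y - y') y'; rewrite subrK rnormN; lra.
Qed.


(** * Square-summable families *)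
Section esum_bound.
Variables (R : realType) (I : choiceType).
Implicit Types (x : I -> R) (F : I -> \bar R).

Lemma esum_le_fset x (M : R) :
  (forall A : {fset I}, \sum_(i <- A) x i <= M) ->
  (\esum_(i in setT) (x i)%:E <= M%:E)%E.
Proof.
move=> h; apply: ge_ereal_sup => _ [_ [/finite_fsetP[A ->] _] <-].
by rewrite -fsbig_seq ?fset_uniq // sumEFin lee_fin.
Qed.

Lemma fset_le_esum x (A : {fset I}) : (forall i, 0 <= x i) ->
  ((\sum_(i <- A) x i)%:E <= \esum_(i in setT) (x i)%:E)%E.
Proof.
move=> x0; apply: esum_ge; exists [set` A]; first by split.
by rewrite -fsbig_seq ?fset_uniq // sumEFin.
Qed.

Lemma esum_leP x (M : R) : (forall i, 0 <= x i) ->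
  (\esum_(i in setT) (x i)%:E <= M%:E)%E <->
  (forall A : {fset I}, \sum_(i <- A) x i <= M).
Proof.
move=> x0; split=> [h A|]; last exact: esum_le_fset.
by rewrite -lee_fin; apply: le_trans (fset_le_esum A x0) h.
Qed.

End esum_bound.

Section l2_theory.
Variables (R : realType) (I : choiceType) (K : hilbertType R).
Implicit Types f g : l2 I K.

Lemma l2_ext f g : (forall i, f i = g i) -> f = g.
Proof. by move=> h; apply: val_inj; exact: funext. Qed.

Lemma l2D f g i : (f + g) i = f i + g i. Proof. by []. Qed.
Lemma l2B f g i : (f - g) i = f i - g i. Proof. by []. Qed.
Lemma l2Z (a : R[i]) f i : (a *: f) i = a *: f i. Proof. by []. Qed.

Lemma l2_sum_le f (A : {fset I}) : \sum_(i <- A) nrm2 (f i) <= nrm2 f.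
Proof. exact: nrm2_le_l2. Qed.

Lemma l2_le f (M : R) :
  (forall A : {fset I}, \sum_(i <- A) nrm2 (f i) <= M) -> nrm2 f <= M.
Proof. exact: l2_nrm2_le. Qed.

Lemma nrm2_l2_esum f : (nrm2 f)%:E = \esum_(i in setT) (nrm2 (f i))%:E.
Proof.
apply/eqP; rewrite eq_le; apply/andP; split; last first.
  by apply: esum_le_fset; exact: l2_sum_le.
have h0 i : 0 <= nrm2 (f i) by exact: nrm2_ge0.
case E : (\esum_(i in setT) (nrm2 (f i))%:E)%E => [r| |].
- by rewrite lee_fin; apply: l2_le; apply/esum_leP => //; rewrite E.
- by rewrite leey.
- have : (0 <= \esum_(i in setT) (nrm2 (f i))%:E)%E.
    by apply: esum_ge0 => i _; rewrite lee_fin.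
  by rewrite E.
Qed.

Definition l2_coord_fun (i : I) f : K := f i.
Fact l2_coord_linear i : linear (l2_coord_fun i). Proof. by []. Qed.
Fact l2_coord_bnd i f : nrm2 (l2_coord_fun i f) <= 1 * nrm2 f.
Proof. by rewrite mul1r; exact: nrm2_coord_le. Qed.
Definition l2_coord i : bop (l2 I K) K := bop_of (@l2_coord_linear i) (@l2_coord_bnd i).

Definition single_fun (i : I) (k : K) : I -> K := fun j => if j == i then k else 0.

Fact single_in_l2 i k : in_l2 (single_fun i k).
Proof.
apply/asboolP; exists (nrm2 k) => A.
have [iA|iA] := boolP (i \in A).
  rewrite (big_fsetD1 i) //= big_seq big1 => [|b].
    by rewrite addr0 /single_fun eqxx.
  by rewrite !inE /single_fun => /andP[/negPf -> _]; rewrite nrm20.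
rewrite big_seq big1 ?nrm2_ge0 // => b bA; rewrite /single_fun.
by case: eqP => [bi|]; [rewrite -bi bA in iA | rewrite nrm20].
Qed.

Definition single (i : I) (k : K) : l2 I K := L2 (single_in_l2 i k).

Lemma singleE i k j : single i k j = if j == i then k else 0.
Proof. by []. Qed.

Lemma single_same i k : single i k i = k.
Proof. by rewrite singleE eqxx. Qed.

Lemma single_linear i : linear (single i).
Proof.
move=> a k k'; apply: l2_ext => j; rewrite l2D l2Z !singleE.
by case: eqP => // _; rewrite scaler0 addr0.
Qed.

Lemma nrm2_single i k : nrm2 (single i k) = nrm2 k.
Proof.
apply/le_anti; rewrite -{3}(single_same i k) nrm2_coord_le andbT.
apply: l2_le => A; have [iA|iA] := boolP (i \in A).
  rewrite (big_fsetD1 i) //= big_seq big1 => [|b].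
    by rewrite addr0 /single_fun eqxx.
  by rewrite !inE /single_fun => /andP[/negPf -> _]; rewrite nrm20.
rewrite big_seq big1 ?nrm2_ge0 // => b bA; rewrite singleE.
by case: eqP => [bi|]; [rewrite -bi bA in iA | rewrite nrm20].
Qed.

Definition single_bop i : bop K (l2 I K) :=
  bop_of (@single_linear i) (fun k => eq_ind_r (fun z => z <= 1 * nrm2 k)
    (eq_ind_r (fun z => nrm2 k <= z) (lexx _) (mul1r _)) (nrm2_single i k)).

Lemma single_isometric i : isometric (single_bop i).
Proof. by apply/isometric_nrm2 => k; exact: nrm2_single. Qed.

Lemma dot_single f i k : dot (single i k) f = dot k (f i).
Proof.
have orth (g : l2 I K) : g i = 0 -> dot (single i k) g = 0.
  move=> g0; have lin (G : I -> R) :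
      (forall j, j != i -> G j = 0) -> G i = 0 -> usum G = 0.
    move=> h hi; apply: cvg_lim => //.
    have -> : psum G = fun=> 0.
      apply/funext => A; rewrite psumE big1 // => j _.
      by have [->|/h] := eqVneq j i.
    exact: cvg_cst.
  apply/eqP; rewrite eq_complex /=; apply/andP; split; apply/eqP; apply: lin.
  - by move=> j ji; rewrite /single_fun (negPf ji) dot0l.
  - by rewrite g0 dot0r.
  - by move=> j ji; rewrite /single_fun (negPf ji) dot0l.
  - by rewrite g0 dot0r.
rewrite -(subrK (single i (f i)) f) dotDr orth ?l2B ?single_same ?subrr //.
rewrite l2D l2B single_same subrK add0r.
exact: (isometric_dot (@single_isometric i)).
Qed.

Lemma dot_singler f i k : dot f (single i k) = dot (f i) k.
Proof. by rewrite dotC dot_single -dotC. Qed.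

(** A vector orthogonal to all [single i k] has zero coefficients. *)
Lemma l2_span (M : csubspace (l2 I K)) :
  (forall i k, carrier M (single i k)) -> forall f, carrier M f.
Proof.
move=> h; apply: csubspace_full => f hf; apply: l2_ext => i.
by apply: nrm2_eq0; rewrite /nrm2 -dot_singler hf.
Qed.

Lemma eq_bop_single (V : hilbertType R) (A B : bop (l2 I K) V) :
  (forall i k, A (single i k) = B (single i k)) -> forall f, A f = B f.
Proof. exact: (@l2_span (eq_sp A B)). Qed.

Lemma sum_singleE (A : {fset I}) f j :
  (\sum_(i <- A) single i (f i)) j = if j \in A then f j else 0.
Proof.
rewrite -[LHS]/(l2_coord j _) linear_sum /= /l2_coord_fun; have [jA|jA] := boolP (j \in A).
  rewrite (big_fsetD1 j) //= /single_fun eqxx big_seq big1 ?addr0 // => i.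
  by rewrite !inE eq_sym => /andP[/negPf ->].
rewrite big_seq big1 // => i iA; rewrite /single_fun.
by case: eqP => // ji; rewrite ji iA in jA.
Qed.

(** Pythagoras: the rest of the family is orthogonal to the partial sum. *)
Lemma nrm2_sub_partial (A : {fset I}) f :
  nrm2 (f - \sum_(i <- A) single i (f i)) = nrm2 f - \sum_(i <- A) nrm2 (f i).
Proof.
set s := \sum_(i <- A) _.
have dots g : (forall i, i \in A -> g i = f i) ->
    complex.Re (dot s g) = \sum_(i <- A) nrm2 (f i).
  move=> gf; rewrite /s.
  have -> : complex.Re (dot (\sum_(i <- A) single i (f i)) g) =
      \sum_(i <- A) complex.Re (dot (single i (f i)) g).
    apply: (big_morph (fun z => complex.Re (dot z g))) => [x y|].
      by rewrite dotDl raddfD.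
    by rewrite dot0l.
  rewrite big_seq [RHS]big_seq; apply: eq_bigr => i iA.
  by rewrite dot_single gf.
rewrite nrm2B (dotC s f).
have -> : complex.Re (dot s f)^* = complex.Re (dot s f) by case: (dot s f).
have -> : nrm2 s = \sum_(i <- A) nrm2 (f i).
  by rewrite /nrm2 dots // => i iA; rewrite sum_singleE iA.
by rewrite dots //; lra.
Qed.

Lemma cvg_psum_single f : psum (fun i => single i (f i)) @ finsets --> f.
Proof.
apply/cvg_nrm2P => e e0.
have [[A hA]|h] := pselect (exists A : {fset I}, nrm2 f - e < \sum_(i <- A) nrm2 (f i)).
  exists A => // B /= AB; rewrite psumE nrm2_sub_partial.
  have := @sub_fset_sum_le _ _ (fun i => nrm2 (f i)) _ _ AB (fun i => nrm2_ge0 _).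
  by move: hA; lra.
have : nrm2 f <= nrm2 f - e.
  by apply: l2_le => A; rewrite leNgt; apply/negP => hA; apply: h; exists A.
by lra.
Qed.

Lemma cvg_psum_bop (V : hilbertType R) (B : bop (l2 I K) V) f :
  psum (fun i => B (single i (f i))) @ finsets --> B f.
Proof.
have -> : psum (fun i => B (single i (f i))) = B \o psum (fun i => single i (f i)).
  by apply/funext => A; rewrite /= !psumE linear_sum.
by apply: (cvg_comp _ _ (cvg_psum_single (f := f))); exact: bop_continuous.
Qed.

(** The infinite sums in [rowTT], [row_op] and [symbol] all have this form, with [B]
    an identity or the adjoint of a column. *)
Lemma usum_bop (V : hilbertType R) (B : bop (l2 I K) V) f :
  usum (fun i => B (single i (f i))) = B f.
Proof. by apply: cvg_lim => //; exact: cvg_psum_bop. Qed.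

End l2_theory.
Arguments single {R I K} i k.
Arguments l2_coord {R I K} i.

(** * Columns of operators and row contractions *)
Section column.
Variables (R : realType) (I : choiceType) (H K : hilbertType R).
Variables (G : I -> bop H K).
Hypothesis G_le : forall x, (\esum_(i in setT) (nrm2 (G i x))%:E <= (nrm2 x)%:E)%E.

Fact column_in_l2 x : in_l2 (fun i => G i x).
Proof.
apply/asboolP; exists (nrm2 x); apply/esum_leP => // i; exact: nrm2_ge0.
Qed.

Definition column_fun x : l2 I K := L2 (column_in_l2 x).

Fact column_linear : linear column_fun.
Proof. by move=> a x y; apply: l2_ext => i; rewrite /= linearP. Qed.

Fact column_bnd x : nrm2 (column_fun x) <= 1 * nrm2 x.
Proof. by rewrite mul1r -lee_fin nrm2_l2_esum; exact: G_le. Qed.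

Definition column : bop H (l2 I K) := bop_of column_linear column_bnd.

Lemma columnE x i : column x i = G i x. Proof. by []. Qed.

Lemma column_contraction : Defs.contraction column.
Proof. by apply/contraction_nrm2 => x; rewrite -[leRHS]mul1r column_bnd. Qed.

Lemma adj_column_single i k : adj column (single i k) = adj (G i) k.
Proof. by apply: adj_uniq => x; rewrite dot_singler columnE adjP. Qed.

End column.

Section row_contraction.
Variables (R : realType) (J : choiceType) (H : hilbertType R).
Variable T : J -> bop H H.

Definition row_bounded : Prop :=
  forall h, (\esum_(j in setT) (nrm2 (adj (T j) h))%:E <= (nrm2 h)%:E)%E.

(** [T T^*] is the composite of the column of the [T_j^*] with its adjoint. *)
Lemma rowTT_column (hT : row_bounded) h :
  psum (fun j => T j (adj (T j) h)) @ finsets --> adj (column hT) (column hT h).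
Proof.
have := @cvg_psum_bop _ _ _ _ (adj (column hT)) (column hT h).
by under [X in psum X]eq_fun do rewrite adj_column_single columnE adjK.
Qed.

Lemma rowTTE (hT : row_bounded) h : rowTT T h = adj (column hT) (column hT h).
Proof. by apply: cvg_lim => //; exact: rowTT_column. Qed.

(** Positivity of [I - T T^*] says that the column of the [T_j^*] is a contraction.
    Conversely, that bound alone makes the operator sum converge. *)
Lemma row_contractionP : row_contraction T <-> row_bounded.
Proof.
split=> [[cT pT] h|hT].
  apply/esum_leP => [j|A]; first exact: nrm2_ge0.
  have /cvg_nrm2P hc : psum (fun j => T j (adj (T j) h)) @ finsets --> rowTT T h.
    exact: cT.
  rewrite -subr_le0; apply: (@eps_le _ _ (rnorm h)) => [|e e0]; first exact: rnorm_ge0.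
  have e20 : 0 < e ^+ 2 by rewrite exprn_gt0.
  have [B _ hB] := hc _ e20.
  have /= hAB := hB _ (fsubsetUr A B); set C := (A `|` B)%fset in hAB.
  have hC : rnorm (rowTT T h - psum (fun j => T j (adj (T j) h)) C) < e.
    by rewrite -(@ltr_pXn2r _ 2) ?nnegrE ?rnorm_ge0 ?(ltW e0) // rnorm_sqr.
  have E : complex.Re (dot (psum (fun j => T j (adj (T j) h)) C) h) =
      \sum_(j <- C) nrm2 (adj (T j) h).
    rewrite psumE (big_morph (fun z => complex.Re (dot z h)) (id1 := 0) (op1 := +%R)).
    - by apply: eq_bigr => j _; rewrite adjP.
    - by move=> x y; rewrite dotDl raddfD.
    - by rewrite dot0l.
  have AC : \sum_(j <- A) nrm2 (adj (T j) h) <= \sum_(j <- C) nrm2 (adj (T j) h).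
    by apply: sub_fset_sum_le; [exact: fsubsetUl | move=> j; exact: nrm2_ge0].
  have := pT h; rewrite dotBl dot_nrm2 lecE => /andP[_ /=].
  have := rnorm_dot (rowTT T h - psum (fun j => T j (adj (T j) h)) C) h.
  rewrite dotBl; move: E.
  case: (dot (rowTT T h) h) => a b; case: (dot (psum _ C) h) => c d /= ->.
  rewrite ler_norml => /andP[+ _].
  have := ler_wpM2r (rnorm_ge0 h) (ltW hC).
  by move: AC; lra.
split=> [h|h]; first by apply/cvg_ex; exists (adj (column hT) (column hT h)); exact: rowTT_column.
rewrite (rowTTE hT) dotBl adjPl !dot_nrm2 -rmorphB /= lecR subr_ge0.
exact: (contraction_nrm2 _).1 (column_contraction hT) h.
Qed.

End row_contraction.

(** * Sums over words *)
Section words.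
Variables (R : realType) (J : choiceType).
Implicit Types F : seq J -> \bar R.

Lemma esum_words F : (forall a, (0 <= F a)%E) ->
  (\esum_(a in setT) F a =
   F [::] + \esum_(j in setT) \esum_(b in setT) F (j :: b))%E.
Proof.
move=> F0; rewrite (esumID [set [::]]) // setTI esum_set1 //; congr (_ + _)%E.
rewrite esum_esum //; apply: reindex_esum; split.
- by move=> [j b] _.
- by move=> [j b] [i c] _ _ /= [-> ->].
- by move=> [|j b] [_ /= h] //; exists (j, b).
Qed.

Lemma esum_words_cond (S : set (seq J)) F : (forall a, (0 <= F a)%E) ->
  (\esum_(a in S) F a = (if [::] \in S then F [::] else 0) +
   \esum_(j in setT) \esum_(b in [set b | S (j :: b)]) F (j :: b))%E.
Proof.
move=> F0; rewrite esum_mkcond esum_words => [|a]; last by case: ifP.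
congr (_ + _)%E; apply: eq_esum => j _; rewrite [RHS]esum_mkcond.
by apply: eq_esum => b _; congr (if _ then _ else _); apply/idP/idP => /set_mem h; apply/mem_set.
Qed.

End words.

Section word_action.
Variables (R : realType) (J : choiceType) (H : hilbertType R).
Variable G : J -> H -> H.

Definition act (a : seq J) (x : H) : H := foldl (fun x j => G j x) x a.

(** The quantity [word_sum], for maps [G j] in place of the [T_j^*]. *)
Definition wsum (k : nat) (x : H) : \bar R :=
  \esum_(a in [set a : seq J | size a = k]) (nrm2 (act a x))%:E.

Lemma wsum0 x : wsum 0 x = (nrm2 x)%:E.
Proof.
rewrite /wsum (_ : [set a | _] = [set [::]]); first by rewrite esum_set1 // lee_fin nrm2_ge0.
by apply/seteqP; split=> [a /size0nil|a ->].
Qed.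

Lemma wsumS k x : wsum k.+1 x = \esum_(j in setT) wsum k (G j x).
Proof.
rewrite /wsum esum_words_cond => [|a]; last by rewrite lee_fin nrm2_ge0.
rewrite ifF; last by apply/negP => /set_mem.
rewrite add0e; apply: eq_esum => j _; congr esum.
by apply/seteqP; split=> b /= => [[]|->].
Qed.

Lemma wsum_ge0 k x : (0 <= wsum k x)%E.
Proof. by apply: esum_ge0 => a _; rewrite lee_fin nrm2_ge0. Qed.

Section energy.
Variables (E : preHilbertType R) (p : H -> E).
Hypothesis energy : forall x,
  ((nrm2 x)%:E = (nrm2 (p x))%:E + \esum_(j in setT) (nrm2 (G j x))%:E)%E.

(** The energy identity, applied [k] times: what has been emitted along words
    shorter than [k], plus what is left along words of length [k]. *)
Lemma energy_telescope k x :
  ((nrm2 x)%:E = \esum_(a in [set a : seq J | (size a < k)%N]) (nrm2 (p (act a x)))%:E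
     + wsum k x)%E.
Proof.
have p0 a y : (0 <= (nrm2 (p (act a y)))%:E)%E by rewrite lee_fin nrm2_ge0.
elim: k x => [|k IH] x.
  by rewrite (_ : [set a | _] = set0) ?esum_set0 ?add0e ?wsum0 //; apply/seteqP; split.
rewrite esum_words_cond // ifT; last exact/mem_set.
rewrite wsumS -addeA -esumD.
- by rewrite energy; congr (_ + _)%E; apply: eq_esum => j _; rewrite IH.
- by move=> j _; apply: esum_ge0.
- by move=> j _; exact: wsum_ge0.
Qed.

Lemma energy_bound x :
  (\esum_(a in setT) (nrm2 (p (act a x)))%:E <= (nrm2 x)%:E)%E.
Proof.
apply: esum_le_fset => A; rewrite -lee_fin.
pose k := (\max_(a <- A) size a).+1.
rewrite (energy_telescope k); apply: le_trans (leeDl _ (wsum_ge0 _ _)).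
apply: esum_ge; exists [set` A]; last by rewrite -fsbig_seq ?fset_uniq // sumEFin.
by split=> // a /= aA; rewrite ltnS; apply: leq_bigmax_seq.
Qed.

Lemma energy_kernel k x : (forall a, p (act a x) = 0) -> wsum k x = (nrm2 x)%:E.
Proof.
move=> h; rewrite (energy_telescope k) esum1 ?add0e // => a _.
by rewrite h nrm20.
Qed.

(** If all of the energy is emitted eventually, nothing is left in the limit: a
    finite set of words carries all but [e] of it, and words are longer than those
    from some [k] on. *)
Lemma energy_tail x :
  (nrm2 x)%:E = \esum_(a in setT) (nrm2 (p (act a x)))%:E ->
  wsum ^~ x @ \oo --> 0%E.
Proof.
move=> hx.
have fin k : wsum k x \is a fin_num.
  rewrite ge0_fin_numE ?wsum_ge0 //.
  apply: le_lt_trans (ltry (nrm2 x)); rewrite (energy_telescope k x).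
  by rewrite leeDr // esum_ge0 // => a _; rewrite lee_fin nrm2_ge0.
apply/fine_cvgP; split; first by near=> k.
apply/cvgrPdist_lt => e e0.
have [A hA] : exists A : {fset seq J}, nrm2 x - e < \sum_(a <- A) nrm2 (p (act a x)).
  apply: contrapT => h; suff : nrm2 x <= nrm2 x - e by lra.
  rewrite -lee_fin {1}hx; apply: esum_le_fset => A.
  by rewrite leNgt; apply/negP => hA; apply: h; exists A.
exists (\max_(a <- A) size a).+1 => // k /= Ak.
rewrite sub0r normrN ger0_norm ?fine_ge0 ?wsum_ge0 //.
have h1 : ((\sum_(a <- A) nrm2 (p (act a x)))%:E <=
    \esum_(a in [set a : seq J | (size a < k)%N]) (nrm2 (p (act a x)))%:E)%E.
  apply: esum_ge; exists [set` A]; last by rewrite -fsbig_seq ?fset_uniq // sumEFin.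
  split=> // a /= aA; apply: leq_trans Ak; rewrite ltnS; exact: leq_bigmax_seq.
have := energy_telescope k x; rewrite -(fineK (fin k)) => h2.
have : ((\sum_(a <- A) nrm2 (p (act a x)) + fine (wsum k x))%:E <= (nrm2 x)%:E)%E.
  by rewrite h2 EFinD leeD2r.
by rewrite lee_fin; lra.
Unshelve. all: by end_near.
Qed.

End energy.
End word_action.

Lemma adj_word_op (R : realType) (J : choiceType) (H : hilbertType R)
    (T : J -> bop H H) a h : adj (word_op T a) h = act (fun j => adj (T j)) a h.
Proof.
have [B hB] : exists B : bop H H, forall x, B x = act (fun j => adj (T j)) a x.
  elim: a => [|j a [B hB]]; first by exists (bop_id H).
  by exists (bop_comp B (adj (T j))) => x; rewrite /= hB.
rewrite (@adjE _ _ _ _ B) // => x y; rewrite hB.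
elim: a x y {B hB} => [|j a IH] x y //=.
by rewrite adjP IH.
Qed.

Lemma word_sumE (R : realType) (J : choiceType) (H : hilbertType R)
    (T : J -> bop H H) k h : word_sum T k h = wsum (fun j => adj (T j)) k h.
Proof. by apply: eq_esum => a _; rewrite adj_word_op. Qed.

(** * Creation operators *)
Section shifts.
Variables (R : realType) (J : choiceType) (K : hilbertType R).
Implicit Types f g : fock J K.

Lemma tensE a k : tens a k = single a k :> fock J K.
Proof. by apply: l2_ext. Qed.

Fact unshift_in_l2 j f : in_l2 (fun a => f (j :: a)).
Proof.
apply/asboolP; exists (nrm2 f) => A.
apply: le_trans (l2_sum_le f [fset j :: a | a in A]%fset).
by rewrite big_imfset //= => a b _ _ [].
Qed.

(** The annihilation operator [S_j^*], see [adj_shift]. *)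
Definition unshift_fun j f : fock J K := L2 (unshift_in_l2 j f).

Fact unshift_linear j : linear (unshift_fun j).
Proof. by move=> a f g; apply: l2_ext. Qed.

Fact unshift_bnd j f : nrm2 (unshift_fun j f) <= 1 * nrm2 f.
Proof.
rewrite mul1r; apply: l2_le => A.
apply: le_trans (l2_sum_le f [fset j :: a | a in A]%fset).
by rewrite big_imfset //= => a b _ _ [].
Qed.

Definition unshift j : bop (fock J K) (fock J K) :=
  bop_of (@unshift_linear j) (@unshift_bnd j).

Lemma unshiftE j f a : unshift j f a = f (j :: a). Proof. by []. Qed.

Lemma unshift_energy f :
  ((nrm2 f)%:E = (nrm2 (f [::]))%:E + \esum_(j in setT) (nrm2 (unshift j f))%:E)%E.
Proof.
rewrite nrm2_l2_esum esum_words => [|a]; last by rewrite lee_fin nrm2_ge0.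
by congr (_ + _)%E; apply: eq_esum => j _; rewrite nrm2_l2_esum.
Qed.

Lemma act_unshift a f b : act unshift a f b = f (a ++ b).
Proof. by elim: a f => [|j a IH] f //=; rewrite IH. Qed.

Lemma wsum_unshift_cvg f : wsum unshift ^~ f @ \oo --> 0%E.
Proof.
apply: (energy_tail unshift_energy); rewrite nrm2_l2_esum.
by apply: eq_esum => a _; rewrite act_unshift cats0.
Qed.

Lemma shift_cons j f i a : Defs.shift j f (i :: a) = if i == j then f a else 0.
Proof. by []. Qed.

Lemma unshift_shift i j f : unshift i (Defs.shift j f) = if i == j then f else 0.
Proof. by apply: l2_ext => a; rewrite unshiftE shift_cons; case: ifP. Qed.

Lemma nrm2_shift j f : nrm2 (Defs.shift j f) = nrm2 f.
Proof.
apply: EFin_inj; rewrite unshift_energy nrm20 add0e.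
rewrite (_ : \esum_(i in setT) _ = \esum_(i in setT) if i \in [set j] then (nrm2 f)%:E else 0)%E.
  by rewrite -esum_mkcond esum_set1 // lee_fin nrm2_ge0.
apply: eq_esum => i _; rewrite unshift_shift.
have [->|ij] := eqVneq i j; first by rewrite ifT //; exact/mem_set.
by rewrite nrm20 ifF //; apply/negP => /set_mem /eqP; rewrite (negPf ij).
Qed.

Fact shift_linear j : linear (Defs.shift j : fock J K -> fock J K).
Proof.
move=> a f g; apply: l2_ext => -[|i b]; rewrite l2D l2Z /= ?scaler0 ?addr0 //.
by case: ifP => // _; rewrite scaler0 addr0.
Qed.

Fact shift_bnd j f : nrm2 (Defs.shift j f) <= 1 * nrm2 f.
Proof. by rewrite mul1r nrm2_shift. Qed.

Definition shift_bop j : bop (fock J K) (fock J K) :=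
  bop_of (@shift_linear j) (@shift_bnd j).

Lemma shift_single j a k : Defs.shift j (single a k) = single (j :: a) k :> fock J K.
Proof.
apply: l2_ext => -[|i b] //; rewrite shift_cons !singleE eqseq_cons.
by case: eqP.
Qed.

(** Both sides are continuous in [f], and agree for [f = single a k]. *)
Lemma dot_shift j f g : dot (Defs.shift j f) g = dot f (unshift j g).
Proof.
suff -> : Defs.shift j f = adj (unshift j) f by rewrite adjPl.
apply: (@eq_bop_single _ _ _ _ (shift_bop j) (adj (unshift j))) => a k.
rewrite bop_ofE shift_single; apply/esym/adj_uniq => x.
by rewrite !dot_singler.
Qed.

Lemma adj_shift j g : adj (@Defs.shift R J K j) g = unshift j g.
Proof. by apply: adjE => x y; exact: dot_shift. Qed.

End shifts.
Arguments unshift {R J K} j.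
Arguments shift_bop {R J K} j.


(** * Sums, pairs and corestrictions of operators *)
Section bop_combinators.
Variable R : realType.
Implicit Types U V W : hilbertType R.

Fact bop_add_linear U V (A B : bop U V) : linear (fun x => A x + B x).
Proof. by move=> a x y; rewrite !linearP scalerDr addrACA. Qed.

Fact bop_add_bnd U V (A B : bop U V) :
  exists C, forall x, nrm2 (A x + B x) <= C * nrm2 x.
Proof.
have [C _ hC] := bop_bounded A; have [D _ hD] := bop_bounded B.
exists (C *+ 2 + D *+ 2) => x; apply: le_trans (nrm2D_le _ _) _.
by have := hC x; have := hD x; lra.
Qed.

Definition bop_add U V (A B : bop U V) : bop U V :=
  bop_of (bop_add_linear A B) (projT2 (cid (bop_add_bnd A B))).

Fact bop_opp_linear U V (A : bop U V) : linear (fun x => - A x).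
Proof. by move=> a x y; rewrite (linearP A) opprD scalerN. Qed.

Fact bop_opp_bnd U V (A : bop U V) :
  exists C, forall x, nrm2 (- A x) <= C * nrm2 x.
Proof. by have [C _ hC] := bop_bounded A; exists C => x; rewrite nrm2N. Qed.

Definition bop_opp U V (A : bop U V) : bop U V :=
  bop_of (bop_opp_linear A) (projT2 (cid (bop_opp_bnd A))).

Fact bop_pair_linear U V W (A : bop U V) (B : bop U W) :
  linear (fun x => (A x, B x) : hprod V W).
Proof. by move=> a x y; rewrite !linearP. Qed.

Fact bop_pair_bnd U V W (A : bop U V) (B : bop U W) :
  exists C, forall x, nrm2 ((A x, B x) : hprod V W) <= C * nrm2 x.
Proof.
have [C _ hC] := bop_bounded A; have [D _ hD] := bop_bounded B.
exists (C + D) => x; rewrite nrm2_hprod /=.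
by have := hC x; have := hD x; lra.
Qed.

Definition bop_pair U V W (A : bop U V) (B : bop U W) : bop U (hprod V W) :=
  bop_of (bop_pair_linear A B) (projT2 (cid (bop_pair_bnd A B))).

Fact bop_fst_bnd V W (x : hprod V W) : nrm2 x.1 <= 1 * nrm2 x.
Proof. by rewrite mul1r nrm2_hprod lerDl nrm2_ge0. Qed.

Definition bop_fst V W : bop (hprod V W) V :=
  bop_of (fun _ _ _ => erefl) (@bop_fst_bnd V W).

Fact bop_snd_bnd V W (x : hprod V W) : nrm2 x.2 <= 1 * nrm2 x.
Proof. by rewrite mul1r nrm2_hprod lerDr nrm2_ge0. Qed.

Definition bop_snd V W : bop (hprod V W) W :=
  bop_of (fun _ _ _ => erefl) (@bop_snd_bnd V W).

Definition bop_inl V W : bop V (hprod V W) := bop_pair (bop_id V) (bop0 V W).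
Definition bop_inr V W : bop W (hprod V W) := bop_pair (bop0 W V) (bop_id W).

Lemma dot_hprod V W (x y : hprod V W) : dot x y = dot x.1 y.1 + dot x.2 y.2.
Proof. by []. Qed.

Definition corestrict U V (A : bop U V) (M : csubspace V) : bop U (sub M) :=
  bop_comp (Defs.proj M) A.

Lemma corestrictE U V (A : bop U V) (M : csubspace V) x :
  carrier M (A x) -> val (corestrict A M x) = A x.
Proof. by move=> h; rewrite /= -[A x]/(val (in_subspace h)) proj_val. Qed.

End bop_combinators.

(** * Wold decomposition *)

(** [G j] stands for the adjoint [V_j^*] of an isometry and [p] for the projection
    onto the wandering space.  The hypotheses say that [x |-> (p x, (G j x)_j)] is
    unitary; [onto_p] and [onto_G] solve it on generators.  They are the relations
    of a row isometry, stated without the isometries. *)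
Section wold.
Variables (R : realType) (J : choiceType) (K E : hilbertType R).
Variables (G : J -> bop K K) (p : bop K E).
Hypothesis energy : forall x,
  ((nrm2 x)%:E = (nrm2 (p x))%:E + \esum_(j in setT) (nrm2 (G j x))%:E)%E.
Hypothesis onto_p : forall d, exists2 x, p x = d & forall j, G j x = 0.
Hypothesis onto_G : forall j y,
  exists2 x, p x = 0 & forall i, G i x = if i == j then y else 0.

Fixpoint act_bop (a : seq J) : bop K K :=
  if a is j :: b then bop_comp (act_bop b) (G j) else bop_id K.

Lemma act_bopE a x : act_bop a x = act G a x.
Proof. by elim: a x => [|j a IH] x //=; rewrite IH. Qed.

Fact wold_bnd x :
  (\esum_(a in setT) (nrm2 (bop_comp p (act_bop a) x))%:E <= (nrm2 x)%:E)%E.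
Proof.
apply: le_trans (energy_bound energy x).
by apply: le_esum => a _; rewrite /= act_bopE.
Qed.

Definition wold : bop K (fock J E) := column wold_bnd.

Lemma woldE x a : wold x a = p (act G a x).
Proof. by rewrite -act_bopE. Qed.

Lemma wold_contraction : Defs.contraction wold.
Proof. exact: column_contraction. Qed.

Lemma wold_G j x : wold (G j x) = unshift j (wold x).
Proof. by apply: l2_ext => a; rewrite unshiftE !woldE. Qed.

Lemma wold_shift j x y : p x = 0 -> (forall i, G i x = if i == j then y else 0) ->
  wold x = Defs.shift j (wold y).
Proof.
move=> px Gx; apply: l2_ext => -[|i a]; rewrite woldE //= Gx.
case: eqP => _; first by rewrite act_bopE.
by rewrite -act_bopE !linear0.
Qed.

Lemma nrm2_onto_p x : (forall j, G j x = 0) -> nrm2 x = nrm2 (p x).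
Proof.
move=> Gx; apply: EFin_inj; rewrite energy esum1 ?adde0 // => j _.
by rewrite Gx nrm20.
Qed.

Lemma nrm2_onto_G x j y : p x = 0 -> (forall i, G i x = if i == j then y else 0) ->
  nrm2 x = nrm2 y.
Proof.
move=> px Gx; apply: EFin_inj; rewrite energy px nrm20 add0e.
rewrite (_ : \esum_(i in setT) _ = \esum_(i in setT) if i \in [set j] then (nrm2 y)%:E else 0)%E.
  by rewrite -esum_mkcond esum_set1 // lee_fin nrm2_ge0.
apply: eq_esum => i _; rewrite Gx.
have [->|ij] := eqVneq i j; first by rewrite ifT //; exact/mem_set.
by rewrite nrm20 ifF //; apply/negP => /set_mem /eqP; rewrite (negPf ij).
Qed.

(** A vector that attains the norm of the contraction [wold] is recovered by its
    adjoint. *)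
Lemma wold_lift x a d : wold x = single a d -> nrm2 x = nrm2 d ->
  adj wold (single a d) = x.
Proof.
move=> Wx nx; rewrite -Wx (contraction_adjK wold_contraction) //.
by rewrite Wx nrm2_single.
Qed.

Lemma adj_wold_nil x : (forall j, G j x = 0) ->
  wold x = single [::] (p x) /\ adj wold (single [::] (p x)) = x.
Proof.
move=> Gx; have Wx : wold x = single [::] (p x).
  apply: l2_ext => -[|i a]; rewrite woldE //= Gx.
  by rewrite -act_bopE !linear0.
by split=> //; apply: wold_lift Wx _; exact: nrm2_onto_p.
Qed.

(** [single a d] is the image of [V_a] applied to a vector of the wandering space,
    which has the same norm. *)
Lemma wold_single a d : wold (adj wold (single a d)) = single a d.
Proof.
suff [x Wx nx] : exists2 x, wold x = single a d & nrm2 x = nrm2 d.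
  by rewrite (wold_lift Wx).
elim: a => [|j a [y Wy ny]].
  have [x px Gx] := onto_p d; exists x; last by rewrite (nrm2_onto_p Gx) px.
  by have [] := adj_wold_nil Gx; rewrite px.
have [x px Gx] := onto_G j y; exists x; last by rewrite (nrm2_onto_G px Gx).
by rewrite (wold_shift px Gx) Wy shift_single.
Qed.

Lemma wold_coisometry g : wold (adj wold g) = g.
Proof.
exact: (@eq_bop_single _ _ _ _ (bop_comp wold (adj wold)) (bop_id _) wold_single).
Qed.

Lemma G_adj_wold j g : G j (adj wold g) = adj wold (unshift j g).
Proof.
suff key a d : G j (adj wold (single a d)) = adj wold (unshift j (single a d)).
  exact: (@eq_bop_single _ _ _ _ (bop_comp (G j) (adj wold))
    (bop_comp (adj wold) (unshift j)) key).
case: a => [|i a].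
  have [x px Gx] := onto_p d; have [_] := adj_wold_nil Gx; rewrite px => ->.
  by rewrite Gx (_ : unshift j _ = 0) ?linear0 //; exact: l2_ext.
have [x px Gx] := onto_G i (adj wold (single a d)).
have Wx : wold x = single (i :: a) d.
  by rewrite (wold_shift px Gx) wold_single shift_single.
have -> : adj wold (single (i :: a) d) = x.
  apply: (wold_lift Wx); rewrite (nrm2_onto_G px Gx).
  have := nrm2_adj_le wold_contraction (single a d); rewrite nrm2_single => h1.
  have := (contraction_nrm2 _).1 wold_contraction (adj wold (single a d)).
  by rewrite wold_single nrm2_single => h2; apply/le_anti; rewrite h1 h2.
rewrite Gx -shift_single unshift_shift.
by case: eqP => // _; rewrite linear0.
Qed.

Lemma wold_kernel k x : wold x = 0 -> wsum G k x = (nrm2 x)%:E.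
Proof. by move=> Wx; apply: (energy_kernel energy) => a; rewrite -woldE Wx. Qed.

(** The projection onto the kernel of [wold]. *)
Definition residue : bop K K :=
  bop_add (bop_id K) (bop_opp (bop_comp (adj wold) wold)).

Lemma residueE x : residue x = x - adj wold (wold x). Proof. by []. Qed.

Lemma wold_residue x : wold (residue x) = 0.
Proof. by rewrite residueE linearB wold_coisometry subrr. Qed.

Lemma dot_residue z x : wold z = 0 -> dot z (residue x) = dot z x.
Proof. by move=> Wz; rewrite residueE dotBr -adjP Wz dot0l subr0. Qed.

Lemma nrm2_residue x : nrm2 (residue x) = nrm2 x - nrm2 (wold x).
Proof.
rewrite /nrm2 dot_residue ?wold_residue // residueE dotBl adjPl.
by case: (dot x x) => a b; case: (dot (wold x) (wold x)).
Qed.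

End wold.


(** * The Schaeffer dilation *)

(** [A] intertwines [A^* A] and [A A^*], and square roots inherit intertwining
    relations. *)
Lemma defect_intertwine (R : realType) (U V : hilbertType R) (A : bop U V) :
  Defs.contraction A -> forall x, A (defect A x) = defect (adj A) (A x).
Proof.
move=> hA.
have hA' : Defs.contraction (adj A) by apply/contraction_nrm2; exact: nrm2_adj_le.
apply: (sqrt_op_intertwine (X := bop_comp (adj A) A) (X' := bop_comp (adj (adj A)) (adj A))).
- exact: defect_X_sa.
- exact: defect_X_contr.
- by [].
- exact: defect_X_sa.
- exact: defect_X_contr.
- by [].
- by move=> x /=; rewrite adjK.
Qed.

Section row_contraction_defects.
Variables (R : realType) (J : choiceType) (H : hilbertType R).
Variable T : J -> bop H H.
Hypothesis hT : row_contraction T.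

Let hb : row_bounded T := (row_contractionP T).1 hT.

(** [T^*] for the row [T]: its adjoint is [row_op T]. *)
Definition rowadj : bop H (l2 J H) := column hb.

Lemma rowadjE h j : rowadj h j = adj (T j) h. Proof. by []. Qed.

Lemma rowadj_contraction : Defs.contraction rowadj.
Proof. exact: column_contraction. Qed.

Lemma adj_rowadj_single j h : adj rowadj (single j h) = T j h.
Proof. by rewrite adj_column_single adjK. Qed.

Lemma row_opE h : row_op T h = adj rowadj h.
Proof.
rewrite -usum_bop; congr usum; apply/funext => j.
by rewrite adj_rowadj_single.
Qed.

Lemma DeltaTE : DeltaT T = defect (adj rowadj).
Proof.
rewrite /DeltaT (_ : row_op T = adj rowadj :> (_ -> _)) //.
by apply/funext => h; exact: row_opE.
Qed.

Lemma DeltaTsE : DeltaTs T = defect rowadj.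
Proof.
rewrite /DeltaTs /defect; congr sqrt_op; apply/funext => h.
by rewrite (rowTTE hb).
Qed.

Let adj_contr : Defs.contraction (adj rowadj).
Proof. by apply/contraction_nrm2; exact: nrm2_adj_le rowadj_contraction. Qed.

Lemma DeltaT_sa x y : dot (DeltaT T x) y = dot x (DeltaT T y).
Proof. by rewrite DeltaTE defect_sa. Qed.

Lemma DeltaTs_sa x y : dot (DeltaTs T x) y = dot x (DeltaTs T y).
Proof. by rewrite DeltaTsE (defect_sa rowadj_contraction). Qed.

Lemma DeltaTK x : DeltaT T (DeltaT T x) = x - rowadj (adj rowadj x).
Proof. by rewrite DeltaTE defectK // adjK. Qed.

Lemma DeltaTsK x : DeltaTs T (DeltaTs T x) = x - adj rowadj (rowadj x).
Proof. by rewrite DeltaTsE (defectK rowadj_contraction). Qed.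

Lemma rowadj_Delta h : rowadj (DeltaTs T h) = DeltaT T (rowadj h).
Proof. by rewrite DeltaTE DeltaTsE (defect_intertwine rowadj_contraction). Qed.

Lemma row_Delta d : DeltaTs T (adj rowadj d) = adj rowadj (DeltaT T d).
Proof.
by apply: dot_injr => x; rewrite -DeltaTs_sa -!adjP rowadj_Delta DeltaT_sa.
Qed.

(** So [T^*] and [T] map the two defect spaces into each other, and the Halmos
    unitary can be written between them. *)
Lemma rowadj_Dstar h : carrier (Dstar T) h -> carrier (Dspace T) (rowadj h).
Proof.
move=> hh; apply: (@clspan_sub _ _ _ (preim_sp rowadj (Dspace T)) _ _ hh).
move=> _ [x _ <-]; change (carrier (Dspace T) (rowadj (DeltaTs T x))).
rewrite rowadj_Delta.
by apply: sub_clspan; exists (rowadj x).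
Qed.

Lemma row_Dspace d : carrier (Dspace T) d -> carrier (Dstar T) (adj rowadj d).
Proof.
move=> hd; apply: (@clspan_sub _ _ _ (preim_sp (adj rowadj) (Dstar T)) _ _ hd).
move=> _ [x _ <-]; change (carrier (Dstar T) (adj rowadj (DeltaT T x))).
rewrite -row_Delta.
by apply: sub_clspan; exists (adj rowadj x).
Qed.

(** [(h, d) |-> (T^* h + Delta_T d, Delta_T* h - T d)] is the Halmos unitary: by
    [row_Delta] the two cross terms are equal, and they enter with opposite
    signs. *)
Lemma halmos_energy h d :
  nrm2 (rowadj h + DeltaT T d) + nrm2 (DeltaTs T h - adj rowadj d) = nrm2 h + nrm2 d.
Proof.
have n1 : nrm2 (DeltaT T d) = nrm2 d - nrm2 (adj rowadj d).
  by rewrite DeltaTE nrm2_defect.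
have n2 : nrm2 (DeltaTs T h) = nrm2 h - nrm2 (rowadj h).
  by rewrite DeltaTsE (nrm2_defect rowadj_contraction).
rewrite nrm2D nrm2B n1 n2.
have -> : dot (rowadj h) (DeltaT T d) = dot (DeltaTs T h) (adj rowadj d).
  by rewrite DeltaTs_sa row_Delta adjP.
by lra.
Qed.

Local Notation E := (sub (Dspace T)).
Local Notation Es := (sub (Dstar T)).

(** The space of the Schaeffer form of the minimal isometric dilation of [T];
    here [fock J E] carries the part of the dilation outside [H]. *)
Definition schaeffer : hilbertType R := hprod H (fock J E).

(** The adjoint [V_j^*] of the dilating isometry, see [dil_iso].  It extends
    [T_j^*], see [dil_space_in]. *)
Definition dil (j : J) : bop schaeffer schaeffer :=
  bop_pair
    (bop_add (bop_comp (adj (T j)) (bop_fst _ _))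
       (bop_comp (l2_coord j) (bop_comp (DeltaT T) (bop_comp (Defs.incl (Dspace T))
          (bop_comp (l2_coord [::]) (bop_snd _ _))))))
    (bop_comp (unshift j) (bop_snd _ _)).

Definition dil_out_fun : bop schaeffer H :=
  bop_add (bop_comp (DeltaTs T) (bop_fst _ _))
    (bop_opp (bop_comp (adj rowadj) (bop_comp (Defs.incl (Dspace T))
       (bop_comp (l2_coord [::]) (bop_snd _ _))))).

Definition dil_out : bop schaeffer Es := corestrict dil_out_fun (Dstar T).

Lemma dilE j x : dil j x =
  (adj (T j) x.1 + DeltaT T (val (x.2 [::])) j, unshift j x.2).
Proof. by []. Qed.

Lemma dil_outE x : val (dil_out x) = DeltaTs T x.1 - adj rowadj (val (x.2 [::])).
Proof.
apply: corestrictE; apply: csubB; first by apply: sub_clspan; exists x.1.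
by apply: row_Dspace; exact: subP.
Qed.

Lemma dil_energy x :
  ((nrm2 x)%:E = (nrm2 (dil_out x))%:E + \esum_(j in setT) (nrm2 (dil j x))%:E)%E.
Proof.
rewrite (nrm2_sub (dil_out x)) dil_outE nrm2_hprod.
under eq_esum => j _ do rewrite dilE nrm2_hprod EFinD.
rewrite esumD => [|j _|j _]; try by rewrite lee_fin nrm2_ge0.
have -> : ((nrm2 x.1 + nrm2 x.2)%:E = (nrm2 x.1)%:E + ((nrm2 (val (x.2 [::])))%:E +
    \esum_(j in setT) (nrm2 (unshift j x.2))%:E))%E.
  by rewrite EFinD; congr (_ + _)%E; exact: unshift_energy.
rewrite [LHS]addeA [RHS]addeA.
congr (_ + _)%E; rewrite -EFinD -halmos_energy [X in X%:E]addrC EFinD.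
by congr (_ + _)%E; exact: (nrm2_l2_esum (rowadj x.1 + DeltaT T (val (x.2 [::])))).
Qed.

Lemma dil_onto_out d : exists2 x, dil_out x = d & forall j, dil j x = 0.
Proof.
have he := rowadj_Dstar (subP d).
exists ((DeltaTs T (val d), single [::] (- in_subspace he)) : schaeffer).
  apply: val_inj; rewrite dil_outE single_same (linearN (Defs.incl (Dspace T))).
  by rewrite (linearN (adj rowadj)) opprK DeltaTsK subrK.
move=> j; rewrite dilE; congr pair; last by apply: l2_ext.
rewrite single_same (linearN (Defs.incl (Dspace T))) (linearN (DeltaT T)).
rewrite -rowadjE rowadj_Delta; exact: subrr.
Qed.

Definition to_Dspace : bop (l2 J H) E := corestrict (DeltaT T) (Dspace T).

Lemma to_DspaceE c : val (to_Dspace c) = DeltaT T c.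
Proof. by apply: corestrictE; apply: sub_clspan; exists c. Qed.

(** The dilating isometry [V_j]. *)
Definition dil_iso j (y : schaeffer) : schaeffer :=
  (T j y.1, Defs.shift j y.2 + single [::] (to_Dspace (single j y.1))).

Lemma dil_out_iso j y : dil_out (dil_iso j y) = 0.
Proof.
apply: val_inj; rewrite dil_outE l2D single_same add0r to_DspaceE.
by rewrite -row_Delta adj_rowadj_single subrr.
Qed.

Lemma dil_dil_iso i j y : dil i (dil_iso j y) = if i == j then y else 0.
Proof.
rewrite dilE l2D single_same add0r to_DspaceE DeltaTK.
have -> : adj (T i) (T j y.1) + (single j y.1 - rowadj (adj rowadj (single j y.1))) i =
    single j y.1 i.
  by rewrite adj_rowadj_single l2B rowadjE addrC subrK.
have -> : unshift i (Defs.shift j y.2 + single [::] (to_Dspace (single j y.1))) =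
    if i == j then y.2 else 0.
  rewrite linearD unshift_shift (_ : unshift i (single _ _) = 0) ?addr0 //.
  exact: l2_ext.
by rewrite singleE; case: eqP => // _; case: y.
Qed.

Lemma dil_onto j y :
  exists2 x, dil_out x = 0 & forall i, dil i x = if i == j then y else 0.
Proof. by exists (dil_iso j y) => [|i]; [exact: dil_out_iso | exact: dil_dil_iso]. Qed.

Definition dil_wold : bop schaeffer (fock J Es) := wold dil_energy.

End row_contraction_defects.


(** * The characteristic function *)
Section fock_joins.
Variables (R : realType) (J : choiceType) (K : hilbertType R).

Lemma adj_unshift j (f : fock J K) : adj (unshift j) f = Defs.shift j f.
Proof. by apply: adj_uniq => x; rewrite dotC -dot_shift -dotC. Qed.

Lemma unshift_bound (f : fock J K) :
  (\esum_(j in setT) (nrm2 (unshift j f))%:E <= (nrm2 f)%:E)%E.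
Proof. by rewrite [leRHS]unshift_energy leeDr // lee_fin nrm2_ge0. Qed.

(** [h |-> \sum_j S_j h_j], obtained as an adjoint so that its boundedness comes
    for free. *)
Definition fock_join : bop (l2 J (fock J K)) (fock J K) := adj (column unshift_bound).

Lemma fock_join_single j f : fock_join (single j f) = Defs.shift j f.
Proof. by rewrite /fock_join adj_column_single adj_unshift. Qed.

Lemma fock_join_nil h : fock_join h [::] = 0.
Proof.
apply: dot_inj => k; rewrite -dot_singler adjPl.
by rewrite (_ : column _ _ = 0) ?dot0r ?dot0l //; apply: l2_ext => j; exact: l2_ext.
Qed.

Lemma fock_join_cons h j b : fock_join h (j :: b) = h j b.
Proof.
apply: dot_inj => k; rewrite -dot_singler adjPl.
have -> : column unshift_bound (single (j :: b) k) = single j (single b k).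
  apply: l2_ext => i; apply: l2_ext => c.
  rewrite columnE unshiftE !singleE eqseq_cons.
  by case: (i == j) => //=; rewrite singleE.
by rewrite !dot_singler.
Qed.

Lemma multi_analytic_eq (K' : hilbertType R) (A B : bop (fock J K) (fock J K')) :
  multi_analytic A -> multi_analytic B ->
  (forall k, A (tens [::] k) = B (tens [::] k)) -> forall f, A f = B f.
Proof.
move=> hA hB h; apply: eq_bop_single; elim=> [|j a IH] k.
  by rewrite -tensE h.
by rewrite -shift_single hA hB IH.
Qed.

Lemma dot_shiftr j (f g : fock J K) : dot f (Defs.shift j g) = dot (unshift j f) g.
Proof. by rewrite dotC dot_shift -dotC. Qed.

End fock_joins.
Arguments fock_join {R J K}.

Section characteristic_function.
Variables (R : realType) (J : choiceType) (H : hilbertType R).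
Variable T : J -> bop H H.
Hypothesis hT : row_contraction T.

Local Notation E := (sub (Dspace T)).
Local Notation Es := (sub (Dstar T)).
Local Notation W := (dil_wold hT).

Definition fock_in : bop (fock J E) (schaeffer T) := bop_inr H (fock J E).
Definition space_in : bop H (schaeffer T) := bop_inl H (fock J E).

Lemma fock_inE f : fock_in f = (0, f). Proof. by []. Qed.
Lemma space_inE h : space_in h = (h, 0). Proof. by []. Qed.

Lemma dil_space_in j h : dil T j (space_in h) = space_in (adj (T j) h).
Proof.
rewrite dilE !space_inE; congr pair; last by apply: l2_ext.
by rewrite -[RHS]addr0; congr (_ + _); exact: (linear0 (bop_comp (l2_coord j) (DeltaT T))).
Qed.

Lemma act_dil_space_in a h :
  act (dil T) a (space_in h) = space_in (act (fun j => adj (T j)) a h).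
Proof. elim: a h => [//|j a IH] h.
by rewrite -[LHS]/(act (dil T) a (dil T j (space_in h))) dil_space_in IH. Qed.

Lemma nrm2_space_in h : nrm2 (space_in h) = nrm2 h.
Proof. by rewrite nrm2_hprod nrm20 addr0. Qed.

Lemma nrm2_fock_in f : nrm2 (fock_in f) = nrm2 f.
Proof. by rewrite nrm2_hprod nrm20 add0r. Qed.

Lemma wold_space_in h a :
  val (W (space_in h) a) = DeltaTs T (adj (word_op T a) h).
Proof.
rewrite woldE act_dil_space_in dil_outE adj_word_op space_inE.
rewrite [X in _ - X](_ : _ = 0) ?subr0 //.
exact: (linear0 (adj (rowadj hT))).
Qed.

Fact poisson_bnd h : (\esum_(a in setT) (nrm2 (bop_comp (Defs.incl (Dstar T))
   (bop_comp (l2_coord a) (bop_comp W space_in)) h))%:E <= (nrm2 h)%:E)%E.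
Proof.
apply: (@le_trans _ _ (nrm2 (W (space_in h)))%:E).
  by rewrite nrm2_l2_esum; apply: le_esum.
by rewrite lee_fin -(nrm2_space_in h); exact: (contraction_nrm2 _).1 (wold_contraction _) _.
Qed.

(** The Poisson kernel [h |-> \sum_a e_a (x) Delta_T* T_a^* h]; the inner sum in the
    symbol of the characteristic function is its value at [(Delta_T h)_j]. *)
Definition poisson : bop H (fock J H) := column poisson_bnd.

Lemma poissonE h a : poisson h a = DeltaTs T (adj (word_op T a) h).
Proof. by rewrite -wold_space_in. Qed.

Lemma usum_poisson h :
  usum (fun a => tens a (DeltaTs T (adj (word_op T a) h))) = poisson h.
Proof.
rewrite -[RHS]/(bop_id _ (poisson h)) -usum_bop; congr usum; apply/funext => a.
by rewrite tensE -poissonE.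
Qed.

Lemma symbolE h : symbol T h = - tens [::] (adj (rowadj hT) h) +
  usum (fun j => Defs.shift j (poisson (DeltaT T h j))).
Proof.
rewrite /symbol row_opE; congr (_ + usum _); apply/funext => j.
by rewrite usum_poisson.
Qed.

Fact poisson_row_bnd (c : l2 J H) : (\esum_(j in setT)
  (nrm2 (bop_comp poisson (l2_coord j) c))%:E <= (nrm2 c)%:E)%E.
Proof.
rewrite [leRHS]nrm2_l2_esum; apply: le_esum => j _; rewrite lee_fin.
exact: (contraction_nrm2 _).1 (column_contraction _) _.
Qed.

Lemma symbol_join h : symbol T h =
  - tens [::] (adj (rowadj hT) h) + fock_join (column poisson_row_bnd (DeltaT T h)).
Proof.
rewrite symbolE -[fock_join _]usum_bop; congr (_ + usum _).
by apply/funext => j; rewrite fock_join_single.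
Qed.

(** At the empty word [W (0, xi)] is [- T xi_[]].  At [j :: b], the first step moves
    [xi_[]] to [(Delta_T xi_[])_j] in [H], where [W] is the Poisson kernel. *)
Lemma wold_symbol (h : E) a : val (W (fock_in (tens [::] h)) a) = symbol T (val h) a.
Proof.
rewrite symbol_join tensE l2D; case: a => [|j b].
  rewrite fock_join_nil addr0 woldE dil_outE fock_inE single_same.
  rewrite [X in X - _](_ : _ = 0); last exact: (linear0 (DeltaTs T)).
  by rewrite sub0r tensE.
rewrite fock_join_cons.
have -> : (- tens [::] (adj (rowadj hT) (val h)) : fock J H) (j :: b) = 0.
  by rewrite tensE; exact: oppr0.
rewrite add0r -[RHS]/(poisson (DeltaT T (val h) j) b) woldE.
have -> : act (dil T) (j :: b) (fock_in (single [::] h)) =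
    act (dil T) b (space_in (DeltaT T (val h) j)).
  congr (act _ b _); rewrite dilE fock_inE space_inE single_same; congr pair.
    by rewrite linear0 add0r.
  exact: l2_ext.
by rewrite -(woldE (dil_energy hT)) wold_space_in -poissonE.
Qed.

Lemma dil_out_fock_shift j f : dil_out hT (fock_in (Defs.shift j f)) = 0.
Proof.
apply: val_inj; rewrite dil_outE fock_inE.
rewrite [X in X - _](_ : _ = 0); last exact: (linear0 (DeltaTs T)).
by rewrite sub0r -[X in - X]/(adj (rowadj hT) 0) linear0 oppr0.
Qed.

Lemma dil_fock_shift i j f :
  dil T i (fock_in (Defs.shift j f)) = if i == j then fock_in f else 0.
Proof.
rewrite dilE !fock_inE unshift_shift -[X in adj _ X]/(0 : H) linear0 add0r.
have -> : DeltaT T (val ((Defs.shift j f) [::])) i = 0.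
  exact: (linear0 (bop_comp (l2_coord i) (DeltaT T))).
by case: eqP.
Qed.

Lemma wold_fock_shift j f :
  W (fock_in (Defs.shift j f)) = Defs.shift j (W (fock_in f)).
Proof. exact: wold_shift (dil_out_fock_shift j f) (fun i => dil_fock_shift i j f). Qed.

(** The symbol determines a multi-analytic operator, so that the operator
    chosen in [charfun] is this one. *)
Lemma charfunE f : charfun T f = W (fock_in f).
Proof.
pose Theta := bop_comp W fock_in.
have PT : [/\ multi_analytic Theta, Defs.contraction Theta &
    forall (h : E) a, val (Theta (tens [::] h) a) = symbol T (val h) a].
  split; first exact: wold_fock_shift; last exact: wold_symbol.
  apply/contraction_nrm2 => g; rewrite -[leRHS]nrm2_fock_in.
  exact: (contraction_nrm2 _).1 (wold_contraction _) _.
have [h1 _ h3] : [/\ multi_analytic (charfun T), Defs.contraction (charfun T) &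
    forall (h : E) a, val (charfun T (tens [::] h) a) = symbol T (val h) a].
  apply: (@getPex _ [set Th : bop (fock J E) (fock J Es) | [/\ multi_analytic Th,
    Defs.contraction Th & forall (h : E) a, val (Th (tens [::] h) a) = symbol T (val h) a]]).
  by exists Theta.
case: PT => [t1 _ t3]; rewrite -[RHS]/(Theta f).
apply: (multi_analytic_eq h1 t1) => k; apply: l2_ext => a; apply: val_inj.
by rewrite t3 h3.
Qed.

Lemma charfun_multi_analytic : multi_analytic (charfun T).
Proof. by move=> j f; rewrite !charfunE wold_fock_shift. Qed.

Lemma charfun_contraction : Defs.contraction (charfun T).
Proof.
apply/contraction_nrm2 => g; rewrite -[leRHS]nrm2_fock_in charfunE.
exact: (contraction_nrm2 _).1 (wold_contraction _) _.
Qed.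

Section completely_noncoisometric.
Hypothesis T_cnc : cnc T.

(** Here complete non-coisometry enters.  A vector of [ker W] orthogonal to the
    Fock space is some [h] in [H]; the energy it loses at each step of the Wold
    decomposition vanishes, so [\sum_(|a| = k) ||T_a^* h||^2 = ||h||^2] for all
    [k]. *)
Lemma residual_in_space_eq0 x :
  W x = 0 -> (forall f, dot x (fock_in f) = 0) -> x = 0.
Proof.
move=> Wx xf.
have x2 : x.2 = 0.
  apply/nrm2_eq0; have := xf x.2; rewrite dot_hprod fock_inE [dot x.1 _]dot0r add0r.
  by rewrite /nrm2 => ->.
have xE : x = space_in x.1 by rewrite space_inE -x2; case: x {Wx xf x2}.
rewrite xE (_ : x.1 = 0) ?linear0 //; apply: T_cnc => k _.
rewrite word_sumE -nrm2_space_in -xE -(wold_kernel k Wx).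
apply: eq_esum => a _; rewrite [in RHS]xE act_dil_space_in nrm2_space_in.
by [].
Qed.

Local Notation Theta := (charfun T).
Local Notation Delta := (defect Theta).
Local Notation C := (residual_shift Theta).

Lemma nrm2_charfun_defect f :
  nrm2 (Delta f) = nrm2 (residue (dil_energy hT) (fock_in f)).
Proof.
rewrite (nrm2_residue _ (dil_onto_out hT) (dil_onto hT)) nrm2_fock_in.
by rewrite (nrm2_defect charfun_contraction) charfunE.
Qed.

(** [||Delta g|| = ||P g||] with [P] the projection onto [ker W]. *)
Fact residual_embedding_exists : exists Y : bop (sub (clrange Delta)) (schaeffer T),
  forall f, Y (to_clrange Delta f) = residue (dil_energy hT) (fock_in f).
Proof.
pose B := bop_comp (residue (dil_energy hT)) fock_in.
have hB f : nrm2 (B f) <= nrm2 (Delta f) by rewrite nrm2_charfun_defect.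
by have [Y hY] := extension hB; exists Y.
Qed.

(** The embedding [Y] of the residual space into [ker W] carries [C_j^*] to [V_j^*]:
    the difference lies in [ker W] and is orthogonal to the Fock space.  On
    [ker W] no energy is lost. *)
Lemma residual_wsum k u : multi_analytic Theta ->
  (forall j f, C j (to_clrange Delta f) = to_clrange Delta (Defs.shift j f)) ->
  wsum (fun j => adj (C j)) k u = (nrm2 u)%:E.
Proof.
move=> ma hC; have [Y hY] := residual_embedding_exists.
have Yiso : isometric Y.
  by apply: isometric_clrange => f; rewrite hY nrm2_charfun_defect.
have Ydot := isometric_dot Yiso.
have WY v : W (Y v) = 0.
  apply: (@eq_bop_clrange _ _ _ _ _ (bop_comp W Y) (bop0 _ _)) => f.
  rewrite -[LHS]/(W (Y (to_clrange Delta f))) hY.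
  exact: wold_residue (dil_onto_out hT) (dil_onto hT) _.
have YC j v : Y (adj (C j) v) = dil T j (Y v).
  apply/eqP; rewrite -subr_eq0; apply/eqP/residual_in_space_eq0.
    have WG : W (dil T j (Y v)) = unshift j (W (Y v)) by exact: wold_G.
    by rewrite (linearB W) WG !WY linear0 subrr.
  move=> f; rewrite dotBl.
  rewrite -(dot_residue _ (WY (adj (C j) v))) -hY Ydot.
  rewrite adjPl hC -Ydot hY (dot_residue _ (WY v)).
  rewrite dilE !dot_hprod !fock_inE [dot (Y v).2 _]dot_shiftr.
  by rewrite !dot0r subrr.
have Yact a v : Y (act (fun j => adj (C j)) a v) = act (dil T) a (Y v).
  elim: a v => [//|j a IH] v; rewrite -[RHS]/(act (dil T) a (dil T j (Y v))) -YC.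
  exact: IH.
have nY v : nrm2 (Y v) = nrm2 v by move/isometric_nrm2: Yiso.
rewrite -nY -(wold_kernel k (WY u)); apply: eq_esum => a _.
by rewrite -Yact nY.
Qed.

End completely_noncoisometric.
End characteristic_function.


(** * Unitary constants and the stable part *)
Section unitary_multi_analytic.
Variables (R : realType) (J : choiceType) (K K' : hilbertType R).
Variable A : bop (fock J K) (fock J K').
Hypotheses (A_ma : multi_analytic A) (A_iso : isometric A) (A_dense : dense (range A)).

Lemma isometric_dense_adjK y : A (adj A y) = y.
Proof.
apply/eqP; rewrite eq_sym -subr_eq0; apply/eqP/((dense_rangeP A).1 A_dense) => x.
by rewrite dotBr isometric_dot // adjP subrr.
Qed.

(** [A^* = A^-1] commutes with the shifts, hence [A] with their adjoints. *)
Lemma unshift_unitary j f : unshift j (A f) = A (unshift j f).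
Proof.
have AV g : adj A (Defs.shift j g) = Defs.shift j (adj A g).
  by rewrite -{1}(isometric_dense_adjK g) -A_ma isometric_adjK.
apply: dot_injr => g; rewrite -dot_shift -adjPl AV dot_shift.
by rewrite adjPl.
Qed.

(** Being annihilated by all [S_j^*] characterizes the vacuum vectors. *)
Lemma vacuum_unitary (k : K') :
  adj A (single [::] k) = single [::] (adj A (single [::] k) [::]).
Proof.
apply: l2_ext => -[|j a]; first by rewrite single_same.
suff h : unshift j (adj A (single [::] k)) = 0.
  by rewrite -[LHS]/(unshift j (adj A (single [::] k)) a) h.
rewrite -[LHS](isometric_adjK A_iso) -unshift_unitary isometric_dense_adjK.
by rewrite (_ : unshift j _ = 0) ?linear0 //; exact: l2_ext.
Qed.

Lemma unitary_multi_analytic_constant : unitary_constant A.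
Proof.
pose W := bop_comp (l2_coord [::]) (bop_comp A (single_bop K [::])).
have WE f a : A f a = W (f a).
  elim: a f => [|j a IH] f; last first.
    by rewrite -[LHS]/(unshift j (A f) a) unshift_unitary IH.
  apply: dot_inj => k.
  have key g : dot (A g [::]) k = dot (g [::]) (adj A (single [::] k) [::]).
    by rewrite -(dot_singler (A g)) (adjP A) vacuum_unitary dot_singler.
  by rewrite -[W _]/(A (single [::] (f [::])) [::]) !key single_same.
have AS k : A (single [::] k) = single [::] (W k).
  by apply: l2_ext => a; rewrite WE !singleE; case: eqP; rewrite ?linear0.
exists W; split => //; split.
  apply/isometric_nrm2 => k; rewrite -(nrm2_single ([::] : seq J)) -AS.
  by rewrite (isometric_nrm2 A).1 // nrm2_single.
move=> y; exists (adj A (single [::] y) [::]).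
by rewrite -WE isometric_dense_adjK single_same.
Qed.

End unitary_multi_analytic.

Section dichotomy.
Variables (R : realType) (J : choiceType) (H : hilbertType R).
Variable T : J -> bop H H.
Hypothesis hT : row_contraction T.

Local Notation E := (sub (Dspace T)).
Local Notation W := (dil_wold hT).
Local Notation into_fock := (fock_in T).
Local Notation into_space := (space_in T).

(** The range of [W^*], that is, the pure shift part of the dilation: the vectors
    on which the coisometry [W] preserves the norm. *)
Definition shift_part : csubspace (schaeffer T) :=
  eq_sp (bop_comp (adj W) W) (bop_id (schaeffer T)).

Lemma shift_partP x : carrier shift_part x <-> nrm2 (W x) = nrm2 x.
Proof.
split=> [h|]; last exact: (contraction_adjK (wold_contraction _)).
by rewrite /nrm2 -adjPl; congr (complex.Re (dot _ _)); exact: h.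
Qed.

(** The [C_{.0}] part of [T]: the vectors [h] with
    [\sum_(|a| = k) ||T_a^* h||^2 --> 0], as that limit is
    [||h||^2 - ||W h||^2]. *)
Definition stable_part : csubspace H := preim_sp into_space shift_part.

Lemma stable_part_invariant j h :
  carrier stable_part h -> carrier stable_part (adj (T j) h).
Proof.
move=> hh; change (adj W (W (into_space (adj (T j) h))) = into_space (adj (T j) h)).
rewrite -(dil_space_in T j h).
have -> : W (dil T j (into_space h)) = unshift j (W (into_space h)) by exact: wold_G.
rewrite -(G_adj_wold (dil_energy hT) (dil_onto_out hT) (dil_onto hT)).
by congr (dil T j _); exact: hh.
Qed.

(** [x = V_j y], and [W V_j = S_j W] with [V_j] and [S_j] isometric. *)
Lemma shift_part_lift j x y : dil_out hT x = 0 ->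
  (forall i, dil T i x = if i == j then y else 0) ->
  carrier shift_part y -> carrier shift_part x.
Proof.
move=> px Gx /shift_partP hy; apply/shift_partP.
have -> : W x = Defs.shift j (W y) by exact: wold_shift px Gx.
by rewrite nrm2_shift hy (nrm2_onto_G (dil_energy hT) px Gx).
Qed.

(** [shift_part] contains [H] and is invariant under the [V_j]; it contains
    [V_j h - T_j h = 1 (x) Delta_T (h e_j)], hence the whole Fock space. *)
Lemma charfun_isometric :
  (forall h, carrier stable_part h) -> isometric (charfun T).
Proof.
move=> hs.
have vac (e : E) : carrier shift_part (into_fock (single [::] e)).
  pose M := preim_sp (bop_comp into_fock (single_bop E [::])) shift_part.
  apply: (@clrange_dense _ _ _ _ M) => c.
  have -> : to_clrange (DeltaT T) c = to_Dspace T c.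
    by apply: val_inj; rewrite to_DspaceE.
  apply: (@l2_span _ _ _ (preim_sp (to_Dspace T) M)) => j h.
  change (carrier shift_part (into_fock (single [::] (to_Dspace T (single j h))))).
  have -> : into_fock (single [::] (to_Dspace T (single j h))) =
      dil_iso j (into_space h) - into_space (T j h).
    rewrite fock_inE !space_inE /dil_iso; congr pair; rewrite ?subrr //.
    by rewrite -[Defs.shift j _]/(shift_bop j 0) linear0 add0r subr0.
  apply: csubB; last exact: hs.
  exact: shift_part_lift (dil_out_iso hT _ _) (fun i => dil_dil_iso hT i _ _) (hs h).
apply/isometric_nrm2 => f; rewrite charfunE -[RHS](nrm2_fock_in f).
apply/shift_partP; apply: (@l2_span _ _ _ (preim_sp into_fock shift_part)).
elim=> [|j a IH] e; first exact: vac.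
change (carrier shift_part (into_fock (single (j :: a) e))).
rewrite -shift_single; apply: shift_part_lift (IH e).
  exact: dil_out_fock_shift.
by move=> i; exact: dil_fock_shift.
Qed.

(** If [y] is orthogonal to the range, then [W^* y] is orthogonal to the Fock space,
    so it lies in [H], and in the range of [W^*]. *)
Lemma charfun_dense :
  (forall h, carrier stable_part h -> h = 0) -> dense (range (charfun T)).
Proof.
move=> hs; apply/dense_rangeP => y hy; pose x := adj W y.
have Wx : W x = y by exact: (wold_coisometry (dil_energy hT) (dil_onto_out hT) (dil_onto hT)).
have x2 : x.2 = 0.
  apply: nrm2_eq0; have := hy x.2; rewrite charfunE adjP -/x dot_hprod fock_inE.
  by rewrite dot0l add0r /nrm2 => ->.
have xE : x = into_space x.1 by rewrite space_inE -x2; case: (x).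
have x10 : x.1 = 0.
  apply: hs; change (adj W (W (into_space x.1)) = into_space x.1).
  by rewrite -xE Wx.
by rewrite -Wx xE x10 !linear0.
Qed.

End dichotomy.


(** * The functional model *)
Lemma dot_in_subspace (R : realType) (V : hilbertType R) (M : csubspace V)
    (y : sub M) x (Mx : carrier M x) : dot y (in_subspace Mx) = dot (val y) x.
Proof. by []. Qed.

Section clrange_operator.
Variables (R : realType) (U V : hilbertType R) (A : bop U V).

Definition onto_clrange : bop U (sub (clrange A)) := corestrict A (clrange A).

Lemma onto_clrangeE x : onto_clrange x = to_clrange A x.
Proof.
by apply: val_inj; rewrite /onto_clrange corestrictE //; apply: sub_clspan; exists x.
Qed.

Lemma nrm2_to_clrange x : nrm2 (to_clrange A x) = nrm2 (A x).
Proof. by []. Qed.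

End clrange_operator.

Lemma adj_multi_analytic (R : realType) (J : choiceType) (K K' : hilbertType R)
    (A : bop (fock J K) (fock J K')) : multi_analytic A ->
  forall j f, adj A (unshift j f) = unshift j (adj A f).
Proof.
move=> hA j f; apply: dot_injr => g.
by rewrite -adjP -!dot_shift -hA adjP.
Qed.

Section residual_shift_theory.
Variables (R : realType) (J : choiceType) (E Es : hilbertType R).
Variable Theta : bop (fock J E) (fock J Es).
Hypotheses (Theta_ma : multi_analytic Theta) (Theta_c : Defs.contraction Theta).

Local Notation Delta := (defect Theta).
Local Notation C := (residual_shift Theta).

Lemma residual_shiftE j f :
  C j (to_clrange Delta f) = to_clrange Delta (Defs.shift j f).
Proof.
pose B := bop_comp (onto_clrange Delta) (shift_bop j).
have BE g : B g = to_clrange Delta (Defs.shift j g) by rewrite -onto_clrangeE.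
have hB g : nrm2 (B g) <= nrm2 (Delta g).
  by rewrite BE nrm2_to_clrange !nrm2_defect // Theta_ma !nrm2_shift.
have [Z hZ] := extension hB; move: f.
apply: (@getPex _ [set C : bop (sub (clrange Delta)) (sub (clrange Delta)) |
    forall g, C (to_clrange Delta g) = to_clrange Delta (Defs.shift j g)]).
by exists Z => g; rewrite hZ BE.
Qed.

Local Notation X := (dilation_space Theta).
Local Notation M := (model_space Theta).

Definition graph_map : bop (fock J E) X := bop_pair Theta (onto_clrange Delta).

Lemma graph_mapE g : graph_map g = (Theta g, to_clrange Delta g).
Proof. by rewrite -onto_clrangeE. Qed.

Lemma graph_map_isometric : isometric graph_map.
Proof.
apply/isometric_nrm2 => g; rewrite graph_mapE nrm2_hprod nrm2_to_clrange.
by rewrite nrm2_defect // addrCA subrr addr0.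
Qed.

Lemma model_spaceP x : carrier M x <-> forall g, dot x (graph_map g) = 0.
Proof.
split=> [[_ h] g|h]; first by apply: h; exists g; rewrite graph_mapE.
by split=> // _ [g ->]; rewrite -graph_mapE.
Qed.

(** The operators whose restrictions to the model space are the [TT_j^*]. *)
Definition backward j : bop X X :=
  bop_pair (bop_comp (unshift j) (bop_fst _ _)) (bop_comp (adj (C j)) (bop_snd _ _)).

Lemma backwardE j x : backward j x = (unshift j x.1, adj (C j) x.2).
Proof. by []. Qed.

Lemma backward_graph j x g :
  dot (backward j x) (graph_map g) = dot x (graph_map (Defs.shift j g)).
Proof.
rewrite !graph_mapE backwardE !dot_hprod; congr (_ + _).
  by rewrite -[LHS]dot_shiftr -Theta_ma.
by rewrite -residual_shiftE; exact: adjPl.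
Qed.

Lemma backward_model j x : carrier M x -> carrier M (backward j x).
Proof. by move=> /model_spaceP h; apply/model_spaceP => g; rewrite backward_graph. Qed.

(** The model space is invariant under [backward j], so that an operator with the
    required adjoint exists. *)
Lemma adj_model_op j x : val (adj (model_op Theta j) x) = backward j (val x).
Proof.
pose B := corestrict (bop_comp (backward j) (Defs.incl M)) M.
have BE z : val (B z) = backward j (val z).
  by rewrite /B corestrictE //; apply: backward_model; exact: subP.
rewrite backwardE -adj_shift; move: x.
apply: (@getPex _ [set A : bop (sub M) (sub M) |
    forall x : sub M, val (adj A x) =
      (adj (@Defs.shift R J Es j) (val x).1, adj (residual_shift Theta j) (val x).2)]).
by exists (adj B) => x; rewrite adjK BE backwardE adj_shift.
Qed.

End residual_shift_theory.

Section inner_outer_model.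
Variables (R : realType) (J : choiceType) (E Es F : hilbertType R).
Variable Theta : bop (fock J E) (fock J Es).
Variable Ti : bop (fock J F) (fock J Es).
Variable To : bop (fock J E) (fock J F).
Hypotheses (Theta_ma : multi_analytic Theta) (Theta_c : Defs.contraction Theta).
Hypotheses (Ti_ma : multi_analytic Ti) (Ti_inner : Defs.inner Ti).
Hypothesis To_outer : Defs.outer To.
Hypothesis factorization : forall f, Theta f = Ti (To f).

Local Notation Delta := (defect Theta).
Local Notation C := (residual_shift Theta).
Local Notation X := (dilation_space Theta).
Local Notation M := (model_space Theta).
Local Notation Gamma := (graph_map Theta).
Local Notation H1 := (model_H1 Theta Ti To).
Local Notation H2 := (model_H2 Theta Ti To).
Local Notation TT := (model_op Theta).

Lemma nrm2_outer f : nrm2 (To f) = nrm2 (Theta f).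
Proof. by rewrite factorization ((isometric_nrm2 Ti).1 Ti_inner). Qed.

Lemma outer_contraction : Defs.contraction To.
Proof. by apply/contraction_nrm2 => f; rewrite nrm2_outer; exact: (contraction_nrm2 Theta).1. Qed.

Lemma inner_contraction : Defs.contraction Ti.
Proof. by apply/contraction_nrm2 => f; rewrite ((isometric_nrm2 Ti).1 Ti_inner). Qed.

(** [||Delta g||^2 = ||Delta_2 Theta_o g||^2 + ||Delta_1 g||^2], for the defect
    operators of the two factors. *)
Lemma fact_isoP :
  (forall f, fact_iso Theta Ti To (to_clrange Delta f) =
     (to_clrange (defect Ti) (To f), to_clrange (defect To) f)) /\
  isometric (fact_iso Theta Ti To).
Proof.
pose B : bop (fock J E) (hprod (sub (clrange (defect Ti))) (sub (clrange (defect To)))) :=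
  bop_pair (bop_comp (onto_clrange (defect Ti)) To) (onto_clrange (defect To)).
have BE f : B f = (to_clrange (defect Ti) (To f), to_clrange (defect To) f).
  by rewrite -!onto_clrangeE.
have nB f : nrm2 (B f) = nrm2 (Delta f).
  rewrite BE nrm2_hprod !nrm2_to_clrange !nrm2_defect //.
  - by rewrite -factorization addrC addrA subrK.
  - exact: outer_contraction.
  - exact: inner_contraction.
have hB f : nrm2 (B f) <= nrm2 (Delta f) by rewrite nB.
have [Z hZ] := extension hB.
have hX f : fact_iso Theta Ti To (to_clrange Delta f) =
     (to_clrange (defect Ti) (To f), to_clrange (defect To) f).
  move: f; apply: (@getPex _ [set X : bop (sub (clrange Delta))
      (hprod (sub (clrange (defect Ti))) (sub (clrange (defect To)))) |
    forall f, X (to_clrange Delta f) =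
      (to_clrange (defect Ti) (To f), to_clrange (defect To) f)]).
  by exists Z => f; rewrite hZ BE.
by split=> //; apply: isometric_clrange => f; rewrite hX -BE nB.
Qed.

(** [Delta_2 = 0] for an isometric [Theta_i]. *)
Lemma inner_defect_space (v w : sub (clrange (defect Ti))) : v = w.
Proof.
have v0 u : u = 0 :> sub (clrange (defect Ti)).
  apply: (@eq_bop_clrange _ _ _ _ _ (bop_id _) (bop0 _ _)) => f.
  apply: nrm2_eq0; rewrite -[LHS]/(nrm2 (defect Ti f)).
  rewrite nrm2_defect; last exact: inner_contraction.
  by rewrite ((isometric_nrm2 Ti).1 Ti_inner) subrr.
by rewrite (v0 v) (v0 w).
Qed.

(** [X^* X = I] and [Delta_2 = 0], so that the second component of [fact_set] takes
    every value; the first ranges over the range of [Theta_i]. *)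
Lemma clspan_factP (x : X) :
  carrier (clspan (fact_set Ti To : set X)) x <-> Ti (adj Ti x.1) = x.1.
Proof.
split=> [hx|hx].
  pose N := eq_sp (bop_comp Ti (bop_comp (adj Ti) (bop_fst (fock J Es) (sub (clrange Delta)))))
    (bop_fst _ _).
  apply: (@clspan_sub _ _ _ N _ _ hx) => _ [f [g ->]].
  change (Ti (adj Ti (Ti f)) = Ti f).
  by rewrite isometric_adjK.
apply: sub_clspan; have [_ Xiso] := fact_isoP.
exists (adj Ti x.1), (fact_iso Theta Ti To x.2).2.
have -> : (to_clrange (defect Ti) (adj Ti x.1), (fact_iso Theta Ti To x.2).2) =
    fact_iso Theta Ti To x.2.
  by rewrite [RHS]surjective_pairing; congr pair; exact: inner_defect_space.
by rewrite (isometric_adjK Xiso) hx; case: (x).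
Qed.

Lemma model_H1P (y : sub M) : carrier H1 y <-> Ti (adj Ti (val y).1) = (val y).1.
Proof.
rewrite -clspan_factP; split=> [[]//|h]; split=> //.
by case: (subP y).
Qed.

(** Subtracting from [z = (Theta_i f, u)] its projection on the graph gives a vector of
    [H_1]; so [H_2] is orthogonal to all such [z], and in particular to the one made
    from [y] itself. *)
Lemma model_H2P (y : sub M) :
  carrier H2 y <-> adj Ti (val y).1 = 0 /\ (val y).2 = 0.
Proof.
have /model_spaceP yM := subP y.
split=> [[_ hy]|[y1 y2]]; last first.
  split=> // z /model_H1P hz; rewrite dot_sub dot_hprod y2 [dot 0 _]dot0l addr0 -hz.
  by rewrite -adjPl y1 dot0l.
pose z : X := (Ti (adj Ti (val y).1), (val y).2).
pose z0 := z - Gamma (adj Gamma z).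
have z0M : carrier M z0.
  apply/model_spaceP => g; rewrite dotBl isometric_dot; last exact: graph_map_isometric.
  by rewrite adjPl subrr.
have hz0 : dot (val y) z0 = 0.
  rewrite -(dot_in_subspace y z0M).
  apply: hy; apply/model_H1P.
  change (Ti (adj Ti (Ti (adj Ti (val y).1) - Theta (adj Gamma z))) =
    Ti (adj Ti (val y).1) - Theta (adj Gamma z)).
  by rewrite factorization -(linearB Ti) isometric_adjK.
have : dot (val y) z = 0.
  by have := hz0; rewrite /z0 dotBr (yM (adj Gamma z)) subr0.
rewrite dot_hprod -[dot (val y).1 _]adjPl !dot_nrm2 -rmorphD /=.
move=> /(congr1 (@complex.Re R)) /= /eqP; rewrite paddr_eq0 ?nrm2_ge0 //.
by move=> /andP[/eqP/nrm2_eq0 -> /eqP/nrm2_eq0 ->].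
Qed.

Lemma model_H2_backward j (y : sub M) :
  carrier H2 y -> carrier H2 (adj (TT j) y).
Proof.
move=> /model_H2P[y1 y2]; apply/model_H2P; rewrite adj_model_op // backwardE.
by rewrite adj_multi_analytic // y1 y2 !linear0.
Qed.

Lemma block_H2_H1 j x : block H2 H1 (TT j) x = 0.
Proof.
apply: proj_eq0 => z /(model_H2_backward j) [_ hz].
change (dot (TT j (val x)) z = 0); rewrite adjP dotC hz ?conjC0 //.
exact: subP.
Qed.

Section C0.
Local Notation B j := (block H2 H2 (TT j)).

Let c0 (y : sub H2) : fock J Es := (val (val y)).1.

Lemma nrm2_H2 y : nrm2 (c0 y) = nrm2 y.
Proof.
have [_ y2] := (model_H2P (val y)).1 (subP y).
by rewrite [RHS]nrm2_sub nrm2_sub nrm2_hprod y2 nrm20 addr0.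
Qed.

Lemma adj_B j y : c0 (adj (B j) y) = unshift j (c0 y).
Proof.
rewrite adj_block /c0.
have h : carrier H2 (adj (TT j) (val y)) by apply: model_H2_backward; exact: subP.
rewrite -[adj (TT j) (val y)]/(val (in_subspace h)) proj_val.
by rewrite -[val (in_subspace h)]/(adj (TT j) (val y)) adj_model_op.
Qed.

Lemma wsum_B k y : wsum (fun j => adj (B j)) k y = wsum unshift k (c0 y).
Proof.
apply: eq_esum => a _; rewrite -nrm2_H2; congr (nrm2 _)%:E.
elim: a y => [//|j a IH] y.
by rewrite -[RHS]/(act unshift a (unshift j (c0 y))) -adj_B -IH.
Qed.

Lemma block_C0 : class_C0 (fun j => B j).
Proof.
split=> [|h].
  apply/row_contractionP => y; rewrite -nrm2_H2.
  under eq_esum => j _ do rewrite -nrm2_H2 adj_B.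
  exact: unshift_bound.
have -> : word_sum (fun j => B j) ^~ h = wsum unshift ^~ (c0 h).
  by apply/funext => k; rewrite word_sumE wsum_B.
exact: wsum_unshift_cvg.
Qed.

End C0.

Section C1.
Hypothesis residual_coisometric : forall k u,
  wsum (fun j => adj (C j)) k u = (nrm2 u)%:E.

Local Notation A j := (block H1 H1 (TT j)).

Let c1 (y : sub H1) : fock J F := adj Ti (val (val y)).1.
Let c2 (y : sub H1) : sub (clrange Delta) := (val (val y)).2.

Lemma inner_c1 y : Ti (c1 y) = (val (val y)).1.
Proof. exact: (model_H1P (val y)).1 (subP y). Qed.

Lemma nrm2_H1 (y : sub H1) : nrm2 y = nrm2 (c1 y) + nrm2 (c2 y).
Proof.
rewrite (nrm2_sub y) (nrm2_sub (val y)) nrm2_hprod -inner_c1.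
by rewrite ((isometric_nrm2 Ti).1 Ti_inner).
Qed.

(** [TT_j^*] followed by the projection onto [H_1]: the projection onto the range of
    [Theta_i] acts on the first component, and [Theta_i^* S_j^* = S_j^* Theta_i^*]. *)
Lemma adj_A_exists j y : exists2 w : sub H1,
  adj (A j) y = w & val (val w) = (Ti (unshift j (c1 y)), adj (C j) (c2 y)).
Proof.
pose w : X := (Ti (unshift j (c1 y)), adj (C j) (c2 y)).
have /model_spaceP yM := subP (val y).
have wM : carrier M w.
  apply/model_spaceP => g; rewrite graph_mapE dot_hprod.
  rewrite -[RHS](yM (Defs.shift j g)) graph_mapE dot_hprod; congr (_ + _).
    rewrite factorization isometric_dot // -dot_shiftr /c1 adjPl.
    by rewrite Ti_ma -factorization -Theta_ma.
  by rewrite adjPl residual_shiftE.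
have wH : carrier H1 (in_subspace wM) by apply/model_H1P; rewrite isometric_adjK.
exists (in_subspace wH) => //; apply: adj_uniq => x.
change (dot (Defs.proj H1 (TT j (val x))) y = dot x (in_subspace wH)).
have e1 : dot (Defs.proj H1 (TT j (val x))) y =
    dot (val (val x)) (backward Theta j (val (val y))).
  by rewrite dot_proj adjP (dot_sub (val x)) adj_model_op.
have e2 : dot x (in_subspace wH) = dot (val (val x)) w.
  by rewrite (dot_in_subspace x wH) (dot_in_subspace (val x) wM).
rewrite e1 e2 backwardE !dot_hprod.
congr (_ + _); rewrite -inner_c1.
change (dot (Ti (c1 x)) (unshift j (val (val y)).1) =
  dot (Ti (c1 x)) (Ti (unshift j (c1 y)))).
by rewrite isometric_dot // adjP adj_multi_analytic.
Qed.

Lemma c1_adj_A j y : c1 (adj (A j) y) = unshift j (c1 y).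
Proof.
by have [w -> hw] := adj_A_exists j y; rewrite /c1 hw isometric_adjK.
Qed.

Lemma c2_adj_A j y : c2 (adj (A j) y) = adj (C j) (c2 y).
Proof. by have [w -> hw] := adj_A_exists j y; rewrite /c2 hw. Qed.

Lemma wsum_A k y : (wsum (fun j => adj (A j)) k y =
  wsum unshift k (c1 y) + (nrm2 (c2 y))%:E)%E.
Proof.
rewrite -(residual_coisometric k) -esumD; try by move=> a _; rewrite lee_fin nrm2_ge0.
apply: eq_esum => a _; rewrite nrm2_H1 EFinD.
have E1 : c1 (act (fun j => adj (A j)) a y) = act unshift a (c1 y).
  elim: a y => [//|j a IH] y.
  by rewrite -[RHS]/(act unshift a (unshift j (c1 y))) -c1_adj_A -IH.
have E2 : c2 (act (fun j => adj (A j)) a y) = act (fun j => adj (C j)) a (c2 y).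
  elim: a y {E1} => [//|j a IH] y.
  by rewrite -[RHS]/(act (fun j => adj (C j)) a (adj (C j) (c2 y))) -c2_adj_A -IH.
by rewrite E1 E2.
Qed.

Lemma block_C1 : class_C1 (fun j => A j).
Proof.
split=> [|y y0].
  apply/row_contractionP => y.
  have -> : \esum_(j in setT) (nrm2 (adj (A j) y))%:E = wsum (fun j => adj (A j)) 1 y.
    by rewrite wsumS; apply: eq_esum => j _; rewrite wsum0.
  rewrite wsum_A nrm2_H1 EFinD leeD2r // wsumS.
  by under eq_esum => j _ do rewrite wsum0; exact: unshift_bound.
exists (nrm2 (c2 y))%:E.
  apply: contra y0 => /eqP[/nrm2_eq0 h2].
  have h1 : c1 y = 0.
    apply: ((dense_rangeP To).1 To_outer) => g.
    have /model_spaceP/(_ g) := subP (val y).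
    rewrite graph_mapE dot_hprod -[(val (val y)).2]/(c2 y) h2 [dot 0 _]dot0l addr0.
    rewrite -inner_c1 factorization isometric_dot // dotC.
    by move=> /(congr1 (fun z => z^*)); rewrite conjCK conjC0.
  by apply/eqP/nrm2_eq0; rewrite nrm2_H1 h1 h2 !nrm20 addr0.
have -> : word_sum (fun j => A j) ^~ y = (fun k => wsum unshift k (c1 y) + (nrm2 (c2 y))%:E)%E.
  by apply/funext => k; rewrite word_sumE wsum_A.
rewrite -[X in _ --> X]add0e; apply: cvgeD => //.
  exact: wsum_unshift_cvg.
exact: cvg_cst.
Qed.

End C1.
End inner_outer_model.


Theorem theorem4p6 (R : realType) (n : option nat) (H : hilbertType R)
    (T : idx n -> bop H H) (F : hilbertType R)
    (Theta_i : bop (fock (idx n) F) (fock (idx n) (sub (Dstar T))))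
    (Theta_o : bop (fock (idx n) (sub (Dspace T))) (fock (idx n) F)) :
  n <> Some 0%N ->
  row_contraction T -> cnc T ->
  multi_analytic Theta_i -> inner Theta_i ->
  multi_analytic Theta_o -> outer Theta_o ->
  (forall f, charfun T f = Theta_i (Theta_o f)) ->
  let TT := model_op (charfun T) in
  let H1 := model_H1 (charfun T) Theta_i Theta_o in
  let H2 := model_H2 (charfun T) Theta_i Theta_o in
  [/\ forall j x, block H2 H1 (TT j) x = 0,
      class_C0 (fun j => block H2 H2 (TT j)) &
      class_C1 (fun j => block H1 H1 (TT j))] /\
  (~ unitary_constant Theta_i -> ~ unitary_constant Theta_o ->
   exists M : csubspace H,
     [/\ carrier M <> [set 0], carrier M <> setT &
         forall j x, carrier M x -> carrier M (T j x)]).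
Proof.
move=> _ hT T_cnc i_ma i_inner o_ma o_outer fac TT H1 H2.
have Th_ma := charfun_multi_analytic hT; have Th_c := charfun_contraction hT.
split.
  split.
  - by move=> j x; exact: block_H2_H1.
  - exact: block_C0.
  - apply: block_C1 => // k u; apply: (residual_wsum hT T_cnc) => //.
    exact: residual_shiftE.
move=> i_nc o_nc; pose S := stable_part hT.
exists (ominus (fullsp H) S); split.
- move=> M0; apply: o_nc; apply: unitary_multi_analytic_constant => //.
  apply/isometric_nrm2 => f; rewrite -((isometric_nrm2 Theta_i).1 i_inner) -fac.
  apply: ((isometric_nrm2 (charfun T)).1 _ f); apply: (charfun_isometric (hT := hT)).
  apply: csubspace_full => x hx.
  have : carrier (ominus (fullsp H) S) x by split=> // y Sy; exact: hx.
  by rewrite M0.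
- move=> MT; apply: i_nc; apply: unitary_multi_analytic_constant => //.
  apply/dense_rangeP => y hy.
  apply: ((dense_rangeP (charfun T)).1 _) => [|f]; last by rewrite fac.
  apply: (charfun_dense (hT := hT)) => h Sh.
  have [_ /(_ h Sh)] : carrier (ominus (fullsp H) S) h by rewrite MT.
  by rewrite dot_nrm2 => /(congr1 (@complex.Re R)) /nrm2_eq0.
- move=> j x [_ hx]; split=> // y Sy.
  by rewrite adjP; apply: hx; exact: stable_part_invariant.
Qed.
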